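(* Assume that $\Omega\subset\mathbb{R}^d$ is a compact domain which satisfies an interior cone condition and has a Lipschitz boundary. Suppose that $k$ is a translational invariant kernel of finite smoothness $\tau>d/2$, and let $f\in\mathcal{H}_k(\Omega)$. Then there is a constant $c_1>0$, independent of $\gamma\in(0,1]$ and of $N\in\mathbb{N}$, such that any $\gamma$-stabilized algorithm applied to $f$ gives a sequence of point sets $X_N\subset\Omega$ such that $$\|P_N\|_{L^\infty(\Omega)}\le C_P\cdot\gamma^{-2}\cdot N^{\frac12-\frac{\tau}{d}}\qquad\text{with } C_P=2^{5\tau/d-1/2}\cdot c_1 .$$ In particular, $$\|f-\Pi_{V(X_N)}(f)\|_{L^\infty(\Omega)}\le C_P\cdot\gamma^{-2}\cdot N^{\frac12-\frac{\tau}{d}}\,\|f\|_{\mathcal{H}_k(\Omega)} .$$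
   Context: Kernels and interpolation. A kernel on $\Omega\subset\mathbb{R}^d$ is a symmetric function $k:\Omega\times\Omega\to\mathbb{R}$; it is strictly positive definite if for all finite sets of pairwise distinct points $X_N=\{x_1,\dots,x_N\}\subset\Omega$ the matrix $(k(x_i,x_j))_{i,j}$ is positive definite. Its native space $\mathcal{H}_k(\Omega)$ is the unique reproducing kernel Hilbert space of functions on $\Omega$ with reproducing kernel $k$. For a finite set $X_N=\{x_1,\dots,x_N\}\subset\Omega$ of pairwise distinct points, $V(X_N)=\mathrm{span}\{k(\cdot,x_i):x_i\in X_N\}$ and $\Pi_{V(X_N)}$ is the orthogonal projection of $\mathcal{H}_k(\Omega)$ onto $V(X_N)$; $\Pi_{V(X_N)}(f)$ is the unique element of $V(X_N)$ interpolating $f$ on $X_N$. The Power function is $P_N(x)=P_{X_N}(x)=\|k(\cdot,x)-\Pi_{V(X_N)}(k(\cdot,x))\|_{\mathcal{H}_k(\Omega)}$, with $P_{\emptyset}(x)=\|k(\cdot,x)\|_{\mathcal{H}_k(\Omega)}$. Finite smoothness. $k$ is translational invariant if $k(x,y)=\Phi(x-y)$ for some $\Phi:\mathbb{R}^d\to\mathbb{R}$. It is a kernel of finite smoothness $\tau>d/2$ if its native space is norm equivalent to the Sobolev space $W_2^\tau$; for translational invariant kernels this is the situation in which $c_\Phi(1+\|\omega\|_2^2)^{-\tau}\le\hat\Phi(\omega)\le C_\Phi(1+\|\omega\|_2^2)^{-\tau}$ for all $\omega\in\mathbb{R}^d$ with constants $c_\Phi,C_\Phi>0$, so that $\mathcal{H}_k(\mathbb{R}^d)$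 is norm equivalent to $W_2^\tau(\mathbb{R}^d)$, and it is assumed throughout that the boundary of $\Omega$ is regular enough that also $\mathcal{H}_k(\Omega)$ is norm equivalent to $W_2^\tau(\Omega)$. $\gamma$-stabilized algorithm. Let $0<\gamma\le1$ and $X_0=\emptyset$. For $N\ge0$ set $\Omega_\gamma^{(N)}=\{x\in\Omega: P_{X_N}(x)\ge\gamma\|P_{X_N}\|_{L^\infty(\Omega)}\}$. Given selection criteria $\eta^{(N)}:\Omega\to\mathbb{R}_{\ge0}$ (arbitrary, possibly depending on $f$ and $X_N$), the algorithm selects $x_{N+1}\in\arg\max_{x\in\Omega_\gamma^{(N)}}\eta^{(N)}(x)$ (any maximizer) and sets $X_{N+1}=X_N\cup\{x_{N+1}\}$. ''Any $\gamma$-stabilized algorithm'' means that the choice of $\eta^{(N)}$ is arbitrary. *)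

(* Defs.v *)
(* [R : realType] is arbitrary and R^d is ['rV[R]_d]. *)
From HB Require Import structures.
From mathcomp Require Import all_boot all_order all_algebra finmap.
From mathcomp Require Import all_classical all_reals all_analysis.
Set Implicit Arguments.
Unset Strict Implicit.
Unset Printing Implicit Defensive.
Import Order.TTheory GRing.Theory Num.Theory.
Import numFieldNormedType.Exports.
Local Open Scope classical_set_scope.
Local Open Scope ring_scope.

(* Borel structure on R^n, generated by the coordinates. *)
Section row_measurable.
Context {R : realType} {n : nat}.

Let coord (i : 'I_n) (x : 'rV[R]_n) : R := x 0 i.

Let row_set0 : g_sigma_preimage coord set0.
Proof. exact: sigma_algebra0. Qed.

Let row_setC A : g_sigma_preimage coord A -> g_sigma_preimage coord (~` A).
Proof. exact: sigma_algebraC. Qed.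

Let row_bigcup (F : (set 'rV[R]_n)^nat) :
  (forall i, g_sigma_preimage coord (F i)) ->
  g_sigma_preimage coord (\bigcup_i F i).
Proof. exact: sigma_algebra_bigcup. Qed.

HB.instance Definition _ := @isMeasurable.Build default_measure_display
  'rV[R]_n (g_sigma_preimage coord) row_set0 row_setC row_bigcup.

Lemma measurable_coord (i : 'I_n) :
  measurable_fun [set: 'rV[R]_n] (fun x : 'rV[R]_n => x 0 i).
Proof.
move=> _ Y mY; rewrite setTI; apply: sub_sigma_algebra => /=.
rewrite -bigcup_seq/=; exists i => /=; first by rewrite mem_index_enum.
by exists Y => //; rewrite setTI.
Qed.

Lemma measurable_fun_row d (T : measurableType d) (f : T -> 'rV[R]_n) :
  (forall i, measurable_fun [set: T] (fun t => f t 0 i)) ->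
  measurable_fun [set: T] f.
Proof.
move=> mf; apply: (@measurability _ _ _ _ setT f
  (\big[setU/set0]_(i < n) preimage_set_system setT (coord i) measurable)) => //.
move=> _ [A + <-]; rewrite -bigcup_seq => -[i _ [B mB <-]].
have := mf i measurableT B mB.
by rewrite !setTI.
Qed.
End row_measurable.

(* Lebesgue measure on R^n, as the n-fold product of [lebesgue_measure];
   [lebesgue_measure_row_box] is its value on boxes, which characterises it. *)
Section lebesgue_measure_row.
Context {R : realType}.

Definition row_cons n (p : measurableTypeR R * 'rV[R]_n) : 'rV[R]_n.+1 :=
  row_mx (p.1)%:M p.2.

Definition row_uncons n (x : 'rV[R]_n.+1) : measurableTypeR R * 'rV[R]_n :=
  (x 0 0, \row_i x 0 (lift 0 i)).

Lemma row_consK n : cancel (@row_cons n) (@row_uncons n).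
Proof.
move=> [a x]; rewrite /row_uncons /row_cons; congr pair => /=.
  rewrite (_ : 0 = lshift n (0 : 'I_1)); last exact/val_inj.
  by rewrite (row_mxEl (a%:M : 'rV_1)) mxE eqxx.
apply/rowP => i; rewrite mxE.
rewrite (_ : lift 0 i = rshift 1 i); last exact/val_inj.
by rewrite (row_mxEr (a%:M : 'rV_1)).
Qed.

Lemma measurable_row_cons n : measurable_fun [set: measurableTypeR R * 'rV[R]_n] (@row_cons n).
Proof.
apply: measurable_fun_row => i.
have [->|[j ->]] : i = 0 \/ exists j, i = lift 0 j.
  by case: (unliftP 0 i) => [j ->|->]; [right; exists j|left].
- rewrite (_ : (fun _ => _) = fst)//; apply/funext => p.
  by rewrite -[in RHS](row_consK p).
- rewrite (_ : (fun _ => _) = (fun x : 'rV[R]_n => x 0 j) \o snd).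
    by apply: measurableT_comp => //; exact: measurable_coord.
  by apply/funext => p /=; rewrite -[in RHS](row_consK p) /= mxE.
Qed.

Lemma measurable_row_uncons n :
  measurable_fun [set: 'rV[R]_n.+1] (@row_uncons n).
Proof.
apply/measurable_fun_pair; first exact: measurable_coord.
apply: measurable_fun_row => i.
rewrite (_ : (fun _ => _) = (fun x : 'rV[R]_n.+1 => x 0 (lift 0 i))).
  exact: measurable_coord.
by apply/funext => x; rewrite mxE.
Qed.

Section cons_measure.
Context {n : nat} (m1 : {sigma_finite_measure set (measurableTypeR R) -> \bar R})
  (mu : {sigma_finite_measure set 'rV[R]_n -> \bar R}).

Definition cons_measure : set 'rV[R]_n.+1 -> \bar R :=
  pushforward (m1 \x mu)%E (@row_cons n).

Let measurable_preimage A :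
  measurable A -> measurable (@row_cons n @^-1` A).
Proof.
by move=> mA; rewrite -[X in measurable X]setTI; exact: measurable_row_cons.
Qed.

Let cons_measure0 : cons_measure set0 = 0%E.
Proof. by rewrite /cons_measure /pushforward preimage_set0 measure0. Qed.

Let cons_measure_ge0 A : (0 <= cons_measure A)%E.
Proof. exact: (@measure_ge0 _ _ _ (m1 \x mu)%E). Qed.

Let cons_measure_sigma_additive : semi_sigma_additive cons_measure.
Proof.
move=> F mF tF mUF; rewrite /cons_measure /pushforward preimage_bigcup.
apply: measure_semi_sigma_additive.
- by move=> k; exact: measurable_preimage.
- apply/trivIsetP => /= i j _ _ ij; rewrite -preimage_setI.
  by move/trivIsetP : tF => /(_ _ _ _ _ ij) ->//; rewrite preimage_set0.
- by rewrite -preimage_bigcup; exact: measurable_preimage.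
Qed.

HB.instance Definition _ := isMeasure.Build _ _ _ cons_measure
  cons_measure0 cons_measure_ge0 cons_measure_sigma_additive.

Let cons_measure_sigma_finite : sigma_finite setT cons_measure.
Proof.
have /sigma_finiteP[F [TF ndF Foo]] := sigma_finiteT m1.
have /sigma_finiteP[G [TG ndG Goo]] := sigma_finiteT mu.
exists (fun k => @row_uncons n @^-1` (F k `*` G k)).
  rewrite -preimage_bigcup; apply/esym/seteqP; split=> // x _ /=.
  have [i _ Fi] : (\bigcup_k F k) (x 0 0) by rewrite -TF.
  have [j _ Gj] : (\bigcup_k G k) (\row_l x 0 (lift 0 l)) by rewrite -TG.
  exists (maxn i j) => //; split.
    by apply: (subsetPset _ _ (ndF _ _ (leq_maxl i j))).
  by apply: (subsetPset _ _ (ndG _ _ (leq_maxr i j))).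
move=> k; have [mF Fk] := Foo k; have [mG Gk] := Goo k; split.
  rewrite -[X in measurable X]setTI; apply: measurable_row_uncons => //.
  exact: measurableX.
rewrite /cons_measure /pushforward -comp_preimage.
rewrite (_ : _ \o _ = id) ?preimage_id; last exact/funext/row_consK.
by rewrite product_measure1E// lte_mul_pinfty// ge0_fin_numE.
Qed.

HB.instance Definition _ := Measure_isSigmaFinite.Build _ _ _ cons_measure
  cons_measure_sigma_finite.

End cons_measure.

Fixpoint lebesgue_measure_row n : {sigma_finite_measure set 'rV[R]_n -> \bar R} :=
  if n is m.+1 then cons_measure (@lebesgue_measure R) (lebesgue_measure_row m)
  else \d_(0 : 'rV[R]_0).

Lemma lebesgue_measure_row_box n (A : 'I_n -> set R) :
  (forall i, measurable (A i)) ->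
  lebesgue_measure_row n [set x | forall i, A i (x 0 i)] =
  (\prod_(i < n) lebesgue_measure (A i))%E.
Proof.
elim: n A => [|n IH] A mA.
  by rewrite big_ord0 /= diracE mem_set//; case.
have mB : measurable [set x : 'rV[R]_n | forall i, A (lift 0 i) (x 0 i)].
  rewrite [X in measurable X](_ : _ =
      \bigcap_(i : 'I_n) ((fun x : 'rV[R]_n => x 0 i) @^-1` A (lift 0 i))).
    apply: fin_bigcap_measurable => // i _.
    by rewrite -[X in measurable X]setTI; exact: (measurable_coord i) (mA _).
  by apply/seteqP; split=> x /= Ax i; [move=> _|]; exact: Ax.
rewrite big_ord_recl -IH// -product_measure1E//=; last exact: (mA ord0).
rewrite /cons_measure /pushforward; congr (_ _).
have cons0 p : @row_cons n p 0 0 = p.1 by rewrite -[in RHS](row_consK p).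
have consS p i : @row_cons n p 0 (lift 0 i) = p.2 0 i.
  by rewrite -[in RHS](row_consK p) [RHS]mxE.
apply/seteqP; split=> [p Ap|p [A0 Ap] i].
  split=> [|i]; first by move: (Ap 0); rewrite cons0.
  by move: (Ap (lift 0 i)); rewrite consS.
case: (unliftP 0 i) => [j ->|->]; last by rewrite cons0.
by rewrite consS; exact: Ap.
Qed.

End lebesgue_measure_row.

Section euclidean_space.
Context {R : realType} {d : nat}.
Implicit Types (x y : 'rV[R]_d) (Omega : set 'rV[R]_d).

Definition dotv x y : R := \sum_i x 0 i * y 0 i.

(* The library norm of ['rV[R]_d] is the maximum norm; the topology is the
   same. *)
Definition enorm x : R := Num.sqrt (dotv x x).

Definition interior_cone_condition Omega :=
  exists theta r : R, [/\ 0 < theta < pi / 2, 0 < r &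
    forall x, Omega x -> exists2 xi, enorm xi = 1 &
      forall y l, enorm y = 1 -> cos theta <= dotv y xi -> 0 <= l <= r ->
        Omega (x + l *: y)].

(* Near each boundary point, [Omega] is the closed region under the graph of a
   Lipschitz function over the hyperplane orthogonal to a unit vector [nu]; a
   function on that hyperplane is encoded as a function on R^d that is
   invariant under translation along [nu]. *)
Definition lipschitz_boundary Omega :=
  forall x, closure Omega x -> ~ Omega° x ->
    exists (nu : 'rV[R]_d) (g : 'rV[R]_d -> R) (L : R),
      [/\ enorm nu = 1,
          forall y t, g (y + t *: nu) = g y,
          forall y z, `|g y - g z| <= L * enorm (y - z) &
          \forall y \near x, Omega y <-> dotv y nu <= g y].

End euclidean_space.

Section fourier.
Context {R : realType} {d : nat}.
Local Notation mu := (@lebesgue_measure_row R d).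
Implicit Types (F : 'rV[R]_d -> R).

Definition fourier_re F (w : 'rV[R]_d) : R :=
  (2 * pi) `^ (- (d%:R / 2)) * \int[mu]_x (F x * cos (dotv x w)).

Definition fourier_im F (w : 'rV[R]_d) : R :=
  - ((2 * pi) `^ (- (d%:R / 2)) * \int[mu]_x (F x * sin (dotv x w))).

Definition cube (n : nat) : set 'rV[R]_d := [set x | forall i, `|x 0 i| <= n%:R].

(* [Fhat] is the (real valued) Fourier-Plancherel transform of [F] in L^2: the
   L^2-limit of the Fourier transforms of the truncations of [F], which are
   integrable. *)
Definition is_fourier_transform F (Fhat : 'rV[R]_d -> R) :=
  [/\ F \in Lfun mu 2%:E, Fhat \in Lfun mu 2%:E,
      ('N[mu]_2%:E[EFin \o (fourier_re (F \_ (cube n)) \- Fhat)%R])%E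
        @[n --> \oo] --> 0%E &
      ('N[mu]_2%:E[EFin \o fourier_im (F \_ (cube n))])%E
        @[n --> \oo] --> 0%E].

End fourier.

(* Sobolev(-Slobodeckij) spaces W_2^tau(U) of real order on an open set U. *)
Section sobolev.
Context {R : realType} {d : nat}.
Local Notation mu := (@lebesgue_measure_row R d).
Implicit Types (u g phi : 'rV[R]_d -> R) (U : set 'rV[R]_d).

Definition partials (s : seq 'I_d) phi : 'rV[R]_d -> R^o :=
  foldr (fun i (h : 'rV[R]_d -> R^o) => 'D_(delta_mx 0 i) h) phi s.

Definition test_function U phi :=
  [/\ forall s, continuous (partials s phi),
      forall s i x, derivable (partials s phi) x (delta_mx 0 i),
      compact (closure [set x | phi x != 0]) &
      closure [set x | phi x != 0] `<=` U].

Definition multiindex m := {ffun 'I_d -> 'I_m.+1}.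

Definition order_mi m (a : multiindex m) : nat := (\sum_i a i)%N.

Definition partial_mi m (a : multiindex m) phi : 'rV[R]_d -> R :=
  partials (flatten [seq nseq (a i) i | i <- enum 'I_d]) phi.

Definition L2_on U u := u \_ U \in Lfun mu 2%:E.

Definition weak_derivative U u m (a : multiindex m) g :=
  forall phi, test_function U phi ->
    \int[mu]_(x in U) (u x * partial_mi a phi x) =
    (-1) ^+ order_mi a * \int[mu]_(x in U) (g x * phi x).

(* [D a] is the weak derivative of order [a] of [u], for [|a| <= m]. *)
Definition weak_derivatives U u m (D : multiindex m -> 'rV[R]_d -> R) :=
  L2_on U u /\ forall a, (order_mi a <= m)%N ->
    L2_on U (D a) /\ weak_derivative U u a (D a).

Definition sobolev_sqnorm U (tau : R)
    (D : multiindex (Num.truncn tau) -> 'rV[R]_d -> R) : \bar R :=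
  let m := Num.truncn tau in
  let s := tau - m%:R in
  (\sum_(a : multiindex m | (order_mi a <= m)%N)
      \int[mu]_(x in U) ((D a x) ^+ 2)%:E
   + if (s == 0)%R then 0 else
     \sum_(a : multiindex m | order_mi a == m)
       \int[mu]_(x in U) \int[mu]_(y in U)
         ((D a x - D a y) ^+ 2 / enorm (x - y) `^ (d%:R + 2 * s))%:E)%E.

(* Weak derivatives are unique almost everywhere, so the infimum is over at
   most one value; it is +oo when [u] is not in W_2^tau(U). *)
Definition sobolev_norm U (tau : R) u : \bar R :=
  ereal_inf [set poweR (sobolev_sqnorm U D) 2^-1 |
    D in [set D | @weak_derivatives U u (Num.truncn tau) D]].

End sobolev.

Section native_space.
Context {R : realType}.

Definition symmetric_kernel (T : Type) (k : T -> T -> R) :=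
  forall x y, k x y = k y x.

(* A Hilbert space of functions on [T] (its elements are identified with
   functions through the injective evaluation [ns_eval]) with reproducing
   kernel [k]; [k] determines it up to a unique isometry compatible with
   [ns_eval]. *)
Record native_space (T : Type) (k : T -> T -> R) := NativeSpace {
  ns_space :> completeNormedModType R ;
  ns_dot : {dot ns_space for idfun} ;
  ns_normE : forall f : ns_space, `|f| ^+ 2 = ns_dot f f ;
  ns_eval : ns_space -> T -> R ;
  ns_eval_linear : forall (a : R) (f g : ns_space) x,
    ns_eval (a *: f + g) x = a * ns_eval f x + ns_eval g x ;
  ns_eval_inj : injective ns_eval ;
  ns_ker : T -> ns_space ;
  ns_kerE : forall x y, ns_eval (ns_ker x) y = k y x ;
  ns_reproducing : forall (f : ns_space) x, ns_eval f x = ns_dot f (ns_ker x) }.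

Context {T : choiceType} {k : T -> T -> R} (H : native_space k).

Definition kernel_span (X : {fset T}) : set H :=
  [set v | exists c : T -> R, v = \sum_(x <- X) c x *: ns_ker H x].

Definition projection (X : {fset T}) (f : H) : H :=
  xget 0 [set p | kernel_span X p /\
    forall v, kernel_span X v -> ns_dot H (f - p) v = 0].

Definition power_function (X : {fset T}) (x : T) : R :=
  `|ns_ker H x - projection X (ns_ker H x)|.

End native_space.

Section kernels_on_domains.
Context {R : realType} {d : nat} {Omega : set 'rV[R]_d}.
Local Notation mu := (@lebesgue_measure_row R d).

Definition extend0 (g : Omega -> R) : 'rV[R]_d -> R := 'valL_0 g.

(* Essential supremum for Lebesgue measure; the extension by zero does not
   affect it when [Omega] is not negligible. *)
Definition linf_norm (g : Omega -> R) : \bar R :=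
  ('N[mu]_+oo[EFin \o extend0 g])%E.

Definition translation_invariant (k : Omega -> Omega -> R)
    (Phi : 'rV[R]_d -> R) :=
  forall x y : Omega, k x y = Phi (\val x - \val y).

(* The native space and W_2^tau of the interior of [Omega] coincide as sets
   (of functions, resp. of classes modulo null sets), with equivalent norms. *)
Definition norm_equivalent_sobolev (k : Omega -> Omega -> R)
    (H : native_space k) (tau : R) :=
  (exists a b : R, [/\ 0 < a, 0 < b & forall h : H,
     ((a * `|h|)%:E <= sobolev_norm Omega° tau (extend0 (ns_eval h))
        <= (b * `|h|)%:E)%E]) /\
  (forall u : 'rV[R]_d -> R,
     (sobolev_norm Omega° tau u < +oo)%E ->
     exists h : H, {ae mu, forall x,
       Omega° x -> u x = extend0 (ns_eval h) x}).

(* A translation invariant kernel on R^d of smoothness [tau > d/2] has a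
   native space of continuous functions, hence [Phi = k(., 0)] is continuous;
   without continuity the Fourier bounds determine [Phi] only up to a null
   set. *)
Definition finite_smoothness (k : Omega -> Omega -> R) (H : native_space k)
    (Phi : 'rV[R]_d -> R) (tau : R) :=
  [/\ d%:R / 2 < tau,
      continuous Phi,
      exists (Phihat : 'rV[R]_d -> R) (c C : R),
        [/\ is_fourier_transform Phi Phihat, 0 < c, 0 < C &
            forall w, c * (1 + enorm w ^+ 2) `^ (- tau) <= Phihat w
                        <= C * (1 + enorm w ^+ 2) `^ (- tau)] &
      norm_equivalent_sobolev H tau].

Context {k : Omega -> Omega -> R} (H : native_space k).

Definition stabilized_domain (gamma : R) (X : {fset Omega}) : set Omega :=
  [set x | (gamma%:E * linf_norm (power_function H X)
              <= (power_function H X x)%:E)%E].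

(* [eta N f X] is the selection criterion of step [N] when the algorithm is
   applied to [f] and has selected [X]; [XN N] is the set selected after [N]
   steps, any maximizer being allowed at each step. *)
Definition stabilized_run (gamma : R)
    (eta : nat -> H -> {fset Omega} -> Omega -> R) (f : H)
    (XN : nat -> {fset Omega}) :=
  XN 0%N = fset0 /\
  forall N, exists x : Omega,
    [/\ stabilized_domain gamma (XN N) x,
        forall y, stabilized_domain gamma (XN N) y ->
          eta N f (XN N) y <= eta N f (XN N) x &
        XN N.+1 = (x |` XN N)%fset].

End kernels_on_domains.

(* Main.v *)
(* A stabilized algorithm selects points at which the power function is at
   least [gamma] times its supremum, so it is a weak greedy algorithm for the
   family of the k(., x) in the native space.  Its rate follows from the rate
   of the Kolmogorov widths of this family.

   Widths.  For x in Omega, the interior cone at x contains, at distance O(h),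
   a cube of points of a grid of mesh h, whose tensor Lagrange coefficients
   approximate cos (x.w + phi) to order min(1, h|w|)^q, uniformly in w and phi.
   With the upper bound on the Fourier transform of Phi, the squared native
   norm of the corresponding combination of kernels is at most
   C h^(2 tau) times the integral of (1 + h^2 |w|^2)^(-tau), which is
   O(h^(2 tau - d)).  The Fourier transform is only given in L^2, so this
   quadratic form is bounded by pairing Phi with products of Fejer kernels,
   whose transforms are compactly supported tents shrinking to a point.

   Greedy step.  Let v_1, ..., v_2m be the residuals, after N steps, of the
   kernels at the next 2m selected points.  Their Gram determinant is the
   product of the squared power functions at these points.  If all the v_i
   have norm at most sigma and are within delta of an m-dimensional space, the
   determinant is at most (2 sigma delta)^(2m).  Hence
   (gamma P)^2 <= 2 sigma delta after N + 2m steps, and a dyadic induction with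
   N = 2m gives the rate with the factor gamma^(-2). *)
Require Import Defs.
From HB Require Import structures.
From mathcomp Require Import all_boot all_order all_algebra finmap.
From mathcomp Require Import all_classical all_reals all_analysis.
From mathcomp Require Import qpoly measurable_realfun ess_sup_inf.
From mathcomp Require Import ring lra.
Set Implicit Arguments.
Unset Strict Implicit.
Unset Printing Implicit Defensive.
Import Order.TTheory GRing.Theory Num.Theory.
Import numFieldNormedType.Exports.
Local Open Scope classical_set_scope.
Local Open Scope ring_scope.

(** * Gram determinants *)

(** The exponent of [gamma] is the fixed point of the greedy step: if [sigma] carries gamma^(-e),
    then (gamma P)^2 <= 2 sigma delta gives P the factor gamma^(-1-e/2), and only e = 2 reproduces
    itself. Taking twice as many vectors as the dimension balances the determinant: m directions
    contribute [sigma] and m contribute [delta]. Over a doubling of N both decay at the same rate,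
    so no power of N is lost.

    The algorithm compares with an essential supremum, whereas the greedy argument needs a bound at
    every point. The two agree because the cone at any point, a boundary point included, contains
    boxes of positive measure arbitrarily close to that point, and power functions are continuous.

    On the Fourier side nothing is lost as the tents shrink: a product of Fejer kernels of parameter
    M is at most M^(2d), while its tent has mass at least a constant times M^(2d), so the quotient
    stays bounded as M tends to 0. *)

Section gram.
Context {R : realType} {V : lmodType R} (dot : {dot V for idfun}).
Implicit Types (u v e : V) (s t : R).

Lemma dotC u v : dot u v = dot v u.
Proof. by rewrite (hermC dot) expr0 mul1r. Qed.

Lemma dot_ge0 u : 0 <= dot u u.
Proof.
have [->|u0] := eqVneq u 0; first by rewrite linear0l.
by apply/ltW/neq0_dnorm_gt0.
Qed.

Lemma dot_eq0 u : (dot u u == 0) = (u == 0).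
Proof.
have [->|u0] := eqVneq u 0; first by rewrite linear0l eqxx.
by apply/gt_eqF/neq0_dnorm_gt0.
Qed.

Lemma dotDl u v w : dot (u + v) w = dot u w + dot v w.
Proof. by rewrite linearDl. Qed.
Lemma dotDr u v w : dot w (u + v) = dot w u + dot w v.
Proof. by rewrite linearDr. Qed.
Lemma dotBl u v w : dot (u - v) w = dot u w - dot v w.
Proof. by rewrite linearBl. Qed.
Lemma dotBr u v w : dot w (u - v) = dot w u - dot w v.
Proof. by rewrite linearBr. Qed.
Lemma dotZl a u v : dot (a *: u) v = a * dot u v.
Proof. by rewrite linearZl_LR. Qed.
Lemma dotZr a u v : dot u (a *: v) = a * dot u v.
Proof. by rewrite dotC dotZl dotC. Qed.
Lemma dot_suml I (r : seq I) (P : pred I) (F : I -> V) u :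
  dot (\sum_(i <- r | P i) F i) u = \sum_(i <- r | P i) dot (F i) u.
Proof. by rewrite linear_sumlz. Qed.
Lemma dot_sumr I (r : seq I) (P : pred I) (F : I -> V) u :
  dot u (\sum_(i <- r | P i) F i) = \sum_(i <- r | P i) dot u (F i).
Proof. by rewrite dotC dot_suml; apply: eq_bigr => i _; rewrite dotC. Qed.

(** Elimination one vector at a time: the residual of [u] is corrected by a multiple of the residual
    of the new vector. The [v i] may be linearly dependent. *)
Lemma orthogonal_residual (I : eqType) (r : seq I) (v : I -> V) u : uniq r ->
  exists c : I -> R, forall i, i \in r ->
    dot (u - \sum_(j <- r) c j *: v j) (v i) = 0.
Proof.
elim: r u => [|k r IH] u /=; first by exists (fun=> 0).
move=> /andP[kr ur].
have [c Hc] := IH u ur; have [b Hb] := IH (v k) ur.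
set ru := u - _ in Hc; set rv := v k - _ in Hb.
pose a := dot ru (v k) / dot rv rv.
exists (fun j => if j == k then a else c j - a * b j).
have -> : u - \sum_(j <- k :: r) (if j == k then a else c j - a * b j) *: v j =
    ru - a *: rv.
  rewrite big_cons eqxx /ru /rv.
  rewrite (_ : \sum_(j <- r) _ = \sum_(j <- r) c j *: v j - a *: \sum_(j <- r) b j *: v j).
    by rewrite scalerBr !opprD !opprK -[RHS]addrA; congr (_ + _); rewrite addrCA.
  rewrite scaler_sumr -sumrB big_seq [RHS]big_seq; apply: eq_bigr => j jr.
  rewrite ifF; first by rewrite scalerBl scalerA.
  by apply: contraNF kr => /eqP <-.
have rvE : dot rv (v k) = dot rv rv.
  rewrite {3}/rv dotBr dot_sumr big_seq big1 ?subr0// => j jr.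
  by rewrite dotZr Hb// mulr0.
move=> i; rewrite inE => /predU1P[->|ir].
  rewrite dotBl dotZl rvE; have [rv0|rv0] := eqVneq (dot rv rv) 0; last first.
    by rewrite /a divfK// subrr.
  (* A vanishing [rv] puts [v k] in the span of the earlier vectors, to which [ru] is already
     orthogonal. *)
  rewrite rv0 mulr0 subr0; move/eqP: rv0; rewrite dot_eq0 subr_eq0 => /eqP ->.
  rewrite dot_sumr big_seq big1// => j jr.
  by rewrite dotZr Hc// mulr0.
by rewrite dotBl dotZl Hc// Hb// mulr0 subr0.
Qed.

Definition gram n (v : nat -> V) : 'M[R]_n := \matrix_(i, j) dot (v i) (v j).

(** Replacing [v n] by its residual is a column operation: the matrix is block lower triangular,
    with diagonal blocks [gram n v] and [dot r r], times a unit upper triangular one. Iterated, this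
    makes the determinant the product of the squared distances to the spans of the predecessors. *)
Lemma det_gramS n (v : nat -> V) (c : nat -> R) :
  let r := v n - \sum_(j < n) c j *: v j in
  (forall i, (i < n)%N -> dot r (v i) = 0) ->
  \det (gram n.+1 v) = \det (gram n v) * dot r r.
Proof.
move=> r rv; rewrite -addn1.
pose b : 'M[R]_(1, n) := \row_j dot (v n) (v j).
pose cc : 'M[R]_(n, 1) := \col_j c j.
have vE : v n = r + \sum_(j < n) c j *: v j by rewrite subrK.
have -> : gram (n + 1) v =
    block_mx (gram n v) 0 b (dot r r)%:M *m block_mx 1%:M cc 0 1%:M.
  rewrite mulmx_block ?(mulmx1,mul1mx,mulmx0,mul0mx) ?(addr0,add0r).
  apply/matrixP => i j.
  case: (splitP i) => i' ii'; case: (splitP j) => j' jj'.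
  - rewrite (_ : i = lshift 1 i'); last exact/val_inj.
    rewrite (_ : j = lshift 1 j'); last exact/val_inj.
    by rewrite block_mxEul !mxE.
  - rewrite (_ : i = lshift 1 i'); last exact/val_inj.
    rewrite (_ : j = rshift n j'); last exact/val_inj.
    rewrite block_mxEur !mxE /= [j']ord1 addn0 vE dotDr.
    rewrite dotC rv// add0r dot_sumr; apply: eq_bigr => l _.
    by rewrite !mxE dotZr mulrC.
  - rewrite (_ : i = rshift n i'); last exact/val_inj.
    rewrite (_ : j = lshift 1 j'); last exact/val_inj.
    by rewrite block_mxEdl !mxE /= [i']ord1 addn0.
  - rewrite (_ : i = rshift n i'); last exact/val_inj.
    rewrite (_ : j = rshift n j'); last exact/val_inj.
    rewrite block_mxEdr !mxE /= [i']ord1 [j']ord1 addn0 {2}vE dotDr dotC.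
    rewrite dot_sumr eqxx mulr1n addrC; congr (_ + _); last first.
      by apply: eq_bigr => l _; rewrite !mxE dotZr mulrC.
    rewrite vE dotDr dot_sumr big1 ?addr0// => l _.
    by rewrite dotZr rv// mulr0.
by rewrite det_mulmx det_lblock det_ublock !det1 !mulr1 det_scalar1.
Qed.

Lemma gram_residual n (v : nat -> V) : exists c : nat -> R, forall i, (i < n)%N ->
  dot (v n - \sum_(j < n) c j *: v j) (v i) = 0.
Proof.
have [c Hc] := orthogonal_residual v (v n) (iota_uniq 0 n).
exists c => i ni; rewrite -(Hc i) ?mem_iota//.
by rewrite -[X in _ = dot (_ - \sum_(_ <- iota 0 X) _) _]subn0 -/(index_iota 0 n) big_mkord.
Qed.

(** Hadamard's inequality: by [det_gramS] each new vector contributes its squared residual, which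
    lies between 0 and its squared norm. *)
Lemma det_gram_bounds n (v : nat -> V) :
  0 <= \det (gram n v) <= \prod_(i < n) dot (v i) (v i).
Proof.
elim: n => [|n /andP[IH0 IH]]; first by rewrite det_mx00 big_ord0 ler01 lexx.
have [c Hc] := gram_residual n v.
rewrite (det_gramS Hc) big_ord_recr/= mulr_ge0 ?dot_ge0//=.
apply: ler_pM => //; first exact: dot_ge0.
set r := v n - _ in Hc *.
have -> : v n = r + \sum_(j < n) c j *: v j by rewrite subrK.
clearbody r; rewrite dotDl !dotDr.
have rv0 : dot r (\sum_(j < n) c j *: v j) = 0.
  by rewrite dot_sumr big1// => l _; rewrite dotZr Hc// mulr0.
by rewrite (dotC (\sum_(j < n) _) r) rv0 addr0 add0r lerDl dot_ge0.
Qed.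

(** The hypothesis bounds the error of every approximation by predecessors, hence also that of the
    orthogonal residual, which is the factor in [det_gramS]. *)
Lemma det_gram_ge n (v : nat -> V) p : 0 <= p ->
  (forall i (c : nat -> R), (i < n)%N ->
    p <= dot (v i - \sum_(j < i) c j *: v j) (v i - \sum_(j < i) c j *: v j)) ->
  p ^+ n <= \det (gram n v).
Proof.
move=> p0; elim: n => [|n IH] pv; first by rewrite det_mx00 expr0.
have [c Hc] := gram_residual n v.
rewrite (det_gramS Hc) exprSr; apply: ler_pM => //; first exact: exprn_ge0.
  by apply: IH => i c' /ltnW; exact: pv.
exact: pv.
Qed.

(* [det (G - a c c^T)] is the determinant of a bordered matrix in which [a]
   only occurs in the first row. *)
Lemma det_rank_one_affine n (G : 'M[R]_n) (c : 'cV[R]_n) a :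
  \det (G - a *: (c *m c^T)) =
  (1 - a) * \det G + a * \det (G - c *m c^T).
Proof.
pose B t : 'M[R]_(1 + n) := block_mx 1%:M (t *: c^T) c G.
have detB t : \det (B t) = \det (G - t *: (c *m c^T)).
  have -> : B t = block_mx 1%:M 0 c 1%:M *m
                  block_mx 1%:M (t *: c^T) 0 (G - t *: (c *m c^T)).
    rewrite mulmx_block ?(mulmx1,mul1mx,mulmx0,mul0mx) ?(addr0,add0r).
    by rewrite -scalemxAr addrCA subrr addr0.
  by rewrite det_mulmx det_lblock det_ublock !det1 !mul1r.
rewrite -detB -[in X in a * \det X](scale1r (c *m c^T)) -detB.
rewrite -[X in _ * \det X]subr0 -[X in G - X](scale0r (c *m c^T)) -detB.
apply: (determinant_multilinear (i0 := lshift n 0)).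
- rewrite /B /block_mx !rowKu; apply/rowP => j.
  rewrite !mxE; case: splitP => k _; rewrite !mxE; first by ring.
  by rewrite !mul0r mulr0 add0r mul1r.
- by apply/matrixP => i j; rewrite !mxE; case: splitP => k kE; rewrite ?mxE//;
    case/negP: (neq_lift (lshift n 0) i); apply/eqP/val_inj; apply: etrans (esym kE); rewrite [k]ord1.
- by apply/matrixP => i j; rewrite !mxE; case: splitP => k kE; rewrite ?mxE//;
    case/negP: (neq_lift (lshift n 0) i); apply/eqP/val_inj; apply: etrans (esym kE); rewrite [k]ord1.
Qed.

(** Shrinking the component along [e] by [s] subtracts [1 - s ^+ 2] times a rank-one matrix. The
    determinant is affine in that coefficient, and at [s = 0] it is still a Gram determinant, hence
    nonnegative; the other endpoint contributes the left-hand side. *)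
Lemma det_gram_scale n (v : nat -> V) e s : dot e e = 1 -> 0 <= s <= 1 ->
  s ^+ 2 * \det (gram n v) <=
  \det (gram n (fun i => v i - ((1 - s) * dot (v i) e) *: e)).
Proof.
move=> e1 /andP[s0 s1].
pose c : 'cV[R]_n := \col_i dot (v i) e.
have gE t : gram n (fun i => v i - ((1 - t) * dot (v i) e) *: e) =
    gram n v - (1 - t ^+ 2) *: (c *m c^T).
  apply/matrixP => i j; rewrite !mxE big_ord1 !mxE.
  by rewrite dotBl !dotBr !dotZl !dotZr e1 (dotC e (v j)); ring.
have [h _] := andP (det_gram_bounds n (fun i => v i - ((1 - 0) * dot (v i) e) *: e)).
move: h; rewrite !gE expr0n subr0 scale1r => h.
rewrite det_rank_one_affine subKr lerDl mulr_ge0//.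
by rewrite subr_ge0 expr_le1.
Qed.

Lemma orthonormal_cons e es : orthonormal dot (e :: es) =
  [&& dot e e == 1, all (fun x => dot e x == 0) es & orthonormal dot es].
Proof. by rewrite /orthonormal /= andbT -!andbA; congr (_ && _); rewrite andbCA. Qed.

Definition oproj (es : seq V) u := \sum_(e <- es) dot u e *: e.

Lemma oproj_cons e es u : oproj (e :: es) u = dot u e *: e + oproj es u.
Proof. by rewrite /oproj big_cons. Qed.

Lemma oprojB es u v : oproj es (u - v) = oproj es u - oproj es v.
Proof.
rewrite /oproj -sumrB; apply: eq_bigr => e _.
by rewrite dotBl scalerBl.
Qed.

Lemma oproj_lin I (r : seq I) (a : I -> R) (F : I -> V) es :
  oproj es (\sum_(i <- r) a i *: F i) = \sum_(i <- r) a i *: oproj es (F i).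
Proof.
under [RHS]eq_bigr do rewrite scaler_sumr.
rewrite exchange_big; apply: eq_bigr => e _.
by rewrite dot_suml scaler_suml; apply: eq_bigr => i _; rewrite dotZl scalerA.
Qed.

Lemma dot_oprojr es e u : all (fun x => dot e x == 0) es -> dot (oproj es u) e = 0.
Proof.
move=> /allP ortho; rewrite dot_suml big_seq big1// => x /ortho/eqP ex.
by rewrite dotZl (dotC x e) ex mulr0.
Qed.

Lemma dot_oproj es u e : orthonormal dot es -> e \in es -> dot (oproj es u) e = dot u e.
Proof.
elim: es => // x es IH; rewrite orthonormal_cons => /and3P[/eqP x1 xes oes].
rewrite inE oproj_cons dotDl dotZl => /predU1P[->|ees].
  by rewrite x1 mulr1 dot_oprojr// addr0.
by rewrite (eqP (allP xes _ ees)) mulr0 add0r IH.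
Qed.

Lemma dot_oproj_oproj es u : orthonormal dot es ->
  dot (oproj es u) (oproj es u) = \sum_(e <- es) dot u e ^+ 2.
Proof.
move=> oes; rewrite {2}/oproj dot_sumr big_seq [RHS]big_seq.
by apply: eq_bigr => e ees; rewrite dotZr dot_oproj.
Qed.

Lemma dot_sub_oproj es u : orthonormal dot es ->
  dot (u - oproj es u) (u - oproj es u) = dot u u - \sum_(e <- es) dot u e ^+ 2.
Proof.
move=> oes; rewrite dotBl !dotBr dot_oproj_oproj//.
rewrite (_ : dot u (oproj es u) = \sum_(e <- es) dot u e ^+ 2); last first.
  by rewrite dot_sumr; apply: eq_bigr => e _; rewrite dotZr.
rewrite (_ : dot (oproj es u) u = \sum_(e <- es) dot u e ^+ 2); first by ring.
by rewrite dotC dot_sumr; apply: eq_bigr => e _; rewrite dotZr.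
Qed.

Lemma sum_dot_sqr_le es u : orthonormal dot es ->
  \sum_(e <- es) dot u e ^+ 2 <= dot u u.
Proof. by move=> oes; rewrite -subr_ge0 -dot_sub_oproj// dot_ge0. Qed.

Lemma sub_oproj_min es u y : orthonormal dot es -> oproj es y = y ->
  dot (u - oproj es u) (u - oproj es u) <= dot (u - y) (u - y).
Proof.
move=> oes yE.
have -> : u - oproj es u = (u - y) - oproj es (u - y).
  by rewrite oprojB yE opprB addrA subrK.
by rewrite dot_sub_oproj// gerBl sumr_ge0// => e _; rewrite sqr_ge0.
Qed.

(** Dependent vectors are dropped, so [es] may be shorter than [w]; the volume cost in
    [det_gram_compress] only calls for an upper bound on its size. *)
Lemma gram_schmidt (w : seq V) : exists es : seq V,
  [/\ (size es <= size w)%N, orthonormal dot es &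
      forall x, x \in w -> oproj es x = x].
Proof.
elim: w => [|x w [es [ses oes wes]]]; first by exists [::].
pose r := x - oproj es x.
have [r0|r0] := eqVneq r 0.
  exists es; split=> //=; first by rewrite ltnW.
  move=> y; rewrite inE => /predU1P[->|/wes//].
  by apply/eqP; rewrite eq_sym -subr_eq0 -/r r0.
pose nr := Num.sqrt (dot r r).
have r1 : dot r r != 0 by rewrite dot_eq0.
have nr2 : nr ^+ 2 = dot r r by rewrite sqr_sqrtr// dot_ge0.
have nr0 : nr != 0 by rewrite -sqrf_eq0 nr2.
have rey y : y \in es -> dot r y = 0.
  by move=> yes; rewrite dotBl dot_oproj// subrr.
exists (nr^-1 *: r :: es); split=> //=.
- rewrite orthonormal_cons oes andbT; apply/andP; split.
    by rewrite dotZl dotZr -nr2 mulrA -expr2 -exprMn mulVf// expr1n.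
  by apply/allP => y /rey ry; rewrite dotZl ry mulr0.
- move=> y; rewrite inE oproj_cons dotZr => /predU1P[->|yw].
    have -> : dot x r = dot r r.
      apply/eqP; rewrite -subr_eq0 -dotBl {1}/r subKr.
      by apply/eqP/dot_oprojr; apply/allP => z /rey ->.
    by rewrite scalerA mulrAC -expr2 exprVn nr2 mulVf// scale1r subrK.
  rewrite -[in dot y r](wes _ yw) dot_oprojr ?mulr0 ?scale0r ?add0r; first exact: wes.
  by apply/allP => z /rey ->.
Qed.

(** The directions of [es] are shrunk one at a time, each at the cost of a factor s^2; by
    orthogonality, shrinking along some of them leaves the components along the others unchanged. *)
Lemma det_gram_compress n (v : nat -> V) es s : orthonormal dot es -> 0 <= s <= 1 ->
  s ^+ (2 * size es) * \det (gram n v) <=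
  \det (gram n (fun i => v i - (1 - s) *: oproj es (v i))).
Proof.
move=> + s01; elim: es => [_|e es IH].
  rewrite muln0 mul1r (_ : (fun i => _) = v)//.
  by apply/funext => i; rewrite /oproj big_nil scaler0 subr0.
rewrite orthonormal_cons => /and3P[/eqP e1 ees oes].
rewrite mulnS exprD -mulrA.
apply: (@le_trans _ _ (s ^+ 2 * \det (gram n (fun i => v i - (1 - s) *: oproj es (v i))))).
  by rewrite ler_wpM2l ?sqr_ge0// IH.
apply: le_trans (det_gram_scale _ _ e1 s01) _.
rewrite (_ : (fun i => _) = (fun i => v i - (1 - s) *: oproj (e :: es) (v i)))//.
apply/funext => i; rewrite oproj_cons dotBl dotZl dot_oprojr// mulr0 subr0.
by rewrite scalerDr scalerA opprD addrA addrAC.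
Qed.

(* Scaling [span w] by [delta / sigma] makes the parts of every [v i] along and
   across [span w] equally small, at the cost of a factor [(sigma / delta) ^ m]
   in the volume. *)
Lemma det_gram_width (T : eqType) (J : seq T) (w : T -> V) m (v : nat -> V) sigma delta :
  (size J <= m)%N -> 0 < delta <= sigma ->
  (forall i, (i < 2 * m)%N -> dot (v i) (v i) <= sigma ^+ 2 /\
    exists a : T -> R, dot (v i - \sum_(j <- J) a j *: w j)
                           (v i - \sum_(j <- J) a j *: w j) <= delta ^+ 2) ->
  \det (gram (2 * m) v) <= (2 * sigma * delta) ^+ (2 * m).
Proof.
move=> Jm /andP[d0 ds] Hv.
have s0 : 0 < sigma by exact: lt_le_trans ds.
have [es [ses oes wes]] := gram_schmidt (map w J).
pose s := delta / sigma.
have s_gt0 : 0 < s by rewrite divr_gt0.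
have s01 : 0 <= s <= 1 by rewrite ltW//= ler_pdivrMr// mul1r.
have [s_ge0 s_le1] := andP s01.
have [det0 _] := andP (det_gram_bounds (2 * m) v).
have H1 : s ^+ (2 * m) * \det (gram (2 * m) v) <= (2 * delta ^+ 2) ^+ (2 * m).
  apply: (@le_trans _ _ (s ^+ (2 * size es) * \det (gram (2 * m) v))).
    apply: ler_wpM2r => //; apply: ler_wiXn2l => //.
    by rewrite leq_mul2l /= (leq_trans ses)// size_map.
  apply: le_trans (det_gram_compress _ _ oes s01) _.
  apply: le_trans (andP (det_gram_bounds _ _)).2 _.
  rewrite -[X in _ <= _ ^+ X]card_ord -prodr_const; apply: ler_prod => i _.
  rewrite dot_ge0/=; have [vi [a va]] := Hv i (ltn_ord i).
  set u := v i in vi va *.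
  pose y := \sum_(j <- J) a j *: w j.
  have ye : oproj es y = y.
    rewrite oproj_lin big_seq [RHS]big_seq; apply: eq_bigr => j jJ.
    by rewrite wes//; apply: map_f.
  have := le_trans (sub_oproj_min u oes ye) va.
  have := sum_dot_sqr_le u oes.
  set S := \sum_(e <- es) _.
  have uu : dot u (oproj es u) = S.
    by rewrite dot_sumr; apply: eq_bigr => e _; rewrite dotZr.
  rewrite dot_sub_oproj// -/S => S1 S2.
  (* After scaling, the squared norm is s^2 S along the span plus |u|^2 - S across it; each part is
     at most [delta ^+ 2], whence the factor 2. *)
  rewrite dotBl !dotBr !dotZl !dotZr (dotC _ u) uu dot_oproj_oproj// -/S.
  have s2 : s ^+ 2 * sigma ^+ 2 = delta ^+ 2.
    by rewrite -exprMn divfK// gt_eqF.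
  have : s ^+ 2 * S <= s ^+ 2 * sigma ^+ 2.
    by rewrite ler_wpM2l ?sqr_ge0// (le_trans S1).
  rewrite s2; move: S2; set D2 := delta ^+ 2; nra.
rewrite -(@ler_pM2l _ (s ^+ (2 * m))) ?exprn_gt0// -exprMn.
rewrite (_ : s * (2 * sigma * delta) = 2 * delta ^+ 2)//.
by rewrite /s; field; rewrite gt_eqF.
Qed.
End gram.

(** * Weak greedy selection in a native space *)

Section power_function.
Context {R : realType} {T : choiceType} {k : T -> T -> R} (H : native_space k).
Implicit Types (X Y : {fset T}) (x y : T) (u v : H).
Local Notation dot := (ns_dot H).
Local Notation ker := (ns_ker H).

Lemma kernel_span0 X : kernel_span (H := H) X 0.
Proof. by exists (fun=> 0); rewrite big1// => i _; rewrite scale0r. Qed.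

Lemma kernel_spanP X a u v :
  kernel_span X u -> kernel_span X v -> kernel_span X (a *: u + v).
Proof.
move=> [b ->] [c ->]; exists (fun x => a * b x + c x).
rewrite scaler_sumr -big_split; apply: eq_bigr => x _ /=.
by rewrite scalerDl scalerA.
Qed.

Lemma kernel_spanD X u v :
  kernel_span X u -> kernel_span X v -> kernel_span X (u + v).
Proof. by move=> Xu Xv; rewrite -[u]scale1r; apply: kernel_spanP. Qed.

Lemma kernel_spanZ X a u : kernel_span X u -> kernel_span X (a *: u).
Proof. by move=> Xu; rewrite -[_ *: _]addr0; apply/kernel_spanP/kernel_span0. Qed.

Lemma kernel_spanB X u v :
  kernel_span X u -> kernel_span X v -> kernel_span X (u - v).
Proof.
by move=> Xu Xv; rewrite -scaleN1r; apply: kernel_spanD => //; exact: kernel_spanZ.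
Qed.

Lemma kernel_span_sum X (I : eqType) (r : seq I) (F : I -> H) :
  (forall i, i \in r -> kernel_span X (F i)) ->
  kernel_span X (\sum_(i <- r) F i).
Proof.
move=> XF; rewrite big_seq; elim/big_ind : _ => //; first exact: kernel_span0.
exact: kernel_spanD.
Qed.

Lemma kernel_span_ker X x : x \in X -> kernel_span X (ker x).
Proof.
move=> xX; exists (fun y => (y == x)%:R).
rewrite (bigD1_seq x)//= eqxx scale1r big1 ?addr0// => y /negbTE ->.
by rewrite scale0r.
Qed.

Lemma kernel_span_subset X Y u : (X `<=` Y)%fset ->
  kernel_span X u -> kernel_span Y u.
Proof.
move=> /fsubsetP XY [c ->]; apply: kernel_span_sum => x xX.
by apply/kernel_spanZ/kernel_span_ker/XY.
Qed.

(** [projection] is a choice with default [0]; [orthogonal_residual] shows that there is something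
    to choose. *)
Lemma projectionP X u : kernel_span X (projection X u) /\
  forall v, kernel_span X v -> dot (u - projection X u) v = 0.
Proof.
rewrite /projection; set P := (P in xget _ P).
suff : P (xget 0 P) by [].
have [c Hc] := orthogonal_residual dot ker u (fset_uniq X).
apply: (@xgetPex _ 0 P); exists (\sum_(x <- X) c x *: ker x); split; first by exists c.
move=> _ [b ->]; rewrite dot_sumr big_seq big1// => x xX.
by rewrite dotZr Hc// mulr0.
Qed.

Lemma projection_span X u : kernel_span X (projection X u).
Proof. exact: (projectionP X u).1. Qed.

Lemma projection_ortho X u v : kernel_span X v -> dot (u - projection X u) v = 0.
Proof. exact: (projectionP X u).2. Qed.

Lemma le_dot_ortho u v : dot u v = 0 -> dot u u <= dot (u + v) (u + v).
Proof.
move=> uv; rewrite dotDl !dotDr (dotC dot v u) uv addr0 add0r lerDl.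
exact: dot_ge0.
Qed.

Lemma ler_normE u v : (`|u| <= `|v|) = (dot u u <= dot v v).
Proof. by rewrite -!ns_normE ler_sqr ?nnegrE. Qed.

Lemma power_function_ge0 X x : 0 <= power_function H X x.
Proof. exact: normr_ge0. Qed.

Lemma power_function_min X x v : kernel_span X v ->
  power_function H X x <= `|ker x - v|.
Proof.
move=> Xv; rewrite /power_function ler_normE.
rewrite (_ : ker x - v = (ker x - projection X (ker x)) + (projection X (ker x) - v)).
  apply/le_dot_ortho/projection_ortho/kernel_spanB => //.
  exact: projection_span.
by rewrite addrA subrK.
Qed.

Lemma power_function_subset X Y x : (X `<=` Y)%fset ->
  power_function H Y x <= power_function H X x.
Proof.
by move=> XY; apply/power_function_min/(kernel_span_subset XY)/projection_span.
Qed.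

Lemma power_function_le_ker X x : power_function H X x <= `|ker x|.
Proof. by rewrite -[ker x in leRHS]subr0; apply/power_function_min/kernel_span0. Qed.

Lemma dot_cauchy_schwarz u v : `|dot u v| <= `|u| * `|v|.
Proof.
have [->|v0] := eqVneq v 0; first by rewrite linear0r !normr0 mulr0.
have vv : 0 < dot v v by exact: neq0_dnorm_gt0.
rewrite -ler_sqr ?nnegrE ?mulr_ge0// exprMn !ns_normE real_normK ?num_real//.
rewrite -subr_ge0 -(pmulr_rge0 _ vv).
have := dot_ge0 dot (dot v v *: u - dot u v *: v).
rewrite dotBl !dotBr !dotZl !dotZr (dotC dot v u).
by congr (_ <= _); ring.
Qed.

(** The residual of [u] is orthogonal to the span, so in the reproducing formula [ker x] may be
    replaced by its own residual, whose norm is the power function; Cauchy-Schwarz does the rest. *)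
Lemma interpolation_error X u x :
  `|ns_eval (u - projection X u) x| <= power_function H X x * `|u|.
Proof.
rewrite ns_reproducing.
have -> : dot (u - projection X u) (ker x) =
    dot (u - projection X u) (ker x - projection X (ker x)).
  by rewrite dotBr (projection_ortho _ (projection_span _ _)) subr0.
apply: le_trans (dot_cauchy_schwarz _ _) _.
rewrite mulrC; apply: ler_wpM2l => //.
rewrite ler_normE -[u in leRHS](subrK (projection X u)).
exact/le_dot_ortho/projection_ortho/projection_span.
Qed.

(** What the rate uses of the algorithm: the selection criterion has disappeared, and the comparison
    is with every point instead of an essential supremum. *)
Definition weak_greedy gamma (XN : nat -> {fset T}) :=
  forall N, exists2 x, XN N.+1 = (x |` XN N)%fset &
    forall y, gamma * power_function H (XN N) y <= power_function H (XN N) x.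

Lemma weak_greedy_subset gamma XN N M : weak_greedy gamma XN -> (N <= M)%N ->
  (XN N `<=` XN M)%fset.
Proof.
move=> XNg /subnK <-; elim: (M - N)%N => [|n IH]; first exact: fsubset_refl.
by have [x + _] := XNg (n + N)%N; rewrite addSn => ->; rewrite (fsubset_trans IH)// fsubsetU1.
Qed.

Lemma weak_greedy_step gamma XN N m (J : seq T) sigma delta :
  weak_greedy gamma XN -> 0 < gamma <= 1 -> (0 < m)%N -> (size J <= m)%N ->
  0 < delta -> (forall y, power_function H (XN N) y <= sigma) ->
  (forall x, exists a : T -> R, `|ker x - \sum_(j <- J) a j *: ker j| <= delta) ->
  forall y, (gamma * power_function H (XN (N + 2 * m)%N) y) ^+ 2 <= 2 * sigma * delta.
Proof.
move=> XNg /andP[g0 g1] m0 Jm d0 sP wd y.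
have s0 : 0 <= sigma by exact: le_trans (power_function_ge0 _ y) (sP y).
set P := power_function _ _ y; have P0 : 0 <= P by exact: power_function_ge0.
(* [det_gram_width] requires [delta <= sigma]. Otherwise monotonicity of the power functions alone
   gives (gamma P)^2 <= sigma^2 <= sigma delta. *)
have [ds|sd] := leP delta sigma; last first.
  have Ps : P <= sigma.
    exact/(le_trans _ (sP y))/power_function_subset/(weak_greedy_subset XNg)/leq_addr.
  have gP : gamma * P <= sigma by apply: le_trans Ps; rewrite ler_piMl.
  have : (gamma * P) ^+ 2 <= sigma ^+ 2 by rewrite ler_sqr ?nnegrE// mulr_ge0// ltW.
  by move=> /le_trans; apply; nra.
have /choice[x Hx] : forall i, exists x, XN i.+1 = (x |` XN i)%fset /\
    forall y, gamma * power_function H (XN i) y <= power_function H (XN i) x.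
  by move=> i; have [x] := XNg i; exists x.
pose v i := ker (x (N + i)%N) - projection (XN N) (ker (x (N + i)%N)).
have spanx i j : (j < i)%N -> kernel_span (XN (N + i)%N) (ker (x (N + j)%N)).
  move=> ji; apply: kernel_span_ker.
  have sub : (XN (N + j.+1)%N `<=` XN (N + i)%N)%fset.
    by apply: (weak_greedy_subset XNg); rewrite leq_add2l.
  apply: (fsubsetP sub).
  by rewrite addnS (Hx _).1 fset1U1.
have spanN i u : kernel_span (XN N) u -> kernel_span (XN (N + i)%N) u.
  exact/kernel_span_subset/(weak_greedy_subset XNg)/leq_addr.
(* Any approximation of [v i] by its predecessors leaves [ker (x (N + i))] minus an element of the
   span after N + i steps, so its error is at least the power function at the selected point, which
   the greedy choice and monotonicity bound below by gamma P. *)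
have low : ((gamma * P) ^+ 2) ^+ (2 * m) <= \det (gram dot (2 * m) v).
  apply: det_gram_ge; first exact: sqr_ge0.
  move=> i c im; rewrite -ns_normE ler_sqr ?nnegrE ?mulr_ge0 ?normr_ge0//; last exact: ltW.
  rewrite /v -addrA -opprD.
  apply: le_trans (_ : power_function H (XN (N + i)%N) (x (N + i)%N) <= _); last first.
    apply: power_function_min; apply: kernel_spanD.
      exact/spanN/projection_span.
    apply: kernel_span_sum => j _; apply: kernel_spanZ; apply: kernel_spanB.
      exact: spanx.
    exact/spanN/projection_span.
  apply: le_trans (_ : gamma * power_function H (XN (N + i)%N) y <= _).
    rewrite ler_pM2l//; apply/power_function_subset/(weak_greedy_subset XNg).
    by rewrite leq_add2l ltnW.
  exact: (Hx _).2.
have up : \det (gram dot (2 * m) v) <= (2 * sigma * delta) ^+ (2 * m).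
  apply: (@det_gram_width _ _ dot _ J (fun j => ker j - projection (XN N) (ker j))) => //.
    by rewrite d0.
  move=> i im; split.
    by rewrite -ns_normE ler_sqr ?nnegrE//; exact: sP.
  have [a Ha] := wd (x (N + i)%N); exists a.
  apply: (@le_trans _ _ (`|ker (x (N + i)%N) - \sum_(j <- J) a j *: ker j| ^+ 2)).
    2: by rewrite ler_sqr// nnegrE// ltW.
  rewrite ns_normE.
  set r := v i - _.
  (* Projecting off the span of [XN N] does not increase the error: the projected error [r] is
     orthogonal to [q], and their sum is the original error. *)
  pose q := projection (XN N) (ker (x (N + i)%N)) - \sum_(j <- J) a j *: projection (XN N) (ker j).
  have -> : ker (x (N + i)%N) - \sum_(j <- J) a j *: ker j = r + q.
    rewrite /r /q /v; under [X in _ - X + _]eq_bigr do rewrite scalerBr.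
    rewrite sumrB opprB addrACA subrK; congr (_ + _).
    by rewrite addrAC subrr add0r.
  apply: le_dot_ortho.
  have qX : kernel_span (XN N) q.
    apply/kernel_spanB; first exact: projection_span.
    by apply: kernel_span_sum => j _; apply/kernel_spanZ/projection_span.
  rewrite /r dotBl projection_ortho// dot_suml big1 ?subr0// => j _.
  by rewrite dotZl projection_ortho// mulr0.
have sd0 : 0 <= 2 * sigma * delta by rewrite !mulr_ge0// ltW.
have m20 : (0 < 2 * m)%N by rewrite muln_gt0.
by rewrite -(ler_pXn2r m20) ?nnegrE ?sqr_ge0//; apply: le_trans up.
Qed.

Lemma weak_greedy_rate (gamma : R) XN (alpha C0 K0 : R) :
  weak_greedy gamma XN -> 0 < gamma <= 1 -> 0 < alpha -> 0 < C0 -> 0 < K0 ->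
  (forall x, `|ker x| <= K0) ->
  (forall m, (0 < m)%N -> exists2 J : seq T, (size J <= m)%N &
    forall x, exists a : T -> R,
      `|ker x - \sum_(j <- J) a j *: ker j| <= C0 * m%:R `^ (- alpha)) ->
  forall N y, (0 < N)%N -> power_function H (XN N) y <=
    (2 * C0 / (2 `^ (- alpha)) ^+ 3 + K0 / 2 `^ (- alpha)) / 2 `^ (- alpha)
    * gamma ^- 2 * N%:R `^ (- alpha).
Proof.
move=> XNg g01 a0 C00 K00 kK wd.
have [g0 g1] := andP g01.
(* [t] is the decay over one doubling. [D] adds up two demands: [K0 <= D * t] starts the induction,
   and [2 * C0 <= D * t ^+ 3] closes its step, the cube being the gap between t^(j+1) t^j and the
   square of t^(j+2). *)
set t := 2 `^ (- alpha); set D := 2 * C0 / t ^+ 3 + K0 / t.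
have t0 : 0 < t by rewrite powR_gt0.
have t1 : t <= 1.
  by rewrite /t -[leRHS](powRr0 2) ler_powR// ?oppr_le0 ?ltW// ltr1n.
have tj j : (2 ^ j)%:R `^ (- alpha) = t ^+ j.
  by rewrite natrX -powR_mulrn// -powRrM mulrC powRrM powR_mulrn// powR_ge0.
have D1 : 2 * C0 <= D * t ^+ 3.
  rewrite /D [leRHS]mulrDl divfK ?lerDl ?gt_eqF ?exprn_gt0//.
  by rewrite mulr_ge0 ?divr_ge0 ?exprn_ge0// ltW.
have D2 : K0 <= D * t.
  rewrite /D [leRHS]mulrDl divfK ?lerDr ?gt_eqF//.
  by rewrite !mulr_ge0 ?invr_ge0 ?exprn_ge0// ltW.
have D0 : 0 < D by rewrite -(pmulr_lgt0 _ t0); exact: lt_le_trans D2.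
have [D_ge0 t_ge0] : 0 <= D /\ 0 <= t by rewrite !ltW.
have gg_ge0 : 0 <= gamma ^- 2 by rewrite invr_ge0 sqr_ge0.
have gg : 1 <= gamma ^- 2.
  by rewrite invf_ge1 ?exprn_gt0// expr_le1// ltW.
have base j : (j <= 1)%N -> forall y, power_function H (XN (2 ^ j)%N) y <= D * gamma ^- 2 * t ^+ j.
  move=> j1 y; apply: le_trans (power_function_le_ker _ _) _.
  apply: le_trans (kK y) _; apply: le_trans D2 _.
  have -> : D * gamma ^- 2 * t ^+ j = (D * t ^+ j) * gamma ^- 2 by ring.
  apply: le_trans (_ : D * t ^+ j <= _); last first.
    by rewrite ler_peMr// mulr_ge0// ?exprn_ge0.
  by rewrite ler_pM2l//; case: j j1 => [|[|]]//= _; rewrite ?expr0 ?expr1.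
have dyadic j : forall y, power_function H (XN (2 ^ j)%N) y <= D * gamma ^- 2 * t ^+ j.
  (* The step from 2^(j+1) to 2^(j+2) points uses width dimension 2^j, hence two base cases. *)
  elim: j => [|[|j] IH]; [exact: base|exact: base|move=> y].
  have [J Jm HJ] := wd (2 ^ j)%N (expn_gt0 2 j).
  have d0 : 0 < C0 * (2 ^ j)%:R `^ (- alpha).
    by rewrite mulr_gt0// powR_gt0// ltr0n expn_gt0.
  have := weak_greedy_step XNg g01 (expn_gt0 2 j) Jm d0 IH HJ y.
  rewrite -expnS addnn -mul2n -expnS tj.
  set P := power_function _ _ _ => HP.
  have P0 : 0 <= P by exact: power_function_ge0.
  have B0 : 0 <= D * gamma ^- 2 * t ^+ j.+2.
    by apply: mulr_ge0; [exact: mulr_ge0|exact: exprn_ge0].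
  rewrite -ler_sqr ?nnegrE//.
  rewrite -(ler_pM2l (exprn_gt0 2 g0)) -exprMn; apply: le_trans HP _.
  have -> : gamma ^+ 2 * (D * gamma ^- 2 * t ^+ j.+2) ^+ 2 =
      (D * t ^+ 3) * (D * gamma ^- 2 * (t ^+ j * t ^+ j * t)).
    by rewrite !exprS expr0; field; rewrite gt_eqF.
  have -> : 2 * (D * gamma ^- 2 * t ^+ j.+1) * (C0 * t ^+ j) =
      (2 * C0) * (D * gamma ^- 2 * (t ^+ j * t ^+ j * t)).
    by rewrite !exprS; ring.
  by apply: ler_wpM2r => //; rewrite !mulr_ge0// ?exprn_ge0.
move=> N y N0.
(* Rounding N down to a power of 2 costs the last division by [t]. *)
have := trunc_log_bounds (isT : (1 < 2)%N) N0.
set j := trunc_log 2 N => /andP[jN Nj].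
apply: le_trans (power_function_subset y (weak_greedy_subset XNg jN)) _.
apply: le_trans (dyadic j y) _.
have -> : D / t * gamma ^- 2 * N%:R `^ (- alpha) =
   D * gamma ^- 2 * (N%:R `^ (- alpha) / t) by ring.
apply: ler_wpM2l; first by rewrite mulr_ge0//.
rewrite ler_pdivlMr// -exprSr -tj !powRN lef_pV2 ?posrE ?powR_gt0 ?ltr0n ?expn_gt0//.
by rewrite ge0_ler_powR// ?nnegrE ?ler0n// ?(ltW a0)// ler_nat ltnW.
Qed.
End power_function.

(** * Interpolation of cosines *)

Section cosine_interpolation.
Context {R : realType}.
Implicit Types (m : nat) (t u phi theta K : R).

(** The Taylor polynomial at 0, of degree below [m], of u -> cos (u + phi). Writing derivatives of
    the cosine as phase shifts by pi/2 avoids alternating between sine and cosine: differentiation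
    just shifts [phi]. *)
Definition cos_taylor m phi : {poly R} :=
  \poly_(q < m) (cos (phi + q%:R * (pi / 2)) / q`!%:R).

Lemma deriv_cos_taylor m phi :
  (cos_taylor m.+1 phi)^`() = cos_taylor m (phi + pi / 2).
Proof.
apply/polyP => i; rewrite coef_deriv !coef_poly ltnS.
case: ifPn => _; last by rewrite mul0rn.
rewrite -mulr_natr factS natrM.
rewrite (_ : phi + _ = phi + pi / 2 + i%:R * (pi / 2)); last first.
  by rewrite -natr1; ring.
have f0 : i`!%:R != 0 :> R by rewrite pnatr_eq0 -lt0n fact_gt0.
by field; rewrite f0 nat1r pnatr_eq0.
Qed.

Lemma horner_cos_taylor0 m phi : (cos_taylor m.+1 phi).[0] = cos phi.
Proof. by rewrite horner_coef0 coef_poly /= mul0r addr0 fact0 divr1. Qed.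

Lemma mean_value (f df : R -> R) u : (forall x : R, is_derive x (1 : R) f (df x)) ->
  exists2 c, `|c| <= `|u| & f u - f 0 = df c * u.
Proof.
move=> fdf; have cf (A : set R) : {within A, continuous f}.
  apply: continuous_subspaceT => x.
  by have [h _] := fdf x; exact/differentiable_continuous/derivable1_diffP.
have [u0|u0] := leP 0 u.
  have [c] := MVT_segment u0 (fun x _ => fdf x) (cf _).
  rewrite in_itv/= subr0 => /andP[c0 cu] fE.
  by exists c => //; rewrite !ger0_norm.
have [c] := MVT_segment (ltW u0) (fun x _ => fdf x) (cf _).
rewrite in_itv/= sub0r => /andP[c0 cu] fE.
exists c; first by rewrite !ler0_norm ?lerN2// ltW.
by rewrite -opprB fE mulrN opprK.
Qed.

(** Each use of the mean value theorem trades one order for one factor [u] and a shift of the phase;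
    the factorial that integration would gain is given up. *)
Lemma cos_taylor_bound m u phi : `|cos (u + phi) - (cos_taylor m phi).[u]| <= `|u| ^+ m.
Proof.
elim: m u phi => [|m IH] u phi.
  by rewrite /cos_taylor poly_def big_ord0 horner0 subr0 expr0 cos_max.
pose f x := cos (x + phi) - (cos_taylor m.+1 phi).[x].
pose df x := cos (x + (phi + pi / 2)) - (cos_taylor m (phi + pi / 2)).[x].
have fdf (x : R) : is_derive x (1 : R) f (df x).
  have h1 : is_derive x (1 : R) (fun y : R => y + phi) 1.
    by apply: is_derive_eq; rewrite addr0.
  have h2 := @is_derive1_comp R cos (fun y => y + phi) x _ _ (is_derive_cos _) h1.
  have h3 := is_derive_poly (cos_taylor m.+1 phi) x.
  have h4 := is_deriveB h2 h3.
  by apply: is_derive_eq h4 _; rewrite mulr1 deriv_cos_taylor /df addrA cosDpihalf.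
have [c cu fE] := mean_value u fdf.
have f0 : f 0 = 0 by rewrite /f add0r horner_cos_taylor0 subrr.
rewrite -/(f u) -[f u]subr0 -f0 fE normrM exprSr.
apply: ler_pM => //; apply: le_trans (IH _ _) _.
by rewrite lerXn2r ?nnegrE.
Qed.

Lemma ler_norm_horner (p : {poly R}) t K : `|t| <= K ->
  `|p.[t]| <= \sum_(i < size p) `|p`_i| * K ^+ i.
Proof.
move=> tK; rewrite horner_coef; apply: le_trans (ler_norm_sum _ _ _) _.
apply: ler_sum => i _; rewrite normrM normrX ler_wpM2l//.
by rewrite lerXn2r ?nnegrE// (le_trans _ tK).
Qed.

(** The coefficients are the Lagrange polynomials of the nodes 0, ..., m - 1 evaluated at [t], so
    they depend on neither [theta] nor [phi]. As they reproduce polynomials of degree below [m] in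
    [t], only Taylor remainders are left. *)
Lemma cos_interpolation1 m K : (0 < m)%N -> exists2 C : R, 0 <= C &
  forall t, `|t| <= K -> exists2 c : 'I_m -> R, (forall a, `|c a| <= C) &
  forall theta phi, `|cos (t * theta + phi) -
     \sum_(a < m) c a * cos (a%:R * theta + phi)| <= C * `|theta| ^+ m.
Proof.
move=> m0; have [K0|K0] := ltP K 0.
  by exists 0 => // t tK; have := le_lt_trans tK K0; rewrite normr_lt0.
have x_inj : injective (fun i : nat => i%:R : R) by move=> i j /eqP; rewrite eqr_nat => /eqP.
pose L (a : 'I_m) : {poly R} := tnth (lagrange m (fun i : nat => i%:R : R)) a.
pose C0 : R := \sum_(a < m) \sum_(i < size (L a)) `|(L a)`_i| * K ^+ i.
have C00 : 0 <= C0.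
  by apply: sumr_ge0 => a _; apply: sumr_ge0 => i _; rewrite mulr_ge0// exprn_ge0.
have LC a t : `|t| <= K -> `|(L a).[t]| <= C0.
  move=> tK; apply: le_trans (ler_norm_horner _ tK) _.
  rewrite /C0 (bigD1 a)//= lerDl; apply: sumr_ge0 => b _; apply: sumr_ge0 => i _.
  by rewrite mulr_ge0// exprn_ge0.
pose C := C0 + (K ^+ m + \sum_(a < m) C0 * a%:R ^+ m).
have CC : 0 <= K ^+ m + \sum_(a < m) C0 * a%:R ^+ m.
  by rewrite addr_ge0 ?exprn_ge0// sumr_ge0// => a _; rewrite mulr_ge0// exprn_ge0.
exists C; first by rewrite addr_ge0.
move=> t tK; exists (fun a => (L a).[t]).
  by move=> a; apply: le_trans (LC a _ tK) _; rewrite lerDl.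
move=> theta phi.
pose P := cos_taylor m phi; pose p := P \Po (theta *: 'X).
have pE s : p.[s] = P.[s * theta] by rewrite horner_comp hornerZ hornerX mulrC.
have sp : (size p <= m)%N.
  rewrite /p; have [->|theta0] := eqVneq theta 0.
    rewrite scale0r comp_poly0r; apply: leq_trans (size_polyC_leq1 _) _.
    by [].
  by rewrite size_comp_poly2 ?size_scale ?size_polyX// size_poly.
have ptE : P.[t * theta] = \sum_(a < m) (L a).[t] * P.[a%:R * theta].
  rewrite -pE {1}(lagrange_gen m0 x_inj sp) horner_sum; apply: eq_bigr => a _.
  by rewrite hornerM hornerC pE mulrC.
(* By [ptE] the Taylor polynomial may be subtracted from every cosine without changing the
   difference. *)
rewrite (_ : cos _ - _ = (cos (t * theta + phi) - P.[t * theta]) -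
    \sum_(a < m) (L a).[t] * (cos (a%:R * theta + phi) - P.[a%:R * theta])); last first.
  under [X in _ = _ - X]eq_bigr do rewrite mulrBr.
  by rewrite sumrB -ptE opprB addrA subrK.
apply: le_trans (ler_normB _ _) _.
apply: (@le_trans _ _ ((K ^+ m + \sum_(a < m) C0 * a%:R ^+ m) * `|theta| ^+ m)); last first.
  by rewrite ler_wpM2r ?exprn_ge0// lerDr.
rewrite mulrDl; apply: lerD.
  apply: le_trans (cos_taylor_bound _ _ _) _.
  by rewrite normrM exprMn ler_wpM2r ?exprn_ge0// lerXn2r ?nnegrE.
rewrite mulr_suml; apply: le_trans (ler_norm_sum _ _ _) _.
apply: ler_sum => a _; rewrite normrM -mulrA; apply: ler_pM => //; first exact: LC.
apply: le_trans (cos_taylor_bound _ _ _) _.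
by rewrite normrM exprMn normr_nat.
Qed.

(* The arbitrary phase [phi] absorbs the other coordinates in the induction
   on [d]. *)
Lemma cos_interpolation m K d : (0 < m)%N -> exists2 C : R, 0 <= C &
  forall t : nat -> R, (forall i, (i < d)%N -> `|t i| <= K) ->
  exists (I : finType) (c : I -> R) (p : I -> nat -> nat),
  [/\ forall j i, (p j i < m)%N, \sum_j `|c j| <= C &
  forall (w : nat -> R) phi (M : R), (forall i, (i < d)%N -> `|w i| <= M) -> 0 <= M ->
    `|cos (\sum_(i < d) t i * w i + phi) -
      \sum_j c j * cos (\sum_(i < d) (p j i)%:R * w i + phi)| <= C * M ^+ m].
Proof.
move=> m0; elim: d => [|d [C C0 IH]].
  exists 1 => // t _; exists unit, (fun=> 1), (fun=> fun=> 0%N).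
  split=> //; first by rewrite (big_pred1 tt) ?normr1//; case.
  move=> w phi M _ M0; rewrite (big_pred1 tt); last by case.
  by rewrite !big_ord0 mul1r subrr normr0 mul1r exprn_ge0.
have [C1 C10 H1] := cos_interpolation1 K m0.
exists (C1 + m%:R * C1 * C); first by rewrite addr_ge0 ?mulr_ge0.
move=> t tK.
have [b bC Hb] := H1 _ (tK d (ltnSn d)).
have [I [c [p [pm cC Hc]]]] := IH t (fun i id => tK i (ltnW id)).
have sumb : \sum_a `|b a| <= m%:R * C1.
  apply: le_trans (ler_sum _ (fun a _ => bC a)) _.
  by rewrite sumr_const card_ord mulr_natl.
exists ('I_m * I)%type, (fun aj : ('I_m * I)%type => b aj.1 * c aj.2),
  (fun (aj : ('I_m * I)%type) i => if i == d then (aj.1 : nat) else p aj.2 i).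
split.
- by move=> [a j] i /=; case: ifP.
- rewrite -(pair_bigA _ (fun a j => `|b a * c j|))/=.
  under eq_bigr do under eq_bigr do rewrite normrM.
  under eq_bigr do rewrite -mulr_sumr.
  rewrite -mulr_suml; apply: (@le_trans _ _ (m%:R * C1 * C)); last by rewrite lerDr.
  by apply: ler_pM => //; exact: sumr_ge0.
move=> w phi M wM M0.
rewrite -(pair_bigA _ (fun a j => b a * c j * cos (\sum_(i < d.+1)
  (if i == d :> nat then (a : nat) else p j i)%:R * w i + phi)))/=.
have E a j : \sum_(i < d.+1) (if i == d :> nat then (a : nat) else p j i)%:R * w i + phi =
    \sum_(i < d) (p j i)%:R * w i + (a%:R * w d + phi).
  rewrite big_ord_recr/= eqxx -addrA; congr (_ + _).
  by apply: eq_bigr => i _; rewrite ltn_eqF.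
rewrite big_ord_recr/= -addrA [\sum_(i < d) _ + _]addrCA.
set S := \sum_(i < d) _.
(* The last coordinate is interpolated with the others in the phase; then each resulting cosine is
   interpolated in the others, with the last coordinate in the phase. *)
rewrite (_ : cos _ - _ = (cos (t d * w d + (S + phi)) -
     \sum_(a < m) b a * cos (a%:R * w d + (S + phi))) +
   \sum_(a < m) b a * (cos (S + (a%:R * w d + phi)) -
      \sum_j c j * cos (\sum_(i < d) (p j i)%:R * w i + (a%:R * w d + phi)))); last first.
  under [X in _ = _ + X]eq_bigr do rewrite mulrBr mulr_sumr.
  rewrite sumrB [RHS]addrA; congr (_ - _).
    rewrite -[LHS]addr0 -addrA; congr (_ + _).
    rewrite (_ : \sum_(i < m) _ = \sum_(a < m) b a * cos (a%:R * w d + (S + phi))) ?addNr//.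
    by apply: eq_bigr => a _; rewrite addrCA.
  by apply: eq_bigr => a _; apply: eq_bigr => j _; rewrite E mulrA.
apply: le_trans (ler_normD _ _) _; rewrite mulrDl; apply: lerD.
  apply: le_trans (Hb _ _) _; apply: ler_wpM2l => //.
  by rewrite lerXn2r ?nnegrE// wM.
apply: le_trans (ler_norm_sum _ _ _) _.
apply: (@le_trans _ _ (\sum_(a < m) `|b a| * (C * M ^+ m))).
  apply: ler_sum => a _; rewrite normrM ler_wpM2l//; apply: Hc => // i id.
  exact/wM/ltnW.
by rewrite -mulr_suml mulrA ler_wpM2r ?exprn_ge0// ler_wpM2r.
Qed.
End cosine_interpolation.

(** * Fourier transforms of Fejer kernels *)

Section one_variable_integrals.
Context {R : realType}.
Local Notation mu := (@lebesgue_measure R).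
Local Open Scope ereal_scope.

(** Lebesgue measure is [a] times its pushforward under the affine map, by uniqueness from the
    values on half-open intervals. *)
Lemma ge0_integral_affine (f : R -> \bar R) (a b : R) : (0 < a)%R ->
  measurable_fun [set: R] f -> (forall x, 0 <= f x) ->
  \int[mu]_x f (a * x + b)%R = a^-1%:E * \int[mu]_x f x.
Proof.
move=> a0 mf f0.
have ma : measurable_fun [set: measurableTypeR R]
    (fun x : measurableTypeR R => (a * x + b)%R : measurableTypeR R).
  by apply: measurable_funD => //; exact: measurable_funM.
pose c : {nonneg R} := NngNum (ltW a0).
have muE A : measurable A ->
    mu A = mscale c (pushforward mu (fun x : measurableTypeR R => (a * x + b)%R : measurableTypeR R)) A.
  move=> mA; apply: lebesgue_measure_unique => // _ [[u v]] _ <-.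
  have preE : (fun x : measurableTypeR R => (a * x + b)%R) @^-1` `]u, v]%classic =
      `](u - b) / a, (v - b) / a]%classic%R.
    by apply/seteqP; split => x /=; rewrite !in_itv/= ltr_pdivrMr// ler_pdivlMr//;
      rewrite ltrBlDr lerBrDr mulrC.
  change (mu `]u, v]%classic = a%:E * mu ((fun x : measurableTypeR R => (a * x + b)%R) @^-1` `]u, v]%classic)).
  rewrite preE.
  rewrite !lebesgue_measure_itv/= !lte_fin ltr_pM2r ?invr_gt0// ltrD2r.
  case: ifPn => _; last by rewrite mule0.
  by rewrite -!EFinB -EFinM; congr EFin; field; rewrite gt_eqF.
rewrite [in RHS](eq_measure_integral (mscale c (pushforward mu
  (fun x : measurableTypeR R => (a * x + b)%R : measurableTypeR R)))); last first.
  by move=> A mA _; exact: muE.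
rewrite ge0_integral_mscale//= ge0_integral_pushforward//.
by rewrite muleA -EFinM mulVf ?mul1e// gt_eqF.
Qed.

Lemma cvg_powR_pinfty0 (c : R) : (0 < c)%R ->
  ((1 + (t : R)) `^ (- c))%R @[t --> +oo%R] --> (0 : R)%R.
Proof.
move=> c0; apply/cvgrPdist_lt => e e0.
near=> t.
have t0 : (0 < t)%R by near: t; exact: nbhs_pinfty_gt.
have t1 : (0 < 1 + t)%R by rewrite addr_gt0.
rewrite sub0r normrN ger0_norm ?powR_ge0// powRN.
rewrite invf_plt ?posrE ?powR_gt0//.
have -> : (e^-1 = (e^-1 `^ c^-1) `^ c)%R.
  by rewrite -powRrM mulVf ?gt_eqF// powRr1// invr_ge0 ltW.
rewrite gt0_ltr_powR// ?nnegrE ?powR_ge0 ?(ltW t1)//.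
apply: (@lt_le_trans _ _ t); last by rewrite lerDr.
by near: t; exact: nbhs_pinfty_gt.
Unshelve. all: by end_near. Qed.

Lemma integral_powR_tail (s : R) : (1 < s)%R ->
  \int[mu]_(t in `[0%R, +oo[) ((1 + t) `^ (- s))%R%:E < +oo.
Proof.
move=> s1; have s0 : (1 - s < 0)%R by rewrite subr_lt0.
pose F (t : R) := ((1 - s)^-1 * (1 + t) `^ (1 - s))%R.
have t1 (t : R) : (0 <= t)%R -> (0 < 1 + t)%R by move=> t0; rewrite ltr_pwDl.
have dF (t : R) : (0 <= t)%R -> is_derive t 1%R F ((1 + t) `^ (- s))%R.
  move=> t0; rewrite /F.
  have h1 := is_derive1_powR (1 - s) (t1 _ t0).
  have h2 : is_derive t 1%R (fun x => 1 + x : R)%R 1%R.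
    by apply: is_derive_eq; rewrite add0r mulr1.
  have h3 := @is_derive1_comp R (fun y : R => y `^ (1 - s))%R (fun x => 1 + x : R)%R t _ _ h1 h2.
  have := is_deriveZ (1 - s)^-1%R h3.
  move=> h4; apply: is_derive_eq h4 _.
  rewrite mulr1 /GRing.scale/= mulrA mulVf ?lt_eqF// mul1r.
  by congr (_ `^ _)%R; ring.
rewrite (@ge0_continuous_FTC2y _ _ F _ 0%R); first by rewrite -EFinB ltry.
- by move=> x x0; exact: powR_ge0.
- apply: continuous_in_subspaceT => x; rewrite inE/= in_itv/= andbT => x0.
  have [h _] := is_derive1_powR (- s) (t1 _ x0).
  apply: (@continuous_comp _ _ _ (fun x : R => 1 + x)%R (fun y : R => y `^ (- s))%R).
    by apply: continuousD; [exact: cst_continuous|exact: cvg_id].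
  exact/differentiable_continuous/derivable1_diffP.
- rewrite -[X in _ --> X](mulr0 (1 - s)^-1%R).
  apply: cvgM; first exact: cvg_cst.
  rewrite (_ : (1 - s = - (s - 1))%R); last by rewrite opprB.
  by apply: cvg_powR_pinfty0; rewrite subr_gt0.
- by move=> x x0; have [] := dF x (ltW x0).
- apply: cvg_at_right_filter.
  have [h _] := dF 0%R (lexx _).
  exact/differentiable_continuous/derivable1_diffP.
- move=> x; rewrite in_itv/= andbT => x0.
  by rewrite derive1E; have [_ ->] := dF x (ltW x0).
Qed.

Lemma continuous_japanese (s : R) : continuous (fun t : R => (1 + t ^+ 2) `^ (- s))%R.
Proof.
move=> x; have x1 : (0 < 1 + x ^+ 2)%R by rewrite ltr_pwDl// sqr_ge0.
have [h _] := is_derive1_powR (- s) x1.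
apply: (@continuous_comp _ _ _ (fun x : R => 1 + x ^+ 2)%R (fun y : R => y `^ (- s))%R).
  by apply: continuousD; [exact: cst_continuous|exact: exprn_continuous].
exact/differentiable_continuous/derivable1_diffP.
Qed.

(** By symmetry the half-line suffices, and there (1 + x)^2 <= 2 (1 + x^2) reduces the integrand to
    one with an explicit primitive. *)
Lemma integral_japanese_lty (s : R) : (1 / 2 < s)%R ->
  \int[mu]_t ((1 + t ^+ 2) `^ (- s))%R%:E < +oo.
Proof.
move=> s2; rewrite ge0_symfun_integralT; last first.
- by move=> x; rewrite /= sqrrN.
- exact: continuous_japanese.
- by move=> x; exact: powR_ge0.
apply: lte_mul_pinfty => //.
have mJ (A : set R) : measurable_fun A (fun t => ((1 + t) `^ (- (2 * s)))%R%:E).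
  apply/measurable_EFinP; apply: measurable_funTS.
  apply: (measurableT_comp (measurable_powR _)).
  exact: measurable_funD.
rewrite -set_itvcy.
apply: (@le_lt_trans _ _ (\int[mu]_(t in `[0%R, +oo[)
    ((2 `^ s)%R%:E * ((1 + t) `^ (- (2 * s)))%R%:E))).
  apply: ge0_le_integral => //.
  - by move=> x _; rewrite lee_fin powR_ge0.
  - apply/measurable_EFinP; apply: measurable_funTS.
    by apply: continuous_measurable_fun; exact: continuous_japanese.
  - exact: (measurable_funeM _ (mJ _)).
  - move=> x /=; rewrite in_itv/= andbT => x0.
    have x1 : (0 < 1 + x)%R by rewrite ltr_pwDl.
    have x2 : (0 < 1 + x ^+ 2)%R by rewrite ltr_pwDl// sqr_ge0.
    have s0 : (0 <= s)%R by apply: le_trans (ltW s2); rewrite divr_ge0.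
    rewrite -EFinM lee_fin !powRN ler_pdivlMr ?powR_gt0// ler_pdivrMl ?powR_gt0//.
    rewrite powRrM powR_mulrn ?(ltW x1)// mulrC -powRM ?(ltW x2)//.
    rewrite ge0_ler_powR// ?nnegrE ?sqr_ge0 ?mulr_ge0// ?(ltW x2)//.
    by have := sqr_ge0 (x - 1)%R; rewrite !expr2; nra.
rewrite ge0_integralZl//; first last.
- by move=> x _; rewrite lee_fin powR_ge0.
- exact: mJ.
apply: lte_mul_pinfty; [by rewrite lee_fin powR_ge0|by []|].
by apply: integral_powR_tail; rewrite -ltr_pdivrMl// mulrC.
Qed.
End one_variable_integrals.

(** * Fejer kernels and tents in one variable *)

Section fejer.
Context {R : realType}.
Local Notation mu := (@lebesgue_measure R).
Implicit Types (a w x y z M : R).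

(* At [w = 0] this is [0], not the limit [a ^+ 2 / 2]; all the identities below
   hold there as well. *)
Definition fejer a w : R := (1 - cos (a * w)) / w ^+ 2.

Lemma fejer_ge0 a w : 0 <= fejer a w.
Proof. by rewrite divr_ge0 ?sqr_ge0// subr_ge0 cos_le1. Qed.

Lemma one_sub_cos_le w : 1 - cos w <= w ^+ 2.
Proof.
have := cos_taylor_bound 2 w 0; rewrite addr0 real_normK ?num_real//.
rewrite /cos_taylor horner_poly !big_ord_recl big_ord0 /=.
rewrite (_ : 0 + (bump 0 0)%:R * (pi / 2) = pi / 2); last by rewrite add0r mul1r.
rewrite cos_pihalf !mul0r !addr0 cos0 fact0 divr1 expr0 mulr1.
by rewrite ler_norml => /andP[]; lra.
Qed.

Lemma fejer_le a w : fejer a w <= a ^+ 2.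
Proof.
have [->|w0] := eqVneq w 0.
  by rewrite /fejer expr0n invr0 mulr0 sqr_ge0.
rewrite ler_pdivrMr ?exprn_even_gt0// -exprMn; exact: one_sub_cos_le.
Qed.

Lemma fejer1_le w : fejer 1 w <= 4 * (1 + w ^+ 2) `^ (- 1).
Proof.
have w1 : 0 < 1 + w ^+ 2 by rewrite ltr_pwDl// sqr_ge0.
rewrite powR_inv1 ?(ltW w1)// ler_pdivlMr//.
have [->|w0] := eqVneq w 0.
  by rewrite /fejer expr0n invr0 mulr0 mul0r.
have w2 : 0 < w ^+ 2 by rewrite exprn_even_gt0.
rewrite /fejer mul1r mulrAC ler_pdivrMr//.
have := one_sub_cos_le w; have := cos_geN1 w; have := cos_le1 w.
set c := cos w; set W := w ^+ 2 in w1 w2 * => c1 cN1 cW.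
have [W1|W1] := leP W 1; nra.
Qed.

Lemma measurable_fejer a : measurable_fun [set: R] (fejer a).
Proof.
rewrite (_ : fejer a = (fun w => (1 - cos (a * w)) * (w ^+ 2) `^ (- 1))); last first.
  by apply/funext => w; rewrite powR_inv1// sqr_ge0.
apply: measurable_funM.
  apply: measurable_funB => //.
  apply: (@measurableT_comp _ _ _ _ _ _ (@cos R) _ (fun w => a * w)).
    by apply: continuous_measurable_fun; exact: continuous_cos.
  exact: measurable_funM.
apply: (@measurableT_comp _ _ _ _ _ _ (fun x : R => x `^ (- 1)) _ (fun w => w ^+ 2)).
  exact: measurable_powR.
exact: measurable_funX.
Qed.

(* The value is [pi], but only positivity matters. *)
Definition kappa : R := \int[mu]_w fejer 1 w.

Lemma integrable_fejer1 : mu.-integrable [set: R] (EFin \o fejer 1).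
Proof.
apply/integrableP; split; first by apply/measurable_EFinP; exact: measurable_fejer.
apply: (@le_lt_trans _ _ (\int[mu]_t (4%:E * ((1 + t ^+ 2) `^ (- 1))%:E))%E).
  apply: ge0_le_integral => //.
  - by apply: measurableT_comp => //; by apply/measurable_EFinP; exact: measurable_fejer.
  - apply: measurable_funeM; apply/measurable_EFinP.
    by apply: continuous_measurable_fun; exact: continuous_japanese.
  - by move=> w _ /=; rewrite lee_fin ger0_norm ?fejer_ge0// fejer1_le.
rewrite ge0_integralZl//.
- by apply: lte_mul_pinfty => //; apply: integral_japanese_lty; lra.
- apply/measurable_EFinP.
  by apply: continuous_measurable_fun; exact: continuous_japanese.
- by move=> x _; rewrite lee_fin powR_ge0.
Qed.

(** By homogeneity [fejer a w] is a^2 times [fejer 1 (a * w)], and the substitution takes one factor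
    back. *)
Lemma ge0_integral_fejer a : (\int[mu]_w (fejer a w)%:E = (`|a| * kappa)%:E)%E.
Proof.
wlog a0 : a / 0 <= a.
  move=> H; have [|a0] := leP 0 a; first exact: H.
  rewrite -normrN -H ?oppr_ge0 ?ltW//; apply: eq_integral => w _.
  by rewrite /fejer mulNr cosN.
rewrite ger0_norm//; have [->|an0] := eqVneq a 0.
  rewrite mul0r integral0_eq// => w _.
  by rewrite /fejer mul0r cos0 subrr mul0r.
have a_gt0 : 0 < a by rewrite lt_neqAle eq_sym an0.
have E w : (fejer a w)%:E = ((a ^+ 2)%:E * (EFin \o fejer 1) (a * w + 0)%R)%E.
  rewrite /= -EFinM addr0 /fejer mul1r exprMn; congr EFin.
  have [->|w0] := eqVneq w 0; first by rewrite !expr0n !mulr0 !invr0 !mulr0.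
  by field; rewrite w0 an0.
under eq_integral do rewrite E.
have mf := measurable_fejer 1.
rewrite ge0_integralZl//; first last.
- by rewrite lee_fin sqr_ge0.
- by move=> w _; rewrite /= lee_fin fejer_ge0.
- apply/measurable_EFinP; apply: (measurableT_comp mf).
  by apply: measurable_funD => //; exact: measurable_funM.
rewrite ge0_integral_affine//; first last.
- by move=> w; rewrite /= lee_fin fejer_ge0.
- exact/measurable_EFinP.
have -> : (\int[mu]_w (EFin \o fejer 1) w = kappa%:E)%E.
  by rewrite /kappa /Rintegral fineK// integrable_fin_num// integrable_fejer1.
by rewrite -!EFinM; congr EFin; field.
Qed.

Lemma integrable_fejer a : mu.-integrable [set: R] (EFin \o fejer a).
Proof.
apply/integrableP; split; first by apply/measurable_EFinP; exact: measurable_fejer.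
under eq_integral do rewrite /= ger0_norm ?fejer_ge0//.
by rewrite ge0_integral_fejer ltry.
Qed.

Lemma integral_fejer a : \int[mu]_w fejer a w = `|a| * kappa.
Proof. by rewrite /Rintegral ge0_integral_fejer. Qed.

Lemma kappa_gt0 : 0 < kappa.
Proof.
(* On the interval from pi/2 to pi/2 + 1 the cosine is at most 0, so the numerator of [fejer 1] is
   at least 1 and [c] bounds the kernel from below. *)
pose c : R := (pi / 2 + 1) ^- 2.
have pi2 : 0 < pi / 2 + 1 :> R by rewrite addr_gt0// divr_gt0// pi_gt0.
have c0 : 0 < c by rewrite invr_gt0 exprn_gt0.
rewrite -lte_fin -[kappa]mul1r -[X in X * _]normr1 -ge0_integral_fejer.
apply: (@lt_le_trans _ _ (\int[mu]_(w in `[(pi / 2)%R, (pi / 2 + 1)%R]) (cst c%:E) w)%E).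
  rewrite integral_cst//= lebesgue_measure_itv/= lte_fin ltrDl ltr01.
  by rewrite -EFinB -EFinM lte_fin mulr_gt0// addrAC subrr add0r.
apply: (@le_trans _ _ (\int[mu]_(w in `[(pi / 2)%R, (pi / 2 + 1)%R]) (fejer 1 w)%:E)%E).
  apply: ge0_le_integral => //.
  - by move=> w _; rewrite lee_fin ltW.
  - by apply/measurable_EFinP; apply: measurable_funTS; exact: measurable_fejer.
  - move=> w /=; rewrite in_itv/= => /andP[w1 w2]; rewrite lee_fin.
    have w0 : 0 < w by apply: lt_le_trans w1; rewrite divr_gt0// pi_gt0.
    have cw : cos w <= 0.
      rewrite -[w](subrK (pi / 2)) cosDpihalf oppr_le0 sin_ge0_pi//.
      by rewrite subr_ge0 w1/= lerBlDr; have := pi_ge2 R; lra.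
    rewrite /fejer mul1r /c ler_pdivlMr ?exprn_gt0// mulrC ler_pdivrMr ?exprn_gt0//.
    have : w ^+ 2 <= (pi / 2 + 1) ^+ 2 by rewrite ler_sqr ?nnegrE // ltW.
    have := exprn_gt0 2 pi2; nra.
apply: ge0_subset_integral => //.
- by apply/measurable_EFinP; exact: measurable_fejer.
- by move=> w _; rewrite lee_fin fejer_ge0.
Qed.

(** For [0 <= M] this is max (0, M - |y|), written as a second difference of the absolute value to
    match [fejer_cos] and [integral_fejer]. *)
Definition tent M y := `|y + M| / 2 + `|y - M| / 2 - `|y|.

(* As the integral of [fejer a] is proportional to [`|a|], this identity yields
   the Fourier transform of [fejer M]. *)
Lemma fejer_cos M y w :
  fejer M w * cos (y * w) = fejer (y + M) w / 2 + fejer (y - M) w / 2 - fejer y w.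
Proof.
rewrite /fejer (mulrDl y M w) (mulrBl w y M) cosD cosB.
by set W := (w ^+ 2)^-1; field.
Qed.

Lemma integral_fejer_cos M y : \int[mu]_w (fejer M w * cos (y * w)) = kappa * tent M y.
Proof.
have If a : mu.-integrable [set: R] (EFin \o (fun w => fejer a w / 2)).
  rewrite (_ : _ \o _ = (fun w => (2^-1)%:E * (EFin \o fejer a) w)%E).
    by apply: integrableZl => //; exact: integrable_fejer.
  by apply/funext => w /=; rewrite -EFinM mulrC.
under eq_Rintegral do rewrite fejer_cos.
rewrite RintegralB//=; first last.
- exact: integrable_fejer.
- exact: (integrableD measurableT (If (y + M)) (If (y - M))).
rewrite RintegralD// !RintegralZr//; try exact: integrable_fejer.
by rewrite !integral_fejer /tent; ring.
Qed.

(** Reflection exchanges the positive and the negative part. If their common integral is infinite,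
    the value 0 is the convention of [fine]. *)
Lemma Rintegral_odd (f : R -> R) : measurable_fun [set: R] f ->
  (forall x, f (- x) = - f x) -> \int[mu]_x f x = 0.
Proof.
move=> mf oddf; rewrite /Rintegral integralE.
set F : R -> \bar R := fun x => (f x)%:E.
have mF : measurable_fun [set: R] F by exact/measurable_EFinP.
have -> : (\int[mu]_x F^\- x = \int[mu]_x F^\+ x)%E.
  rewrite (eq_measure_integral (pushforward mu
    (-%R : measurableTypeR R -> measurableTypeR R))); last first.
    by move=> A mA _; apply/esym; exact: lebesgue_measureN.
  rewrite ge0_integral_pushforward//=; last exact: measurable_funeneg.
  apply: eq_integral => x _ /=.
  by rewrite funenegE funeposE /F oddf -EFinN opprK.
have : (0 <= \int[mu]_x F^\+ x)%E by exact: integral_ge0.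
by case: (\int[mu]_x F^\+ x)%E => [r _||]//=; rewrite subrr.
Qed.

Lemma integral_fejer_sin M y : \int[mu]_w (fejer M w * sin (y * w)) = 0.
Proof.
apply: Rintegral_odd => [|w].
  apply: measurable_funM; first exact: measurable_fejer.
  apply: (@measurableT_comp _ _ _ _ _ _ (@sin R) _ (fun w => y * w)).
    by apply: continuous_measurable_fun; exact: continuous_sin.
  exact: measurable_funM.
by rewrite /fejer !mulrN cosN sinN sqrrN mulrN.
Qed.

Lemma tent_ge0 M y : 0 <= M -> 0 <= tent M y.
Proof. by rewrite /tent; case: (ger0P (y + M)); case: (ger0P (y - M)); case: (ger0P y); lra. Qed.

Lemma tent_le M y : 0 <= M -> tent M y <= M.
Proof. by rewrite /tent; case: (ger0P (y + M)); case: (ger0P (y - M)); case: (ger0P y); lra. Qed.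

Lemma tent_eq0 M y : 0 <= M -> M <= `|y| -> tent M y = 0.
Proof. by rewrite /tent; case: (ger0P (y + M)); case: (ger0P (y - M)); case: (ger0P y); lra. Qed.

Lemma tent_ge M y : 0 <= M -> `|y| <= M / 2 -> M / 2 <= tent M y.
Proof. by rewrite /tent; case: (ger0P (y + M)); case: (ger0P (y - M)); case: (ger0P y); lra. Qed.

Lemma continuous_tent M : continuous (tent M).
Proof.
move=> y; rewrite /tent; apply: cvgB; last exact: norm_continuous.
by apply: cvgD; apply: cvgMl; apply: cvg_norm; [apply: cvgD|apply: cvgB];
  [exact: cvg_id|exact: cvg_cst|exact: cvg_id|exact: cvg_cst].
Qed.

Lemma measurable_tent M : measurable_fun [set: R] (tent M).
Proof. by apply: continuous_measurable_fun; exact: continuous_tent. Qed.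

Lemma integral_tent_shift M z : 0 <= M ->
  (\int[mu]_y (tent M (y - z))%:E = \int[mu]_y (tent M y)%:E)%E.
Proof.
move=> M0; rewrite -[RHS]mul1e -[X in (X%:E * _)%E]invr1.
rewrite -(@ge0_integral_affine _ _ 1 (- z))//.
- by apply: eq_integral => y _; rewrite mul1r.
- by apply/measurable_EFinP; exact: measurable_tent.
- by move=> x; rewrite lee_fin tent_ge0.
Qed.

(** Only the order M^2 of the lower bound matters: in [cos_sum_bound] it cancels the M^2 of
    [fejer_le]. *)
Lemma integral_tent_bounds M : 0 < M ->
  ((M ^+ 2 / 2)%:E <= \int[mu]_y (tent M y)%:E < +oo)%E.
Proof.
move=> M0; have M_ge0 := ltW M0.
have mT (A : set R) : measurable_fun A (fun y => (tent M y)%:E).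
  by apply/measurable_EFinP; apply: measurable_funTS; exact: measurable_tent.
apply/andP; split.
  apply: (@le_trans _ _ (\int[mu]_(y in `[(- (M / 2))%R, (M / 2)%R]) (cst (M / 2)%:E) y)%E).
    rewrite integral_cst//= lebesgue_measure_itv/= lte_fin.
    rewrite ifT; last by lra.
    by rewrite -EFinB -EFinM lee_fin; nra.
  apply: (@le_trans _ _ (\int[mu]_(y in `[(- (M / 2))%R, (M / 2)%R]) (tent M y)%:E)%E).
    apply: ge0_le_integral => //.
    - by move=> y _; rewrite lee_fin; lra.
    - exact: mT.
    - move=> y /= yM; rewrite lee_fin tent_ge// ler_norml.
      by move: yM; rewrite ?in_itv.
  apply: ge0_subset_integral => //; first exact: mT.
  by move=> y _; rewrite lee_fin tent_ge0.
apply: (@le_lt_trans _ _ (\int[mu]_(y in `[(- M)%R, M]) (cst M%:E) y)%E).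
  rewrite [leRHS]integral_mkcond; apply: ge0_le_integral => //.
  - by move=> y _; rewrite lee_fin tent_ge0.
  - exact: mT.
  - by apply/(measurable_restrictT _ _).1.
  - move=> y _; rewrite patchE; case: ifPn => [_|].
      by rewrite lee_fin tent_le.
    rewrite notin_setE => yM; rewrite tent_eq0//.
    rewrite leNgt; apply/negP => yM'; apply: yM => /=.
    by rewrite in_itv/= -ler_norml ltW.
rewrite integral_cst//= lebesgue_measure_itv/= lte_fin.
by case: ifPn => _; rewrite -?EFinB -?EFinM ?mule0 ltry.
Qed.
End fejer.

(** * Integrals over R^n by splitting off the first coordinate *)

Section row_integrals.
Context {R : realType}.
Local Notation leb := (@lebesgue_measure R).
Local Notation mu n := (@lebesgue_measure_row R n).

Definition row_tail n (x : 'rV[R]_n.+1) : 'rV[R]_n := (row_uncons x).2.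

Lemma row_tailE n (x : 'rV[R]_n.+1) i : row_tail x 0 i = x 0 (lift 0 i).
Proof. by rewrite mxE. Qed.

Lemma measurable_row_tail n : measurable_fun [set: 'rV[R]_n.+1] (@row_tail n).
Proof. exact: (measurableT_comp measurable_snd (@measurable_row_uncons R n)). Qed.

Lemma row_cons_head n (p : measurableTypeR R * 'rV[R]_n) : row_cons p 0 0 = p.1.
Proof. by rewrite -[in RHS](row_consK p). Qed.

Lemma row_cons_tail n (p : measurableTypeR R * 'rV[R]_n) : row_tail (row_cons p) = p.2.
Proof. by rewrite -[in RHS](row_consK p). Qed.

Lemma ge0_integral_row_split n (f : 'rV[R]_n.+1 -> \bar R) :
  measurable_fun [set: 'rV[R]_n.+1] f -> (forall x, 0 <= f x)%E ->
  (\int[mu n.+1]_x f x = \int[leb]_a \int[mu n]_x f (row_cons (a, x)))%E.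
Proof.
move=> mf f0; rewrite [LHS](_ : _ = \int[(leb \x mu n)]_p f (row_cons p))%E.
  rewrite fubini_tonelli1//.
  exact: (measurableT_comp mf (@measurable_row_cons R n)).
exact: (ge0_integral_pushforward (@measurable_row_cons R n)).
Qed.

Lemma measurable_row_tensor n (u : R -> R) (v : 'rV[R]_n -> R) :
  measurable_fun [set: R] u -> measurable_fun [set: 'rV[R]_n] v ->
  measurable_fun [set: 'rV[R]_n.+1] (fun x : 'rV[R]_n.+1 => u (x 0 0) * v (row_tail x)).
Proof.
move=> mu mv; apply: measurable_funM.
  exact: (measurableT_comp mu (measurable_coord 0)).
exact: (measurableT_comp mv (@measurable_row_tail n)).
Qed.

Lemma ge0_integral_row_tensor n (u : R -> R) (v : 'rV[R]_n -> R) :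
  measurable_fun [set: R] u -> measurable_fun [set: 'rV[R]_n] v ->
  (forall a, 0 <= u a) -> (forall x, 0 <= v x) ->
  (\int[mu n.+1]_x (u (x 0 0) * v (row_tail x))%:E =
   \int[leb]_a (u a)%:E * \int[mu n]_x (v x)%:E)%E.
Proof.
move=> mu mv u0 v0; rewrite ge0_integral_row_split; first last.
- by move=> x; rewrite lee_fin mulr_ge0.
- by apply/measurable_EFinP; exact: measurable_row_tensor.
rewrite -ge0_integralZr//; first last.
- by apply: integral_ge0 => x _; rewrite lee_fin.
- by move=> x _; rewrite lee_fin.
- exact/measurable_EFinP.
apply: eq_integral => a _.
rewrite -ge0_integralZl//; first last.
- by rewrite lee_fin.
- by move=> x _; rewrite lee_fin.
- exact/measurable_EFinP.
by apply: eq_integral => x _; rewrite row_cons_head row_cons_tail EFinM.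
Qed.

Lemma integrable_row_tensor n (u : R -> R) (v : 'rV[R]_n -> R) :
  leb.-integrable [set: R] (EFin \o u) -> (mu n).-integrable [set: 'rV[R]_n] (EFin \o v) ->
  (mu n.+1).-integrable [set: 'rV[R]_n.+1]
    (EFin \o (fun x : 'rV[R]_n.+1 => u (x 0 0) * v (row_tail x))).
Proof.
move=> /integrableP[/measurable_EFinP mu iu] /integrableP[/measurable_EFinP mv iv].
apply/integrableP; split; first by apply/measurable_EFinP; exact: measurable_row_tensor.
under eq_integral do rewrite /= normrM.
rewrite (@ge0_integral_row_tensor n (fun a => `|u a|) (fun x => `|v x|))//; first last.
- exact: measurableT_comp.
- exact: measurableT_comp.
by apply: lte_mul_pinfty => //; [exact: integral_ge0|rewrite ge0_fin_numE//; exact: integral_ge0].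
Qed.

Lemma Rintegral_row_tensor n (u : R -> R) (v : 'rV[R]_n -> R) :
  leb.-integrable [set: R] (EFin \o u) -> (mu n).-integrable [set: 'rV[R]_n] (EFin \o v) ->
  \int[mu n.+1]_x (u (x 0 0) * v (row_tail x)) =
  (\int[leb]_a u a) * (\int[mu n]_x v x).
Proof.
move=> iu iv.
have iuv := integrable_row_tensor iu iv.
pose F (x : 'rV[R]_n.+1) : \bar R := (u (x 0 0) * v (row_tail x))%:E.
have /integrableP[muv Fy] : (mu n.+1).-integrable setT F by [].
have irc : (leb \x mu n)%E.-integrable setT (F \o @row_cons R n).
  apply/integrableP; split; first exact: (measurableT_comp muv (@measurable_row_cons R n)).
  rewrite (_ : (\int[_]_x _)%E = \int[mu n.+1]_x `|F x|)%E//; apply/esym.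
  apply: (ge0_integral_pushforward (@measurable_row_cons R n)) => //.
  exact: measurableT_comp.
rewrite /Rintegral.
rewrite (_ : (\int[mu n.+1]_x (u (x 0 0) * v (row_tail x))%:E =
  \int[(leb \x mu n)]_p F (row_cons p))%E); last first.
  exact: (integral_pushforward (@measurable_row_cons R n) muv).
rewrite -(integral12_prod_meas1 irc).
have vfin := integrable_fin_num measurableT iv.
have ufin := integrable_fin_num measurableT iu.
rewrite (_ : (\int[leb]_a _)%E =
    (\int[leb]_a ((u a)%:E * \int[mu n]_x (v x)%:E))%E); last first.
  apply: eq_integral => a _; rewrite -integralZl//; apply: eq_integral => x _.
  by rewrite /F /= row_cons_head row_cons_tail EFinM.
rewrite -(fineK vfin)/= integralZr//.
by rewrite fineM.
Qed.

Lemma measurable_tensor n (g : 'I_n -> R -> R) :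
  (forall i, measurable_fun [set: R] (g i)) ->
  measurable_fun [set: 'rV[R]_n] (fun x => \prod_(i < n) g i (x 0 i)).
Proof.
move=> mg; apply: measurable_prod => i _.
exact: (measurableT_comp (mg i) (measurable_coord i)).
Qed.

Lemma tensorS n (g : 'I_n.+1 -> R -> R) (x : 'rV[R]_n.+1) :
  \prod_(i < n.+1) g i (x 0 i) =
  g 0 (x 0 0) * \prod_(i < n) g (lift 0 i) (row_tail x 0 i).
Proof. by rewrite big_ord_recl; under [in RHS]eq_bigr do rewrite row_tailE. Qed.

Lemma integral_row0 (f : 'rV[R]_0 -> \bar R) : measurable_fun setT f ->
  (\int[mu 0]_x f x = f 0%R)%E.
Proof. by move=> mf; rewrite /= integral_dirac// diracT mul1e. Qed.

Lemma ge0_integral_tensor n (g : 'I_n -> R -> R) :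
  (forall i, measurable_fun [set: R] (g i)) -> (forall i a, 0 <= g i a) ->
  (\int[mu n]_x (\prod_(i < n) g i (x 0 i))%:E =
   \prod_(i < n) \int[leb]_a (g i a)%:E)%E.
Proof.
elim: n g => [|n IH] g mg g0.
  rewrite integral_row0 ?big_ord0//.
  by apply/measurable_EFinP; exact: measurable_tensor.
rewrite big_ord_recl -IH//; under eq_integral do rewrite tensorS.
rewrite (@ge0_integral_row_tensor n (g 0)
  (fun x => \prod_(i < n) g (lift 0 i) (x 0 i)))//.
- exact: (measurable_tensor (fun i => mg (lift 0 i))).
- by move=> x; exact: prodr_ge0.
Qed.

Lemma integrable_tensor n (g : 'I_n -> R -> R) :
  (forall i, leb.-integrable [set: R] (EFin \o g i)) ->
  (mu n).-integrable [set: 'rV[R]_n] (EFin \o (fun x : 'rV[R]_n => \prod_(i < n) g i (x 0 i))).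
Proof.
elim: n g => [|n IH] g ig.
  apply/integrableP; split.
    by apply/measurable_EFinP; apply: measurable_tensor => -[].
  rewrite integral_row0 ?ltry//.
  by apply: measurableT_comp => //; apply/measurable_EFinP; apply: measurable_tensor => -[].
apply: (eq_integrable measurableT _ _ _
  (integrable_row_tensor (ig 0) (IH _ (fun i => ig (lift 0 i))))).
by move=> x _ /=; rewrite tensorS.
Qed.

Lemma dotvS n (x y : 'rV[R]_n.+1) :
  dotv x y = x 0 0 * y 0 0 + dotv (row_tail x) (row_tail y).
Proof.
by rewrite /dotv big_ord_recl; under [in RHS]eq_bigr do rewrite !row_tailE.
Qed.

Lemma measurable_dotv n (y : 'rV[R]_n) : measurable_fun [set: 'rV[R]_n] (fun w => dotv y w).
Proof.
apply: measurable_sum => i; apply: measurable_funM => //.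
exact: measurable_coord.
Qed.

Lemma measurable_cosT : measurable_fun [set: R] (@cos R).
Proof. by apply: continuous_measurable_fun; exact: continuous_cos. Qed.

Lemma measurable_sinT : measurable_fun [set: R] (@sin R).
Proof. by apply: continuous_measurable_fun; exact: continuous_sin. Qed.

Lemma le_integrable_bounded d (T : measurableType d) (m : {measure set T -> \bar R})
  (u b : T -> R) : measurable_fun [set: T] b -> (forall x, `|b x| <= 1) ->
  m.-integrable [set: T] (EFin \o u) ->
  m.-integrable [set: T] (EFin \o (fun x => u x * b x)).
Proof.
move=> mb b1 iu; apply: (le_integrable measurableT _ _ iu).
  have /integrableP[/measurable_EFinP mu _] := iu.
  by apply/measurable_EFinP; exact: measurable_funM.
by move=> x _ /=; rewrite lee_fin normrM ler_piMr.
Qed.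

(** The real form of factorising the exponential of a sum. The addition formulas split each
    integrand into two tensor products; those containing the sine of the first coordinate integrate
    to 0. *)
Lemma integral_tensor_cos n (g : 'I_n -> R -> R) (y : 'rV[R]_n) :
  (forall i, leb.-integrable [set: R] (EFin \o g i)) ->
  (forall i, \int[leb]_a (g i a * sin (y 0 i * a)) = 0) ->
  \int[mu n]_w (\prod_(i < n) g i (w 0 i) * cos (dotv y w)) =
    \prod_(i < n) \int[leb]_a (g i a * cos (y 0 i * a)) /\
  \int[mu n]_w (\prod_(i < n) g i (w 0 i) * sin (dotv y w)) = 0.
Proof.
elim: n g y => [|n IH] g y ig gs.
  have mh (h : R -> R) : measurable_fun setT h -> measurable_fun [set: 'rV[R]_0]
      (fun w => (\prod_(i < 0) g i (w 0 i) * h (dotv y w))%:E).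
    move=> mh; apply/measurable_EFinP/measurable_funM.
      by apply: measurable_tensor => -[].
    by apply: (measurableT_comp mh); exact: measurable_dotv.
  rewrite /Rintegral (integral_row0 (mh _ measurable_cosT)).
  rewrite (integral_row0 (mh _ measurable_sinT)) /=.
  by rewrite !big_ord0 !mul1r /dotv big_ord0 cos0 sin0.
set u := g 0; set v := fun x : 'rV[R]_n => \prod_(i < n) g (lift 0 i) (x 0 i).
have iv : (mu n).-integrable setT (EFin \o v) by exact: (integrable_tensor (fun i => ig (lift 0 i))).
have yt i : row_tail y 0 i = y 0 (lift 0 i) by rewrite row_tailE.
have [IHc IHs] := IH (fun i => g (lift 0 i)) (row_tail y) (fun i => ig _)
  (fun i => etrans (congr1 (fun t => \int[leb]_a (g (lift 0 i) a * sin (t * a))) (yt i)) (gs _)).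
have mtrig (h : R -> R) a : measurable_fun setT h -> measurable_fun [set: R] (fun w => h (a * w)).
  move=> mh; apply: (measurableT_comp mh); exact: measurable_funM.
have mtrigv (h : R -> R) : measurable_fun setT h ->
    measurable_fun [set: 'rV[R]_n] (fun w => h (dotv (row_tail y) w)).
  by move=> mh; apply: (measurableT_comp mh); exact: measurable_dotv.
have iuc : leb.-integrable setT (EFin \o (fun a => u a * cos (y 0 0 * a))).
  apply: (le_integrable_bounded _ _ (ig 0)) => [|x]; last exact: cos_max.
  by apply: mtrig; exact: measurable_cosT.
have ius : leb.-integrable setT (EFin \o (fun a => u a * sin (y 0 0 * a))).
  apply: (le_integrable_bounded _ _ (ig 0)) => [|x]; last exact: sin_max.
  by apply: mtrig; exact: measurable_sinT.
have ivc : (mu n).-integrable setT (EFin \o (fun w : 'rV[R]_n => v w * cos (dotv (row_tail y) w))).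
  apply: (le_integrable_bounded _ _ (iv)) => [|x]; last exact: cos_max.
  by apply: mtrigv; exact: measurable_cosT.
have ivs : (mu n).-integrable setT (EFin \o (fun w : 'rV[R]_n => v w * sin (dotv (row_tail y) w))).
  apply: (le_integrable_bounded _ _ (iv)) => [|x]; last exact: sin_max.
  by apply: mtrigv; exact: measurable_sinT.
have HC : \int[leb]_a (u a * sin (y 0 0 * a)) = 0 := gs 0.
split.
  under eq_Rintegral => w _.
    rewrite tensorS dotvS cosD mulrBr.
    rewrite [X in X - _]mulrACA [X in _ - X]mulrACA -/u -/(v (row_tail w)). over.
  rewrite RintegralB//; last 2 first.
  - exact: (integrable_row_tensor iuc ivc).
  - exact: (integrable_row_tensor ius ivs).
  rewrite (Rintegral_row_tensor iuc ivc) (Rintegral_row_tensor ius ivs).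
  rewrite HC mul0r subr0 IHc big_ord_recl.
  by under [in LHS]eq_bigr do rewrite yt.
under eq_Rintegral => w _.
  rewrite tensorS dotvS sinD mulrDr.
  rewrite [X in X + _]mulrACA [X in _ + X]mulrACA -/u -/(v (row_tail w)). over.
rewrite RintegralD//; last 2 first.
- exact: (integrable_row_tensor ius ivc).
- exact: (integrable_row_tensor iuc ivs).
rewrite (Rintegral_row_tensor ius ivc) (Rintegral_row_tensor iuc ivs).
by rewrite HC IHs mul0r mulr0 addr0.
Qed.
End row_integrals.

(** * Measurability and integrability on product spaces *)

Section product_integrals.
Context d1 d2 (T1 : measurableType d1) (T2 : measurableType d2) (R : realType).
Variables (m1 : {sigma_finite_measure set T1 -> \bar R})
  (m2 : {sigma_finite_measure set T2 -> \bar R}).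

Lemma measurable_integral_fst (f : T1 * T2 -> R) : measurable_fun setT f ->
  measurable_fun setT (fun y => \int[m1]_x f (x, y)).
Proof.
move=> mf; have mF : measurable_fun setT (EFin \o f) by exact/measurable_EFinP.
apply: (@measurableT_comp _ _ _ _ _ _ (@fine R)) => //.
rewrite (_ : (fun y => _) = (fun y => \int[m1]_x ((EFin \o f)^\+ (x, y)) -
    \int[m1]_x ((EFin \o f)^\- (x, y)))%E); last first.
  apply/funext => y; rewrite [LHS]integralE; congr (_ - _)%E;
    by apply: eq_integral => x _; rewrite ?funeposE ?funenegE.
apply: emeasurable_funB.
- apply: measurable_fun_fubini_tonelli_G => //.
  exact: measurable_funepos.
- apply: measurable_fun_fubini_tonelli_G => //.
  exact: measurable_funeneg.
Qed.

Lemma integrable_prod (u : T1 -> R) (v : T2 -> R) :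
  m1.-integrable setT (EFin \o u) -> m2.-integrable setT (EFin \o v) ->
  (m1 \x m2)%E.-integrable setT (EFin \o (fun p : T1 * T2 => u p.1 * v p.2)).
Proof.
move=> /integrableP[/measurable_EFinP mu iu] /integrableP[/measurable_EFinP mv iv].
have mf : measurable_fun setT (EFin \o (fun p : T1 * T2 => u p.1 * v p.2)).
  by apply/measurable_EFinP; apply: measurable_funM; exact: measurableT_comp.
apply/integrable12ltyP => //=.
rewrite (_ : (\int[m1]_x _)%E = (\int[m1]_x `|(u x)%:E| * \int[m2]_y `|(v y)%:E|)%E).
  apply: lte_mul_pinfty => //; first exact: integral_ge0.
  by rewrite ge0_fin_numE//; exact: integral_ge0.
rewrite -ge0_integralZr//; first last.
- exact: integral_ge0.
- by do 2 apply: measurableT_comp => //.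
apply: eq_integral => x _; rewrite -ge0_integralZl//.
- by apply: eq_integral => y _; rewrite -abseM.
- by do 2 apply: measurableT_comp => //.
Qed.
End product_integrals.

(** * Pairing a Fourier-Plancherel transform with a test function *)

Section fourier_pairing.
Context {R : realType} {d : nat}.
Local Notation leb := (@lebesgue_measure R).
Local Notation mu := (@lebesgue_measure_row R d).
Implicit Types (F G : 'rV[R]_d -> R) (z : 'rV[R]_d).

Lemma measurable_cos_dotv : measurable_fun setT
  (fun p : 'rV[R]_d * 'rV[R]_d => cos (dotv p.1 p.2)).
Proof.
apply: (measurableT_comp (@measurable_cosT R)).
apply: measurable_sum => i; apply: measurable_funM.
  exact: (measurableT_comp (measurable_coord i)).
exact: (measurableT_comp (measurable_coord i)).
Qed.

Lemma dotvC (x y : 'rV[R]_d) : dotv x y = dotv y x.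
Proof. by apply: eq_bigr => i _; rewrite mulrC. Qed.

Lemma measurable_fourier_re F : measurable_fun setT F -> measurable_fun setT (fourier_re F).
Proof.
move=> mF; apply: measurable_funM => //.
apply: (@measurable_integral_fst _ _ _ _ _ mu (fun p : 'rV[R]_d * 'rV[R]_d => F p.1 * cos (dotv p.1 p.2))).
by apply: measurable_funM; [exact: measurableT_comp|exact: measurable_cos_dotv].
Qed.

(** The multiplication formula: the cosine moves from F to G by Fubini, the integrand being
    dominated by the tensor product of two integrable functions. *)
Lemma fourier_pairing F G :
  mu.-integrable setT (EFin \o F) -> mu.-integrable setT (EFin \o G) ->
  mu.-integrable setT (EFin \o (fun w => fourier_re F w * G w)) /\
  \int[mu]_w (fourier_re F w * G w) =
  (2 * pi) `^ (- (d%:R / 2)) * \int[mu]_x (F x * \int[mu]_w (G w * cos (dotv x w))).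
Proof.
move=> iF iG.
have /integrableP[/measurable_EFinP mF _] := iF.
have /integrableP[/measurable_EFinP mG _] := iG.
pose P (p : 'rV[R]_d * 'rV[R]_d) := G p.1 * F p.2 * cos (dotv p.2 p.1).
have iP : (mu \x mu)%E.-integrable setT (EFin \o P).
  apply: (le_integrable_bounded _ _ (integrable_prod iG iF)).
    by under eq_fun do rewrite dotvC; exact: measurable_cos_dotv.
  by move=> p; exact: cos_max.
have cosF w : mu.-integrable setT (EFin \o (fun x => F x * cos (dotv x w))).
  apply: (le_integrable_bounded _ _ iF) => [|x]; last exact: cos_max.
  apply: (measurableT_comp (@measurable_cosT R)).
  by under eq_fun do rewrite dotvC; exact: measurable_dotv.
have cosG x : mu.-integrable setT (EFin \o (fun w => G w * cos (dotv x w))).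
  apply: (le_integrable_bounded _ _ iG) => [|w]; last exact: cos_max.
  apply: (measurableT_comp (@measurable_cosT R)); exact: measurable_dotv.
have E1 w : (\int[mu]_x (EFin \o P) (w, x) =
    (G w * \int[mu]_x (F x * cos (dotv x w)))%:E)%E.
  rewrite -RintegralZl// fineK; last first.
    exact: (integrable_fin_num measurableT (integrableZl measurableT (G w) (cosF w))).
  by apply: eq_integral => x _; rewrite /P /= mulrA.
have E2 x : (\int[mu]_w (EFin \o P) (w, x) =
    (F x * \int[mu]_w (G w * cos (dotv x w)))%:E)%E.
  rewrite -RintegralZl// fineK; last first.
    exact: (integrable_fin_num measurableT (integrableZl measurableT (F x) (cosG x))).
  by apply: eq_integral => w _; rewrite /P /= mulrA [F x * _]mulrC.
have iG' : mu.-integrable setT (EFin \o (fun w => G w * \int[mu]_x (F x * cos (dotv x w)))).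
  by apply: (eq_integrable measurableT _ _ _ (integrable_fubini_F iP)) => w _; exact: E1.
pose C : R := (2 * pi) `^ (- (d%:R / 2)).
split.
  apply: (eq_integrable measurableT _ _ _ (integrableZl measurableT C iG')) => w _ /=.
  by rewrite -EFinM /fourier_re -/C mulrA mulrAC.
under eq_Rintegral => w _.
  rewrite /fourier_re -mulrA [X in _ * X]mulrC. over.
rewrite (RintegralZl _ measurableT iG'); congr (_ * fine _).
transitivity (\int[mu]_w \int[mu]_x (EFin \o P) (w, x))%E.
  by apply: eq_integral => w _; rewrite E1.
by rewrite (Fubini iP); apply: eq_integral => x _; rewrite E2.
Qed.

Lemma Lfun_sq_integrable F : measurable_fun setT F ->
  mu.-integrable setT (EFin \o (fun x => F x ^+ 2)) -> F \in Lfun mu 2%:E.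
Proof.
move=> mF /integrableP[_ i2]; rewrite inE; apply/andP; split; rewrite inE/=//.
rewrite /finite_norm unlock poweR_lty//.
apply: le_lt_trans i2; apply: ge0_le_integral => //.
- by move=> x _; rewrite poweR_ge0.
- apply/measurable_EFinP.
  apply: (@measurableT_comp _ _ _ _ _ _ (fun x : R => x `^ 2) _ (fun x => `|F x|)).
    exact: measurable_powR.
  exact: measurableT_comp.
- by apply: measurableT_comp => //; apply/measurable_EFinP; exact: measurable_funX.
- by move=> x _ /=; rewrite lee_fin normrX -powR_mulrn.
Qed.

Lemma measurable_cube n : measurable (cube (R := R) (d := d) n).
Proof.
rewrite (_ : cube n = \bigcap_(i : 'I_d) ((fun x : 'rV[R]_d => x 0 i) @^-1` `[(- n%:R)%R, n%:R%R]%classic)).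
  apply: fin_bigcap_measurable => // i _.
  by rewrite -[X in measurable X]setTI; exact: (measurable_coord i).
apply/seteqP; split=> x /= Hx i; first by move=> _ /=; rewrite in_itv/= -ler_norml.
by have := Hx i I; rewrite /= in_itv/= -ler_norml.
Qed.

Lemma cube_measure_lty n : (mu (cube n) < +oo)%E.
Proof.
pose A (i : 'I_d) : set R := `[(- n%:R)%R, n%:R%R]%classic.
rewrite (_ : cube n = [set x | forall i, A i (x 0 i)]); last first.
  by apply/seteqP; split=> x Hx i; have := Hx i; rewrite /A/= in_itv/= -ler_norml.
rewrite lebesgue_measure_row_box => [|i]; last exact: measurable_itv.
have Afin i : (0 <= leb (A i) < +oo)%E.
  rewrite measure_ge0/= /A lebesgue_measure_itv/=; case: ifPn => _ //.
  by rewrite -EFinB ltry.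
have : forall s : seq 'I_d, (0 <= \prod_(i <- s) leb (A i) < +oo)%E; last first.
  by move=> /(_ (index_enum 'I_d))/andP[].
elim => [|i s /andP[s0 sy]]; first by rewrite big_nil lee_fin ler01 ltry.
have /andP[i0 iy] := Afin i.
by rewrite big_cons mule_ge0//= lte_mul_pinfty// ge0_fin_numE.
Qed.

(** Hoelder's inequality against the indicator of a cube, which has finite measure. *)
Lemma integrable_truncation F n : F \in Lfun mu 2%:E ->
  mu.-integrable setT (EFin \o (F \_ (cube n))).
Proof.
move=> F2; have mF : measurable_fun setT F.
  by move: F2; rewrite inE => /andP[+ _]; rewrite inE.
have mc := measurable_cube n.
have ic : (\1_(cube n) : 'rV[R]_d -> R) \in Lfun mu 2%:E.
  apply: Lfun_sq_integrable => //.
  apply/integrableP; split.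
    by apply/measurable_EFinP; exact: measurable_funX.
  rewrite (eq_integral (fun x => (\1_(cube n) x)%:E)); last first.
    by move=> x _ /=; rewrite indicE; case: (x \in _); rewrite ?expr1n ?expr0n/= ?normr1 ?normr0.
  by rewrite integral_indic// setIT; exact: cube_measure_lty.
have /Lfun1_integrable := Lfun2_mul_Lfun1 F2 ic.
apply: eq_integrable => // x _ /=.
by rewrite patchE indicE; case: ifPn => _; rewrite ?mulr1 ?mulr0.
Qed.

(** Pairing with a square-integrable G is continuous for L^2 convergence, so the multiplication
    formula passes to the limit. The truncated pairings are assumed eventually constant, as happens
    when the cosine transform of G has compact support. *)
Lemma fourier_transform_pairing F Fhat G A n0 : is_fourier_transform F Fhat ->
  mu.-integrable setT (EFin \o G) -> G \in Lfun mu 2%:E ->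
  (forall n, (n0 <= n)%N ->
    \int[mu]_x ((F \_ (cube n)) x * \int[mu]_w (G w * cos (dotv x w))) = A) ->
  \int[mu]_w (Fhat w * G w) = (2 * pi) `^ (- (d%:R / 2)) * A.
Proof.
move=> [F2 Fh2 reF _] iG G2 HA.
have mF : measurable_fun setT F.
  by move: F2; rewrite inE => /andP[+ _]; rewrite inE.
have mFh : measurable_fun setT Fhat.
  by move: Fh2; rewrite inE => /andP[+ _]; rewrite inE.
have mG : measurable_fun setT G.
  by move: G2; rewrite inE => /andP[+ _]; rewrite inE.
have iFhG : mu.-integrable setT (EFin \o (fun w => Fhat w * G w)).
  by have /Lfun1_integrable := Lfun2_mul_Lfun1 Fh2 G2.
set B := _ * A.
pose D n := (fourier_re (F \_ (cube n)) \- Fhat)%R.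
have mre n : measurable_fun setT (fourier_re (F \_ (cube n))).
  apply: measurable_fourier_re.
  by apply: (proj1 (measurable_restrictT F (measurable_cube n))); exact: measurable_funTS.
have bnd n : (n0 <= n)%N ->
    (`|B - \int[mu]_w (Fhat w * G w)|%:E <= 'N[mu]_2%:E[EFin \o D n] * 'N[mu]_2%:E[EFin \o G])%E.
  move=> n0n.
  have [ireG reGE] := fourier_pairing (integrable_truncation n F2) iG.
  rewrite (HA n n0n) -/B in reGE.
  rewrite -reGE -RintegralB//.
  apply: (@le_trans _ _ 'N[mu]_1[EFin \o (D n \* G)%R]%E); last first.
    apply: hoelder => //; first exact: measurable_funB.
    by rewrite [RHS]splitr !div1r.
  rewrite Lnorm1.
  have iDG : mu.-integrable setT (EFin \o (fun w => fourier_re (F \_ (cube n)) w * G w - Fhat w * G w)).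
    exact: (integrableB measurableT ireG iFhG).
  rewrite EFin_normr_Rintegral//; apply: le_trans (le_abse_integral _ _ _) _ => //.
    by have /integrableP[] := iDG.
  rewrite le_eqVlt; apply/orP; left; apply/eqP; apply: eq_integral => w _ /=.
  by rewrite /D /= mulrBl.
have GN : ('N[mu]_2%:E[EFin \o G] < +oo)%E.
  by move: G2; rewrite inE => /andP[_]; rewrite inE.
apply/eqP; rewrite eq_sym -subr_eq0 -normr_eq0; apply/negPn/negP => q0.
set q := `|_| in q0 bnd; have {q0} q_gt0 : 0 < q by rewrite lt_neqAle eq_sym q0 normr_ge0.
pose g := fine ('N[mu]_2%:E[EFin \o G])%E.
have gE : ('N[mu]_2%:E[EFin \o G])%E = g%:E.
  by rewrite /g fineK// ge0_fin_numE// Lnorm_ge0.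
have g0 : 0 <= g by rewrite fine_ge0// Lnorm_ge0.
(* A gap [q] between the two sides would have to be bounded by the L^2 error times [g]; the added 1
   covers [g = 0]. *)
have : \forall n \near \oo, ('N[mu]_2%:E[EFin \o D n] < (q / (g + 1))%:E)%E.
  move: reF; rewrite -/(D _) => /fine_cvgP[fin /cvgrPdist_lt/(_ (q / (g + 1)))].
  have q1 : 0 < q / (g + 1) by rewrite divr_gt0// ltr_wpDl.
  move=> /(_ q1) H; near=> n.
  have fn : ('N[mu]_2%:E[EFin \o D n])%E \is a fin_num by near: n.
  rewrite -(fineK fn) lte_fin.
  have : `|0 - fine ('N[mu]_2%:E[EFin \o D n])%E| < q / (g + 1) by near: n.
  by rewrite sub0r normrN; exact/le_lt_trans/ler_norm.
move=> [n1 _ Hn1].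
have := bnd (maxn n0 n1) (leq_maxl _ _).
have := Hn1 (maxn n0 n1) (leq_maxr _ _); rewrite /= gE => HD.
move=> /le_lt_trans; suff : ('N[mu]_2%:E[EFin \o D (maxn n0 n1)] * g%:E < q%:E)%E.
  by move=> H /(_ _ H); rewrite ltxx.
move: HD (Lnorm_ge0 mu 2%:E (EFin \o D (maxn n0 n1))).
case: ('N[mu]_2%:E[_])%E => [r||]//; rewrite lte_fin lee_fin => rq r0.
rewrite -EFinM lte_fin.
move: rq; rewrite ltr_pdivlMr ?ltr_wpDl// => rq.
by apply: le_lt_trans rq; rewrite ler_wpM2l// lerDl.
Unshelve. all: by end_near. Qed.
End fourier_pairing.

(** * Bounding quadratic forms of a function through its Fourier transform *)

Section positive_type.
Context {R : realType} {d : nat}.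
Local Notation leb := (@lebesgue_measure R).
Local Notation mu := (@lebesgue_measure_row R d).
Implicit Types (F G : 'rV[R]_d -> R) (w x y z : 'rV[R]_d) (M : R).

Definition fejer_row M w : R := \prod_(i < d) fejer M (w 0 i).
Definition tent_row M y : R := \prod_(i < d) (kappa * tent M (y 0 i)).

Lemma kappa_ge0 : 0 <= kappa :> R. Proof. exact: ltW (kappa_gt0). Qed.

Lemma fejer_row_ge0 M w : 0 <= fejer_row M w.
Proof. by apply: prodr_ge0 => i _; exact: fejer_ge0. Qed.

Lemma fejer_row_le M w : fejer_row M w <= (M ^+ 2) ^+ d.
Proof.
rewrite -[X in _ ^+ X]card_ord -prodr_const; apply: ler_prod => i _.
by rewrite fejer_ge0 fejer_le.
Qed.

Lemma integrable_fejer_row M : mu.-integrable setT (EFin \o fejer_row M).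
Proof.
by apply: (integrable_tensor (g := fun=> fejer M)) => i; exact: integrable_fejer.
Qed.

Lemma measurable_fejer_row M : measurable_fun [set: 'rV[R]_d] (fejer_row M).
Proof. by have /integrableP[/measurable_EFinP] := integrable_fejer_row M. Qed.

Lemma measurable_cos_dot z : measurable_fun [set: 'rV[R]_d] (fun w => cos (dotv z w)).
Proof. by apply: (measurableT_comp (@measurable_cosT R)); exact: measurable_dotv. Qed.

Lemma integrable_fejer_cos M z :
  mu.-integrable setT (EFin \o (fun w => fejer_row M w * cos (dotv z w))).
Proof.
apply: (le_integrable_bounded _ _ (integrable_fejer_row M)) => [|w].
  exact: measurable_cos_dot.
exact: cos_max.
Qed.

Lemma Lfun_fejer_cos M z :
  (fun w => fejer_row M w * cos (dotv z w)) \in Lfun mu 2%:E.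
Proof.
have mg : measurable_fun setT (fun w => fejer_row M w * cos (dotv z w)).
  by apply: measurable_funM; [exact: measurable_fejer_row|exact: measurable_cos_dot].
apply: Lfun_sq_integrable => //.
apply: (le_integrable measurableT _ _
  (integrableZl measurableT ((M ^+ 2) ^+ d) (integrable_fejer_row M))).
  by apply/measurable_EFinP; exact: measurable_funX.
move=> w _ /=; rewrite lee_fin normrX normrM expr2.
have g0 := fejer_row_ge0 M w; have gM := fejer_row_le M w.
have c1 := cos_max (dotv z w); have c0 := normr_ge0 (cos (dotv z w)).
rewrite normrM (ger0_norm g0) (ger0_norm (le_trans g0 gM)).
rewrite mulrACA -[leRHS]mulr1; apply: ler_pM; rewrite ?mulr_ge0//.
  by apply: ler_pM.
by rewrite -[leRHS]mulr1; apply: ler_pM.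
Qed.

Lemma fejer_row_cos M y :
  \int[mu]_w (fejer_row M w * cos (dotv y w)) = tent_row M y.
Proof.
have [-> _] := @integral_tensor_cos R d (fun=> fejer M) y
  (fun=> integrable_fejer M) (fun i => integral_fejer_sin M (y 0 i)).
by apply: eq_bigr => i _; rewrite integral_fejer_cos.
Qed.

Lemma dotvDl x y w : dotv (x + y) w = dotv x w + dotv y w.
Proof. by rewrite -big_split; apply: eq_bigr => i _; rewrite !mxE mulrDl. Qed.

Lemma dotvNl x w : dotv (- x) w = - dotv x w.
Proof. by rewrite -sumrN; apply: eq_bigr => i _; rewrite !mxE mulNr. Qed.

Lemma fejer_row_cos_cos M z x :
  \int[mu]_w (fejer_row M w * cos (dotv z w) * cos (dotv x w)) =
  (tent_row M (x - z) + tent_row M (x + z)) / 2.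
Proof.
rewrite -!fejer_row_cos -RintegralD//; try exact: integrable_fejer_cos.
rewrite -RintegralZr//; last first.
  exact: (integrableD measurableT (integrable_fejer_cos M (x - z)) (integrable_fejer_cos M (x + z))).
apply: eq_Rintegral => w _.
by rewrite !dotvDl dotvNl !cosD cosN sinN; field.
Qed.

Lemma tent_row_ge0 M y : 0 <= M -> 0 <= tent_row M y.
Proof. by move=> M0; apply: prodr_ge0 => i _; rewrite mulr_ge0 ?kappa_ge0 ?tent_ge0. Qed.

Lemma tent_row_le M y : 0 <= M -> tent_row M y <= (kappa * M) ^+ d.
Proof.
move=> M0; rewrite -[X in _ ^+ X]card_ord -prodr_const; apply: ler_prod => i _.
by rewrite mulr_ge0 ?kappa_ge0 ?tent_ge0//= ler_wpM2l ?kappa_ge0 ?tent_le.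
Qed.

Lemma tent_row_eq0 M y i : 0 <= M -> M <= `|y 0 i| -> tent_row M y = 0.
Proof. by move=> M0 My; rewrite /tent_row (bigD1 i)//= tent_eq0// mulr0 mul0r. Qed.

Lemma measurable_tent_row_shift M z : measurable_fun [set: 'rV[R]_d] (fun x => tent_row M (x - z)).
Proof.
apply: measurable_prod => i _; apply: measurable_funM => //.
apply: (measurableT_comp (measurable_tent M)).
under eq_fun do rewrite !mxE.
by apply: measurable_funD => //; exact: measurable_coord.
Qed.

Definition tent_mass M : R := (kappa * \int[leb]_t tent M t) ^+ d.

Lemma integral_tent_row M z : 0 < M ->
  (\int[mu]_x (tent_row M (x - z))%:E = (tent_mass M)%:E)%E.
Proof.
move=> M0; have M_ge0 := ltW M0.
have /andP[_ ty] := integral_tent_bounds M0.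
have tfin : (\int[leb]_y (tent M y)%:E)%E \is a fin_num.
  by rewrite ge0_fin_numE//; apply: integral_ge0 => y _; rewrite lee_fin tent_ge0.
rewrite /tent_row; under eq_integral => x _.
  under eq_bigr do rewrite !mxE. over.
rewrite (@ge0_integral_tensor R d (fun i t => kappa * tent M (t - z 0 i))).
- rewrite (eq_bigr (fun=> (kappa * \int[leb]_t tent M t)%:E)) => [|i _].
    by rewrite prodEFin prodr_const card_ord.
  under eq_integral do rewrite EFinM.
  rewrite ge0_integralZl//.
  + rewrite integral_tent_shift// EFinM; congr (_ * _)%E.
    by rewrite /Rintegral fineK.
  + apply/measurable_EFinP; apply: (measurableT_comp (measurable_tent M)).
    exact: measurable_funB.
  + by move=> t _; rewrite lee_fin tent_ge0.
  + by rewrite lee_fin kappa_ge0.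
- move=> i; apply: measurable_funM => //; apply: (measurableT_comp (measurable_tent M)).
  exact: measurable_funB.
- by move=> i t; rewrite mulr_ge0 ?kappa_ge0 ?tent_ge0.
Qed.

Lemma tent_mass_ge M : 0 < M -> (kappa * (M ^+ 2 / 2)) ^+ d <= tent_mass M.
Proof.
move=> M0; have /andP[tM ty] := integral_tent_bounds M0.
have k0 := kappa_ge0.
apply: lerXn2r; rewrite ?nnegrE ?mulr_ge0//.
- exact: ltW.
- exact: ltW.
- by apply: Rintegral_ge0 => t _; rewrite tent_ge0 ?ltW.
apply: ler_wpM2l => //; rewrite -lee_fin /Rintegral fineK//.
by rewrite ge0_fin_numE//; apply: integral_ge0 => y _; rewrite lee_fin tent_ge0 ?ltW.
Qed.

Lemma tent_mass_gt0 M : 0 < M -> 0 < tent_mass M.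
Proof.
move=> M0; apply: lt_le_trans (tent_mass_ge M0).
by rewrite exprn_gt0// mulr_gt0 ?kappa_gt0 ?divr_gt0 ?exprn_gt0.
Qed.

(** The shifted tent vanishes outside the box of half-width M about [z], which all large cubes
    contain; this is what makes the truncated pairings eventually constant. *)
Lemma truncation_tent F M z : 0 < M -> exists n0, forall n, (n0 <= n)%N ->
  forall x, (F \_ (cube n)) x * tent_row M (x - z) = F x * tent_row M (x - z).
Proof.
move=> M0; pose n0 := Num.truncn (\sum_(i < d) `|z 0 i| + M).
exists n0.+1 => n n0n x; rewrite patchE; case: ifPn => //.
rewrite notin_setE => /existsNP[i /negP]; rewrite -ltNge => xi.
rewrite (@tent_row_eq0 _ _ i) ?mulr0 ?(ltW M0)//.
rewrite !mxE.
have h1 : `|z 0 i| + M < n%:R.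
  apply: le_lt_trans (_ : \sum_(j < d) `|z 0 j| + M < _).
    by rewrite lerD2r (bigD1 i)//= lerDl sumr_ge0.
  apply: lt_le_trans (_ : n0.+1%:R <= _); last by rewrite ler_nat.
  exact: truncnS_gt.
have h2 : `|x 0 i| <= `|x 0 i - z 0 i| + `|z 0 i|.
  by rewrite -[x 0 i in leLHS](subrK (z 0 i)); exact: ler_normD.
lra.
Qed.

Lemma integrable_mul_tent F M z : F \in Lfun mu 2%:E -> 0 < M ->
  mu.-integrable setT (EFin \o (fun x => F x * tent_row M (x - z))).
Proof.
move=> F2 M0; have [n0 Hn0] := truncation_tent F z M0.
have iF := integrable_truncation n0 F2.
have k0 : 0 <= (kappa * M) ^+ d by rewrite exprn_ge0// mulr_ge0 ?kappa_ge0 ?ltW.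
apply: (le_integrable measurableT _ _ (integrableZl measurableT ((kappa * M) ^+ d) iF)).
  apply/measurable_EFinP; apply: measurable_funM; last exact: measurable_tent_row_shift.
  by move: F2; rewrite inE => /andP[+ _]; rewrite inE.
move=> x _ /=; rewrite -(Hn0 _ (leqnn _)) lee_fin !normrM mulrC.
rewrite (ger0_norm k0) ler_wpM2r// ger0_norm ?tent_row_ge0 ?(ltW M0)//.
by apply: tent_row_le; exact: ltW.
Qed.

(** A product of two cosines is a mean of cosines at the sum and at the difference, so testing
    against cos (z.w) sees F near both [z] and [- z]. *)
Lemma pairing_fejer F Fhat M z : is_fourier_transform F Fhat -> 0 < M ->
  \int[mu]_w (Fhat w * (fejer_row M w * cos (dotv z w))) =
  (2 * pi) `^ (- (d%:R / 2)) *
   ((\int[mu]_x (F x * tent_row M (x - z)) +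
     \int[mu]_x (F x * tent_row M (x - (- z)))) / 2).
Proof.
move=> FF M0; have [F2 _ _ _] := FF.
have i1 := integrable_mul_tent z F2 M0.
have i2 := integrable_mul_tent (- z) F2 M0.
have [n1 Hn1] := truncation_tent F z M0.
have [n2 Hn2] := truncation_tent F (- z) M0.
apply: (fourier_transform_pairing (n0 := maxn n1 n2) FF).
- exact: integrable_fejer_cos.
- exact: Lfun_fejer_cos.
move=> n; rewrite geq_max => /andP[n1n n2n].
rewrite -RintegralD// -RintegralZr//; last exact: (integrableD measurableT i1 i2).
apply: eq_Rintegral => x _.
rewrite fejer_row_cos_cos (_ : x + z = x - - z); last by rewrite opprK.
rewrite mulrA mulrDr.
by rewrite Hn1// Hn2.
Qed.

(** Divided by [tent_mass M], the shifted tent is nonnegative, has integral 1, and is supported in a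
    box that shrinks to [z]. *)
Lemma approximate_identity F z e : continuous F -> F \in Lfun mu 2%:E -> 0 < e ->
  \forall M \near 0^'+,
    `|\int[mu]_x (F x * tent_row M (x - z)) - F z * tent_mass M| <= e * tent_mass M.
Proof.
move=> cF F2 e0.
have /cvgrPdist_lt/(_ e e0)/nbhs_ballP[r /= r0 Hr] := cF z.
near=> M.
have M0 : 0 < M by near: M; exact: nbhs_right_gt.
have Mr : M < r by near: M; exact: nbhs_right_lt.
have iF := integrable_mul_tent z F2 M0.
have mt : measurable_fun [set: 'rV[R]_d] (fun x => (tent_row M (x - z))%:E).
  by apply/measurable_EFinP; exact: measurable_tent_row_shift.
have it : mu.-integrable setT (fun x => (tent_row M (x - z))%:E).
  apply/integrableP; split => //.
  under eq_integral do rewrite gee0_abs ?lee_fin ?tent_row_ge0 ?(ltW M0)//.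
  by rewrite integral_tent_row// ltry.
have tE : \int[mu]_x tent_row M (x - z) = tent_mass M.
  by rewrite /Rintegral integral_tent_row.
have ic : mu.-integrable setT (EFin \o (fun x => F z * tent_row M (x - z))).
  exact: (integrableZl measurableT (F z) it).
have ie : mu.-integrable setT (EFin \o (fun x => e * tent_row M (x - z))).
  exact: (integrableZl measurableT e it).
rewrite -tE -!RintegralZl// -RintegralB//.
have id : mu.-integrable setT (EFin \o (fun x => F x * tent_row M (x - z) - F z * tent_row M (x - z))).
  exact: (integrableB measurableT iF ic).
apply: le_trans (le_normr_Rintegral _ id) _ => //.
apply: le_Rintegral => //.
  by move: id => /integrable_abse.
move=> x _; rewrite -mulrBl normrM (ger0_norm (tent_row_ge0 (x - z) (ltW M0))).
have [[i Mi]|xz] := pselect (exists i, M <= `|(x - z) 0 i|).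
  by rewrite (tent_row_eq0 (ltW M0) Mi) !mulr0.
rewrite ler_wpM2r ?tent_row_ge0 ?(ltW M0)// distrC ltW//.
apply: Hr; split=> // j i; rewrite ord1 /ball/= distrC.
apply: lt_trans Mr; rewrite ltNge; apply/negP => Mi; apply: xz; exists i.
by rewrite !mxE.
Unshelve. all: by end_near. Qed.

Lemma Rintegral_lincomb (L : finType) (a : L -> R) (h : L -> 'rV[R]_d -> R) :
  (forall l, mu.-integrable setT (EFin \o h l)) ->
  mu.-integrable setT (EFin \o (fun x => \sum_l a l * h l x)) /\
  \int[mu]_x (\sum_l a l * h l x) = \sum_l a l * \int[mu]_x h l x.
Proof.
move=> ih; elim: (index_enum L) => [|l r [IH1 IH2]].
  split; first by under eq_fun do rewrite big_nil; exact: integrable0.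
  rewrite big_nil; under eq_Rintegral do rewrite big_nil.
  by rewrite Rintegral_cst// mul0r.
have il : mu.-integrable setT (EFin \o (fun x => a l * h l x)).
  exact: (integrableZl measurableT (a l) (ih l)).
split.
  apply: (eq_integrable measurableT _ _ _ (integrableD measurableT il IH1)) => x _ /=.
  by rewrite big_cons.
under eq_Rintegral do rewrite big_cons.
by rewrite RintegralD// IH2 RintegralZl// big_cons.
Qed.

(* The Fourier transform of [fejer_row] is the compactly supported [tent_row],
   so the pairing localises [F] near the points [z l] and [- z l], wherever
   [F] might grow at infinity. *)
Lemma cos_sum_bound F Fhat (L : finType) (a : L -> R) (z : L -> 'rV[R]_d)
    (B : 'rV[R]_d -> R) (b : R) :
  continuous F -> is_fourier_transform F Fhat ->
  measurable_fun setT B -> (forall w, 0 <= B w) -> (\int[mu]_w (B w)%:E <= b%:E)%E ->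
  (forall w, Fhat w * \sum_l a l * cos (dotv (z l) w) <= B w) ->
  \sum_l a l * ((F (z l) + F (- z l)) / 2) <=
    (2 * pi) `^ (d%:R / 2) * (2 / kappa) ^+ d * b.
Proof.
move=> cF FF mB B0 Bb FB; have [F2 Fh2 _ _] := FF.
set K := _ * _ ^+ d; set S := \sum_l _.
have k0 : 0 < kappa :> R by exact: kappa_gt0.
have pi2 : 0 < 2 * pi :> R by rewrite mulr_gt0 ?pi_gt0.
have K0 : 0 < K by apply: mulr_gt0; rewrite ?powR_gt0// exprn_gt0// divr_gt0.
have b0 : 0 <= b by rewrite -lee_fin; apply: le_trans Bb; apply: integral_ge0 => w _; rewrite lee_fin.
apply/ler_addgt0Pr => e' e'0.
(* The tolerance is shared among the terms; the added 1 covers [sa = 0]. *)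
pose sa := \sum_l `|a l|; pose e := e' / (sa + 1).
have sa0 : 0 <= sa by exact: sumr_ge0.
have e0 : 0 < e by rewrite divr_gt0// ltr_wpDl.
have ea : e * sa <= e'.
  by rewrite /e mulrAC ler_pdivrMr ?ltr_wpDl// ler_wpM2l ?(ltW e'0)// lerDl.
have : \forall M \near 0^'+, 0 < M /\ forall l,
    `|\int[mu]_x (F x * tent_row M (x - z l)) - F (z l) * tent_mass M| <= e * tent_mass M /\
    `|\int[mu]_x (F x * tent_row M (x - - z l)) - F (- z l) * tent_mass M| <= e * tent_mass M.
  near=> M; split; first by near: M; exact: nbhs_right_gt.
  near: M; apply: filter_forall => l.
  by apply: filterI; exact: approximate_identity.
move=> /filter_ex[M [M0 HM]].
have m0 := tent_mass_gt0 M0; set m := tent_mass M in m0 HM.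
pose c : R := (2 * pi) `^ (- (d%:R / 2)).
have c0 : 0 < c by rewrite powR_gt0// mulr_gt0 ?pi_gt0.
have ihl l : mu.-integrable setT (EFin \o (fun w => Fhat w * (fejer_row M w * cos (dotv (z l) w)))).
  by have /Lfun1_integrable := Lfun2_mul_Lfun1 Fh2 (Lfun_fejer_cos M (z l)).
have [isum sumE] := Rintegral_lincomb a ihl.
have up : \sum_l a l * \int[mu]_w (Fhat w * (fejer_row M w * cos (dotv (z l) w))) <=
    (M ^+ 2) ^+ d * b.
  rewrite -sumE.
  have iB : mu.-integrable setT (EFin \o B).
    apply/integrableP; split; first exact/measurable_EFinP.
    under eq_integral do rewrite gee0_abs ?lee_fin//.
    by apply: le_lt_trans Bb _; rewrite ltry.
  apply: (@le_trans _ _ (\int[mu]_w ((M ^+ 2) ^+ d * B w))).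
    apply: le_Rintegral => //; first exact: (integrableZl measurableT _ iB).
    move=> w _; apply: (@le_trans _ _ (fejer_row M w * B w)); last first.
      by rewrite ler_wpM2r// fejer_row_le.
    rewrite (_ : \sum_l _ = fejer_row M w * (Fhat w * \sum_l a l * cos (dotv (z l) w))).
      by rewrite ler_wpM2l// fejer_row_ge0.
    by rewrite !mulr_sumr; apply: eq_bigr => l _; ring.
  rewrite RintegralZl//; apply: ler_wpM2l; first by apply: exprn_ge0; exact: sqr_ge0.
  rewrite -lee_fin /Rintegral fineK//; exact: (integrable_fin_num measurableT iB).
have low : c * (m * (S - e * sa)) <=
    \sum_l a l * \int[mu]_w (Fhat w * (fejer_row M w * cos (dotv (z l) w))).
  under eq_bigr do rewrite (pairing_fejer _ FF M0) -/c mulrCA.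
  rewrite -mulr_sumr ler_pM2l// mulrBr mulr_sumr.
  rewrite /sa 2!mulr_sumr -sumrB; apply: ler_sum => l _.
  have [] := HM l; rewrite !ler_norml => /andP[h1 h2] /andP[h3 h4].
  move: h1 h2 h3 h4; set I1 := \int[mu]_x _; set I2 := \int[mu]_x _ => h1 h2 h3 h4.
  have : `|(I1 + I2) / 2 - (F (z l) + F (- z l)) / 2 * m| <= e * m.
    by rewrite ler_norml; apply/andP; split; lra.
  move=> h; have := ler_wpM2l (normr_ge0 (a l)) h; rewrite -normrM ler_norml => /andP[h5 _].
  by move: h5; rewrite mulrBr; lra.
have := le_trans low up.
have mge := tent_mass_ge M0; rewrite -/m in mge.
have cinv : (2 * pi) `^ (d%:R / 2) = c^-1 by rewrite /c powRN invrK.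
rewrite /K cinv.
(* The powers of M cancel here, so the final constant does not depend on M. *)
have MK : (M ^+ 2) ^+ d <= m * (2 / kappa) ^+ d.
  apply: le_trans (ler_wpM2r _ mge); last by rewrite exprn_ge0// divr_ge0// ltW.
  by rewrite -exprMn (_ : kappa * _ * _ = M ^+ 2)//; field; rewrite gt_eqF.
move=> h; have {h} : c * (m * (S - e * sa)) <= m * (2 / kappa) ^+ d * b.
  by apply: le_trans h _; rewrite ler_wpM2r.
rewrite mulrCA -mulrA ler_pM2l// -ler_pdivlMl// mulrA => h.
by rewrite -lerBlDr; apply: le_trans h; rewrite lerB.
Unshelve. all: by end_near. Qed.
End positive_type.

(** * Approximation from grids *)

Section cone.
Context {R : realType} {d : nat}.
Implicit Types (x y z u v e xi : 'rV[R]_d) (Omega : set 'rV[R]_d).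

Lemma dotvv_ge0 x : 0 <= dotv x x.
Proof. by apply: sumr_ge0 => i _; rewrite -expr2 sqr_ge0. Qed.

Lemma enorm_ge0 x : 0 <= enorm x. Proof. exact: sqrtr_ge0. Qed.

Lemma sqr_enorm x : enorm x ^+ 2 = dotv x x.
Proof. by rewrite sqr_sqrtr// dotvv_ge0. Qed.

Lemma dotvZl a x y : dotv (a *: x) y = a * dotv x y.
Proof. by rewrite /dotv mulr_sumr; apply: eq_bigr => i _; rewrite mxE mulrA. Qed.

Lemma enormZ a x : enorm (a *: x) = `|a| * enorm x.
Proof.
by rewrite /enorm dotvZl dotvC dotvZl mulrA -expr2 sqrtrM ?sqr_ge0// sqrtr_sqr.
Qed.

Lemma coord_le_enorm x i : `|x 0 i| <= enorm x.
Proof.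
rewrite -sqrtr_sqr ler_wsqrtr// /dotv (bigD1 i)//= expr2 lerDl.
by apply: sumr_ge0 => j _; rewrite -expr2 sqr_ge0.
Qed.

Lemma enorm_le x b : 0 <= b -> (forall i, `|x 0 i| <= b) -> enorm x <= d%:R * b.
Proof.
move=> b0 xb; rewrite -(ler_pXn2r (isT : (0 < 2)%N)) ?nnegrE ?enorm_ge0 ?mulr_ge0//.
rewrite sqr_enorm; apply: (@le_trans _ _ (\sum_(i < d) b ^+ 2)).
  apply: ler_sum => i _; rewrite -expr2 -real_normK ?num_real//.
  by rewrite ler_sqr ?nnegrE.
rewrite sumr_const card_ord exprMn -[leLHS]mulr_natl ler_wpM2r ?sqr_ge0//.
by rewrite -natrX ler_nat; case: (d) => // n; rewrite -[X in (X <= _)%N]expn1 leq_pexp2l.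
Qed.

Lemma dotv_unit_le e xi : enorm xi = 1 -> `|dotv e xi| <= enorm e.
Proof.
move=> xi1; have xixi : dotv xi xi = 1 by rewrite -sqr_enorm xi1 expr1n.
rewrite -(ler_pXn2r (isT : (0 < 2)%N)) ?nnegrE ?enorm_ge0//.
rewrite real_normK ?num_real// sqr_enorm.
have := dotvv_ge0 (e - dotv e xi *: xi).
rewrite -scaleNr dotvDl dotvZl ![dotv _ (_ + _)]dotvC !dotvDl !dotvZl xixi.
by rewrite [dotv xi e]dotvC; lra.
Qed.

Lemma enorm_add_unit s e xi : 0 <= s -> enorm xi = 1 -> enorm (s *: xi + e) <= s + enorm e.
Proof.
move=> s0 xi1; have xixi : dotv xi xi = 1 by rewrite -sqr_enorm xi1 expr1n.
have e0 := enorm_ge0 e.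
rewrite -(ler_pXn2r (isT : (0 < 2)%N)) ?nnegrE ?enorm_ge0 ?addr_ge0//.
rewrite sqr_enorm dotvDl dotvZl ![dotv _ (_ + _)]dotvC !dotvDl !dotvZl xixi.
rewrite [dotv xi e]dotvC -sqr_enorm.
have := dotv_unit_le e xi1; rewrite ler_norml => /andP[_ h]; nra.
Qed.

Lemma cos_lt1 (theta : R) : 0 < theta < pi / 2 -> 0 < cos theta < 1.
Proof.
move=> /[dup] /sin_gt0_pihalf s0 /andP[t0 t1].
have c0 : 0 < cos theta.
  by apply: cos_gt0_pihalf; rewrite t1 andbT (lt_trans _ t0)// oppr_lt0 divr_gt0 ?pi_gt0.
rewrite c0/= ltNge; apply/negP => c1.
by have := cos2Dsin2 theta; have := exprn_gt0 2 s0; rewrite !expr2; nra.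
Qed.

(** The angle and the unit directions are replaced by one inequality on the displacement [v], which
    is easier to check for perturbed vectors. *)
Lemma interior_cone_conditionP Omega : interior_cone_condition Omega ->
  exists c r : R, [/\ 0 < c < 1, 0 < r & forall x, Omega x ->
    exists2 xi, enorm xi = 1 & forall v, c * enorm v <= dotv v xi ->
      enorm v <= r -> Omega (x + v)].
Proof.
move=> [theta [r [th r0 cone]]]; exists (cos theta), r; split=> //; first exact: cos_lt1.
move=> x Ox; have [xi xi1 Hxi] := cone x Ox; exists xi => // v vxi vr.
have [v0|v0] := eqVneq (enorm v) 0.
  (* A zero displacement has no direction of its own; the axis serves as one. *)
  rewrite (_ : v = 0 *: xi); first by apply: Hxi => //;
    [by rewrite -sqr_enorm xi1 expr1n; exact: cos_le1|by rewrite lexx ltW].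
  apply/rowP => i; rewrite scale0r mxE; apply/eqP; rewrite -normr_le0 -v0.
  exact: coord_le_enorm.
have v_gt0 : 0 < enorm v by rewrite lt_neqAle eq_sym v0 enorm_ge0.
rewrite (_ : v = enorm v *: ((enorm v)^-1 *: v)); last by rewrite scalerA mulfV// scale1r.
apply: Hxi; first by rewrite enormZ ger0_norm ?invr_ge0 ?enorm_ge0// mulVf.
  by rewrite dotvZl mulrC ler_pdivlMr.
by rewrite ltW.
Qed.

(** A point far enough along the cone axis is the centre of a ball inside the cone, and a block of
    q^d grid points fits into it. The offset [b] does not depend on [x], so all blocks belong to one
    grid. *)
Lemma cone_grid Omega (b : R) q : interior_cone_condition Omega -> (0 < q)%N ->
  exists K h0 : R, [/\ 0 <= K, 0 < h0 & forall h x, 0 < h <= h0 -> Omega x ->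
    exists z : 'I_d -> int,
      (forall i, `|x 0 i - (h * (z i)%:~R - b)| <= K * h) /\
      forall a : 'I_d -> nat, (forall i, (a i < q)%N) ->
        Omega (\row_i (h * (z i)%:~R - b + h * (a i)%:R))].
Proof.
move=> /interior_cone_conditionP[c [r [/andP[c0 c1] r0 cone]]] q0.
(* [h * E] bounds the Euclidean distance from a block point to the axis point: each coordinate
   differs by at most h q. The 1 keeps [E] positive. *)
pose E : R := d%:R * q%:R + 1.
have E0 : 0 < E by rewrite ltr_wpDl// mulr_ge0.
have c10 : 0 < 1 - c by rewrite subr_gt0.
pose K := 2 * E / (1 - c).
have K0 : 0 < K by rewrite divr_gt0 ?mulr_gt0.
exists K, (r / K); split; [exact: ltW|by rewrite divr_gt0|].
move=> h x /andP[h0 hr] Ox.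
have [xi xi1 Hxi] := cone x Ox.
(* Solves s (1 - c) = h E (1 + c): an error e of norm at most h E then satisfies c (s + |e|) <= s -
   |e|, which puts s xi + e in the cone. *)
pose s := h * E * (1 + c) / (1 - c).
have s0 : 0 <= s by rewrite divr_ge0 ?mulr_ge0 ?(ltW h0) ?(ltW E0) ?(ltW c10)// addr_ge0// ltW.
have sE : s * (1 - c) = h * E * (1 + c) by rewrite /s divfK// gt_eqF.
have KE : K * (1 - c) = 2 * E by rewrite /K divfK// gt_eqF.
have sK : s + h * E = K * h.
  apply: (mulIf (lt0r_neq0 c10)).
  rewrite (_ : K * h * (1 - c) = h * (K * (1 - c))); last by ring.
  by rewrite mulrDl sE KE; ring.
pose z i : int := Num.floor ((x 0 i + s * xi 0 i + b) / h).
have zP (a : 'I_d -> nat) : (forall i, (a i < q)%N) ->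
    exists2 v, \row_i (h * (z i)%:~R - b + h * (a i)%:R) = x + v &
      c * enorm v <= dotv v xi /\ enorm v <= K * h.
  move=> aq.
  pose e : 'rV[R]_d := \row_i (h * (z i)%:~R - b + h * (a i)%:R - (x 0 i + s * xi 0 i)).
  have eE : enorm e <= h * E.
    apply: le_trans (_ : d%:R * (h * q%:R) <= _); last first.
      by rewrite /E mulrDr mulrCA lerDl mulr1 ltW.
    apply: enorm_le => [|i]; first by rewrite mulr_ge0// ltW.
    rewrite mxE.
    set t := (x 0 i + s * xi 0 i + b) / h.
    have tE : x 0 i + s * xi 0 i + b = h * t by rewrite /t mulrCA mulfV ?mulr1// gt_eqF.
    have -> : h * (z i)%:~R - b + h * (a i)%:R - (x 0 i + s * xi 0 i) =
        h * ((z i)%:~R + (a i)%:R - t).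
      by rewrite !mulrBr !mulrDr -tE; ring.
    rewrite normrM (gtr0_norm h0) ler_pM2l//.
    have := floor_itv t; rewrite -/(z i) => /andP[zt tz].
    have aq' : (a i)%:R <= q%:R - 1 :> R.
      by rewrite lerBrDr natr1 ler_nat aq.
    have q1 : 1 <= q%:R :> R by rewrite ler1n.
    have a0 : 0 <= (a i)%:R :> R by [].
    rewrite intrD in tz.
    rewrite ler_norml; apply/andP; split; lra.
  exists (s *: xi + e).
    by apply/rowP => i; rewrite !mxE; ring.
  have h1 := enorm_add_unit e s0 xi1.
  have h2 := dotv_unit_le e xi1.
  have xixi : dotv xi xi = 1 by rewrite -sqr_enorm xi1 expr1n.
  split; last by rewrite -sK; apply: le_trans h1 _; rewrite lerD2l.
  rewrite dotvDl dotvZl xixi mulr1.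
  move: h2; rewrite ler_norml => /andP[h2 _].
  apply: le_trans (ler_wpM2l (ltW c0) h1) _; nra.
have Kr : K * h <= r by rewrite mulrC -ler_pdivlMr.
exists z; split=> [i|a aq]; last first.
  by have [v -> [v1 v2]] := zP a aq; apply: Hxi => //; exact: le_trans Kr.
have [v vE [_ vK]] := zP (fun=> 0%N) (fun=> q0).
have := congr1 (fun u : 'rV[R]_d => u 0 i) vE; rewrite !mxE mulr0 addr0 => ->.
by rewrite opprD addrA subrr sub0r normrN; apply: le_trans vK; exact: coord_le_enorm.
Qed.
End cone.

(** * The frequency weight and its integral *)

Section grid_estimate.
Context {R : realType} {d : nat}.
Local Notation leb := (@lebesgue_measure R).
Local Notation mu := (@lebesgue_measure_row R d).
Implicit Types (w x y : 'rV[R]_d) (h tau s C D : R).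

Lemma ler_powRN (a b s : R) : 0 <= s -> 0 < a -> a <= b -> b `^ (- s) <= a `^ (- s).
Proof.
move=> s0 a0 ab; have b0 := lt_le_trans a0 ab.
rewrite !powRN lef_pV2 ?posrE ?powR_gt0//.
by rewrite ge0_ler_powR// ?nnegrE ltW.
Qed.

(** With u = M^2, M the largest |h w i|, the transform weight is at most h^(2 tau) u^(-tau), while
    D^2 is at most C^2 min (1, u)^tau because tau <= q; and min (1, u) / u <= 2 / (1 + u). The
    product of one-variable weights takes the place of a radial one so that its integral
    factorises. *)
Lemma weight_bound tau q C h w D : (0 < d)%N -> 0 < h -> 0 < tau <= q%:R ->
  0 <= D <= C -> (forall M, 0 <= M -> (forall i, `|h * w 0 i| <= M) -> D <= C * M ^+ q) ->
  (1 + enorm w ^+ 2) `^ (- tau) * D ^+ 2 <=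
  C ^+ 2 * 2 `^ tau * h `^ (2 * tau) *
    \prod_(i < d) (1 + (h * w 0 i) ^+ 2) `^ (- (tau / d%:R)).
Proof.
move=> d0 h0 /andP[t0 tq] /andP[D0 DC] DM.
have q0 : (0 < q)%N by rewrite -(ltr_nat R); exact: lt_le_trans tq.
have dR : 0 < d%:R :> R by rewrite ltr0n.
have C0 : 0 <= C := le_trans D0 DC.
pose i1 : 'I_d := Ordinal d0.
pose i0 := [arg max_(i > i1) `|h * w 0 i|]%O.
pose M := `|h * w 0 i0|.
have iM i : `|h * w 0 i| <= M.
  by rewrite /M /i0; case: arg_maxP => // j _; exact.
have M0 : 0 <= M by exact: normr_ge0.
have {DM}DM := DM M M0 iM.
pose u := M ^+ 2.
have prodE : (1 + u) `^ (- tau) <= \prod_(i < d) (1 + (h * w 0 i) ^+ 2) `^ (- (tau / d%:R)).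
  have -> : (1 + u) `^ (- tau) = \prod_(i < d) (1 + u) `^ (- (tau / d%:R)).
    rewrite prodr_const card_ord -powR_mulrn ?powR_ge0// -powRrM.
    by congr (_ `^ _); field; rewrite gt_eqF.
  apply: ler_prod => i _; rewrite powR_ge0/=.
  apply: ler_powRN; first by rewrite divr_ge0// ltW.
    by rewrite ltr_pwDl// sqr_ge0.
  by rewrite lerD2l -real_normK ?num_real// ler_sqr ?nnegrE.
apply: le_trans (ler_wpM2l _ prodE); last by rewrite !mulr_ge0 ?powR_ge0 ?sqr_ge0.
(* At M = 0 the negative power of [u] is meaningless, but there [D] vanishes since [q] is
   positive. *)
have [M00|M_neq0] := eqVneq M 0.
  have -> : D = 0.
    apply/eqP; rewrite eq_le D0 andbT; apply: le_trans DM _.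
    by rewrite M00 expr0n eqn0Ngt q0 mulr0.
  by rewrite expr0n mulr0 !mulr_ge0 ?powR_ge0 ?sqr_ge0.
have M_gt0 : 0 < M by rewrite lt_neqAle eq_sym M_neq0.
have u0 : 0 < u by rewrite exprn_gt0.
have h2 : 0 < h ^+ 2 by rewrite exprn_gt0.
have W1 : (1 + enorm w ^+ 2) `^ (- tau) <= h `^ (2 * tau) * u `^ (- tau).
  apply: le_trans (_ : (u / h ^+ 2) `^ (- tau) <= _).
    apply: ler_powRN; [exact: ltW|by rewrite divr_gt0|].
    rewrite ler_pdivrMr// /u /M normrM exprMn (ger0_norm (ltW h0)) mulrC ler_pM2r//.
    apply: le_trans (_ : enorm w ^+ 2 <= _); last by rewrite lerDr.
    by rewrite ler_sqr ?nnegrE ?enorm_ge0//; exact: coord_le_enorm.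
  rewrite powRM ?(ltW u0) ?invr_ge0 ?(ltW h2)// mulrC.
  rewrite -powR_inv1 ?(ltW h2)// -powRrM mulN1r opprK.
  by rewrite -(powR_mulrn _ (ltW h0)) -powRrM.
pose t := Num.min 1 u.
have tt0 : 0 < t by rewrite lt_min ltr01 u0.
have D2 : D ^+ 2 <= C ^+ 2 * t `^ tau.
  rewrite /t; have [u1|u1] := leP 1 u.
    by rewrite powR1 mulr1 ler_sqr ?nnegrE.
  apply: (@le_trans _ _ (C ^+ 2 * u ^+ q)).
    rewrite /u -exprM mulnC exprM -exprMn ler_sqr ?nnegrE//.
    by rewrite mulr_ge0// exprn_ge0.
  rewrite ler_wpM2l ?sqr_ge0// -powR_mulrn ?(ltW u0)//.
  by apply: ger_powR => //; rewrite u0 ltW.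
have tu : u `^ (- tau) * t `^ tau <= 2 `^ tau * (1 + u) `^ (- tau).
  have u1 : 0 < 1 + u by rewrite addr_gt0.
  have E (a b : R) : 0 < a -> 0 < b -> a `^ tau * b `^ (- tau) = (a / b) `^ tau.
    move=> a0 b0; rewrite powRM ?invr_ge0 ?(ltW a0) ?(ltW b0)//.
    by rewrite -(powR_inv1 (ltW b0)) -powRrM mulN1r.
  rewrite mulrC !E// ge0_ler_powR ?nnegrE ?divr_ge0 ?(ltW tt0) ?(ltW u0) ?(ltW u1) ?(ltW t0)//.
  rewrite ler_pdivrMr// mulrAC ler_pdivlMr//.
  by rewrite /t; have [u1'|u1'] := leP 1 u; nra.
apply: le_trans (_ : (h `^ (2 * tau) * u `^ (- tau)) * (C ^+ 2 * t `^ tau) <= _).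
  by apply: ler_pM => //; rewrite ?powR_ge0 ?sqr_ge0.
rewrite (_ : _ * _ * (_ * _) = C ^+ 2 * h `^ (2 * tau) * (u `^ (- tau) * t `^ tau)); last by ring.
rewrite (_ : C ^+ 2 * _ * _ * _ = C ^+ 2 * h `^ (2 * tau) * (2 `^ tau * (1 + u) `^ (- tau))); last by ring.
by rewrite ler_wpM2l// mulr_ge0 ?powR_ge0 ?sqr_ge0.
Qed.

(** Each of the d factors is rescaled separately. For the exponent tau / d the condition reads tau >
    d/2. *)
Lemma integral_weight s : 1 / 2 < s -> exists J : R, 0 <= J /\
  forall h, 0 < h ->
  (\int[mu]_w (\prod_(i < d) (1 + (h * w 0 i) ^+ 2) `^ (- s))%:E = ((h^-1 * J) ^+ d)%:E)%E.
Proof.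
move=> s2; have cj := @continuous_japanese R s.
have mj : measurable_fun [set: R] (fun t : R => (1 + t ^+ 2) `^ (- s)).
  exact: continuous_measurable_fun.
pose J := \int[leb]_t (1 + t ^+ 2) `^ (- s).
have JE : (\int[leb]_t ((1 + t ^+ 2) `^ (- s))%:E = J%:E)%E.
  rewrite /J /Rintegral fineK// ge0_fin_numE ?integral_japanese_lty//.
  by apply: integral_ge0 => t _; rewrite lee_fin powR_ge0.
exists J; split; first by apply: Rintegral_ge0 => t _; exact: powR_ge0.
move=> k k0.
rewrite (@ge0_integral_tensor R d (fun i t => (1 + (k * t) ^+ 2) `^ (- s))).
- rewrite (eq_bigr (fun=> (k^-1 * J)%:E)) => [|i _].
    by rewrite prodEFin prodr_const card_ord.
  have aff := @ge0_integral_affine R (fun t => ((1 + t ^+ 2) `^ (- s))%:E) k 0 k0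
    (proj2 (measurable_EFinP _ _) mj) (fun t => powR_ge0 _ _).
  by rewrite EFinM -JE -aff; apply: eq_integral => t _; rewrite addr0.
- move=> i; apply: (measurableT_comp mj); exact: measurable_funM.
- by move=> i t; exact: powR_ge0.
Qed.
End grid_estimate.

(** * The squared error of interpolating a kernel from a grid block *)

Section grid_estimate.
Context {R : realType} {d : nat}.
Local Notation mu := (@lebesgue_measure_row R d).
Implicit Types (w x y : 'rV[R]_d) (h tau s C D : R).

Lemma sum_option (V : nmodType) (I : finType) (f : option I -> V) :
  \sum_l f l = f None + \sum_j f (Some j).
Proof.
rewrite (bigD1 None)//=; congr (_ + _).
rewrite (reindex_omap Some id) => [|[]//].
by apply: eq_bigl => j /=; rewrite eqxx.
Qed.

(** The squared modulus of an exponential sum. Its sine part is written as a cosine with phase -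
    pi/2, so that one estimate uniform in the phase covers both squares. *)
Lemma sum_pair_cosB (L : finType) (a : L -> R) (Y : L -> 'rV[R]_d) w :
  \sum_(p : L * L) a p.1 * a p.2 * cos (dotv (Y p.1 - Y p.2) w) =
  (\sum_l a l * cos (dotv (Y l) w)) ^+ 2 + (\sum_l a l * cos (dotv (Y l) w - pi / 2)) ^+ 2.
Proof.
rewrite !expr2 !big_distrlr /= !pair_bigA -big_split/=; apply: eq_bigr => p _.
rewrite dotvDl dotvNl cosB !cosBpihalf; ring.
Qed.

(** [None] stands for the target [x] with weight 1, [Some j] for a grid point with weight [- c j].
    For F = Phi the sum is the squared native norm of the approximation error. The weight supplies
    h^(2 tau), its integral h^(-d). *)
Lemma grid_estimate Omega (F Fhat : 'rV[R]_d -> R) tau Cf b :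
  (0 < d)%N -> d%:R / 2 < tau -> interior_cone_condition Omega ->
  continuous F -> is_fourier_transform F Fhat -> 0 < Cf ->
  (forall w, Fhat w <= Cf * (1 + enorm w ^+ 2) `^ (- tau)) ->
  exists C1 h0 : R, [/\ 0 <= C1, 0 < h0 & forall h x, 0 < h <= h0 -> Omega x ->
    exists (I : finType) (c : I -> R) (y : I -> 'rV[R]_d),
    [/\ forall j, Omega (y j),
        forall j, exists k : 'I_d -> int, y j = \row_i (h * (k i)%:~R - b) &
        let a (l : option I) := oapp (fun j => - c j) 1 l in
        let Y (l : option I) := oapp y x l in
        \sum_(p : option I * option I) a p.1 * a p.2 *
          ((F (Y p.1 - Y p.2) + F (- (Y p.1 - Y p.2))) / 2) <=
        C1 * h `^ (2 * tau - d%:R)]].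
Proof.
move=> d0 tau2 coneO cF FF Cf0 Fhat_le.
have dR : 0 < d%:R :> R by rewrite ltr0n.
have tau0 : 0 < tau by apply: lt_trans tau2; rewrite divr_gt0.
have Cf_ge0 := ltW Cf0.
(* The interpolation order has to reach [tau] for [weight_bound]. *)
pose q := (Num.truncn tau).+1.
have tauq : 0 < tau <= q%:R by rewrite tau0/= ltW// truncnS_gt.
have [K [h0 [K0 h00 grid]]] := cone_grid b coneO (isT : (0 < q)%N).
have [C C0 interp] := cos_interpolation K d (isT : (0 < q)%N).
have s2 : 1 / 2 < tau / d%:R by rewrite ltr_pdivlMr// mulrAC mul1r.
have [J [J0 JE]] := @integral_weight R d _ s2.
pose C' := 1 + C; have C'0 : 0 <= C' by rewrite addr_ge0.
(* The factor 2 counts the two squares of [sum_pair_cosB]. *)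
pose A := Cf * 2 * (C' ^+ 2 * 2 `^ tau).
have A0 : 0 <= A by rewrite !mulr_ge0 ?powR_ge0 ?sqr_ge0.
have kap0 : 0 < kappa :> R by exact: kappa_gt0.
exists ((2 * pi) `^ (d%:R / 2) * (2 / kappa) ^+ d * (A * J ^+ d)), h0.
split=> //.
  rewrite !mulr_ge0 ?powR_ge0 ?sqr_ge0 ?exprn_ge0//.
  - by rewrite divr_ge0// ltW.
move=> h x /andP[hp hh0] Ox.
have hne0 : h != 0 by rewrite gt_eqF.
have [z [zx zO]] := grid h x (introT andP (conj hp hh0)) Ox.
pose p0 i : R := h * (z i)%:~R - b.
(* The position of [x] relative to the corner of the block, in mesh units; [insub] extends it by 0
   to the indices beyond [d]. *)
pose t (n : nat) : R := oapp (fun i : 'I_d => (x 0 i - p0 i) / h) 0 (insub n).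
have tE (i : 'I_d) : t i = (x 0 i - p0 i) / h by rewrite /t valK.
have tK n : (n < d)%N -> `|t n| <= K.
  move=> nd; rewrite -[n]/(val (Ordinal nd)) tE normrM normfV (gtr0_norm hp).
  by rewrite ler_pdivrMr//; exact: zx.
have [I [c [p [pq cC pE]]]] := interp t tK.
pose y j : 'rV[R]_d := \row_i (p0 i + h * (p j i)%:R).
exists I, c, y; split.
- by move=> j; apply: zO => i; exact: pq.
- move=> j; exists (fun i => z i + (p j i)%:Z); apply/rowP => i.
  by rewrite !mxE /p0 intrD mulrDr addrAC.
set a := fun l : option I => _; set Y := fun l : option I => _.
cbv zeta.
pose D phi w := `|\sum_l a l * cos (dotv (Y l) w + phi)|.
pose wn w (n : nat) : R := oapp (fun i : 'I_d => h * w 0 i) 0 (insub n).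
have wnE w (i : 'I_d) : wn w i = h * w 0 i by rewrite /wn valK.
have Dle phi w : 0 <= D phi w <= C'.
  rewrite normr_ge0/= /D sum_option /a/=; apply: le_trans (ler_normD _ _) _.
  apply: lerD; first by rewrite mul1r cos_max.
  apply: le_trans (ler_norm_sum _ _ _) _; apply: le_trans cC; apply: ler_sum => j _.
  by rewrite normrM normrN ler_piMr// cos_max.
have DM phi w M : 0 <= M -> (forall i, `|h * w 0 i| <= M) -> D phi w <= C' * M ^+ q.
  move=> M0 wM; apply: (@le_trans _ _ (C * M ^+ q)); last first.
    by rewrite ler_wpM2r ?exprn_ge0// lerDr.
  (* The corner [p0] contributes the same phase to all terms, which the freedom in the phase
     absorbs. *)
  have := pE (wn w) (\sum_(i < d) p0 i * w 0 i + phi) M; rewrite /D.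
  have xE : \sum_(i < d) t i * wn w i + (\sum_(i < d) p0 i * w 0 i + phi) = dotv x w + phi.
    rewrite addrA -big_split; congr (_ + _); apply: eq_bigr => i _ /=.
    by rewrite tE wnE; field.
  have yE j : \sum_(i < d) (p j i)%:R * wn w i + (\sum_(i < d) p0 i * w 0 i + phi) =
      dotv (y j) w + phi.
    rewrite addrA -big_split; congr (_ + _); apply: eq_bigr => i _ /=.
    by rewrite wnE mxE; ring.
  rewrite xE; under eq_bigr do rewrite yE.
  rewrite sum_option /a /Y /= mul1r.
  under [X in _ -> `|_ + X| <= _]eq_bigr do rewrite mulNr.
  rewrite sumrN; apply=> //.
  by move=> n nd; rewrite -[n]/(val (Ordinal nd)) wnE.
pose W w : R := \prod_(i < d) (1 + (h * w 0 i) ^+ 2) `^ (- (tau / d%:R)).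
have WD phi w : (1 + enorm w ^+ 2) `^ (- tau) * D phi w ^+ 2 <=
    C' ^+ 2 * 2 `^ tau * h `^ (2 * tau) * W w.
  by apply: (weight_bound d0 hp tauq (Dle phi w)) => M; exact: DM.
pose B w := A * h `^ (2 * tau) * W w.
have W0 w : 0 <= W w by apply: prodr_ge0 => i _; exact: powR_ge0.
have mW : measurable_fun [set: 'rV[R]_d] W.
  apply: measurable_prod => i _.
  apply: (measurableT_comp (continuous_measurable_fun (@continuous_japanese R (tau / d%:R)))).
  by apply: measurable_funM => //; exact: measurable_coord.
have Ah : 0 <= A * h `^ (2 * tau) by rewrite mulr_ge0 ?powR_ge0.
apply: le_trans (@cos_sum_bound R d F Fhat _ (fun p => a p.1 * a p.2)
  (fun p => Y p.1 - Y p.2) B (A * h `^ (2 * tau) * (h^-1 * J) ^+ d) cF FF _ _ _ _) _.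
- exact: measurable_funM.
- by move=> w; rewrite mulr_ge0.
- rewrite EFinM -(JE h hp) -ge0_integralZl//.
  + exact/measurable_EFinP.
  + by move=> w _; rewrite lee_fin; exact: W0.
- move=> w; rewrite sum_pair_cosB.
  have E phi : (\sum_l a l * cos (dotv (Y l) w + phi)) ^+ 2 = D phi w ^+ 2.
    by rewrite /D real_normK ?num_real.
  have := E 0; under eq_bigr do rewrite addr0; move=> ->.
  rewrite E; set S := _ + _.
  have S0 : 0 <= S by rewrite addr_ge0 ?sqr_ge0.
  apply: le_trans (ler_wpM2r S0 (Fhat_le w)) _.
  rewrite -mulrA /S mulrDr.
  rewrite (_ : B w = Cf * (C' ^+ 2 * 2 `^ tau * h `^ (2 * tau) * W w +
                           C' ^+ 2 * 2 `^ tau * h `^ (2 * tau) * W w)); last first.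
    by rewrite /B /A; ring.
  by rewrite ler_wpM2l ?(ltW Cf0)// lerD.
rewrite -!mulrA ler_wpM2l ?powR_ge0// ler_wpM2l ?exprn_ge0 ?divr_ge0 ?(ltW kap0)//.
rewrite ler_wpM2l// exprMn mulrCA [leRHS]mulrC.
rewrite powRD; last by rewrite hne0 implybT.
rewrite powRN powR_mulrn ?(ltW hp)// exprVn.
by rewrite le_eqVlt; apply/orP; left; apply/eqP; ring.
Qed.
End grid_estimate.

(** * Native norms of kernel combinations and Kolmogorov widths *)

Section kernels_on_domains.
Context {R : realType} {d : nat} {Omega : set 'rV[R]_d} {k : Omega -> Omega -> R}
  (H : native_space k).
Local Notation mu := (@lebesgue_measure_row R d).
Local Notation dot := (ns_dot H).
Local Notation ker := (ns_ker H).
Implicit Types (X : {fset Omega}) (x y : Omega) (Phi : 'rV[R]_d -> R).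

Lemma dot_ker x y : dot (ker x) (ker y) = k y x.
Proof. by rewrite -ns_reproducing ns_kerE. Qed.

(** The two values of [Phi] coincide by symmetry of the kernel; averaging them matches the form of
    [cos_sum_bound]. *)
Lemma dot_lincomb Phi (L : finType) (a : L -> R) (y : L -> Omega) :
  symmetric_kernel k -> translation_invariant k Phi ->
  dot (\sum_l a l *: ker (y l)) (\sum_l a l *: ker (y l)) =
  \sum_(p : L * L) a p.1 * a p.2 *
    ((Phi (\val (y p.1) - \val (y p.2)) + Phi (- (\val (y p.1) - \val (y p.2)))) / 2).
Proof.
move=> ksym kPhi; rewrite dot_suml.
under eq_bigr do rewrite dot_sumr.
rewrite pair_bigA; apply: eq_bigr => p _ /=.
rewrite dotZl dotZr dot_ker opprB -!kPhi (ksym (y p.1)).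
by field.
Qed.

Lemma norm_ker Phi x : translation_invariant k Phi -> `|ker x| = Num.sqrt (Phi 0).
Proof.
move=> kPhi; rewrite -[LHS]ger0_norm// -sqrtr_sqr ns_normE dot_ker kPhi.
by rewrite subrr.
Qed.

Lemma compact_coord_bounded : compact Omega ->
  exists2 b : R, 0 < b & forall w, Omega w -> forall i, `|w 0 i| < b.
Proof.
move=> /compact_bounded[M [_ HM]].
exists (`|M| + 2); first by rewrite ltr_wpDl.
move=> w Ow i; apply: (@le_lt_trans _ _ (`|M| + 1)); last by lra.
have := HM (`|M| + 1); rewrite (le_lt_trans (ler_norm M)) ?ltrDl//.
move=> /(_ isT w Ow); apply: le_trans.
rewrite (_ : `|w| = mx_norm w)// mx_normrE.
exact: (le_bigmax _ (fun ij => `|w ij.1 ij.2|) (0, i)).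
Qed.

(** The offset - b makes the indices of grid points in [Omega] positive, and 2 b <= h N makes them
    smaller than N, so N choices per coordinate suffice. *)
Lemma grid_subset (b h : R) N : 0 < h -> 2 * b <= h * N%:R ->
  (forall w, Omega w -> forall i, `|w 0 i| < b) ->
  exists2 X : {fset Omega}, (#|` X| <= N ^ d)%N &
    forall y, (exists z : 'I_d -> int, \val y = \row_i (h * (z i)%:~R - b)) -> y \in X.
Proof.
move=> h0 hN Ob.
pose pt (f : {ffun 'I_d -> 'I_N}) : option Omega :=
  insub (\row_i (h * (f i)%:R - b) : 'rV[R]_d).
pose s := pmap pt (enum {ffun 'I_d -> 'I_N}).
exists (seq_fset tt s).
  rewrite size_seq_fset; apply: leq_trans (size_undup _) _.
  rewrite size_pmap; apply: leq_trans (count_size _ _) _.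
  by rewrite -cardE card_ffun !card_ord.
move=> y [z yz]; rewrite seq_fsetE.
have Oy : Omega (\val y) by have := valP y; rewrite inE.
have zP i : exists n : 'I_N, z i = n%:Z.
  have := Ob _ Oy i; rewrite yz mxE ltr_norml => /andP[h1 h2].
  have hz : 0 < h * (z i)%:~R by lra.
  have zi0 : 0 < (z i)%:~R :> R by rewrite -(pmulr_rgt0 _ h0).
  have zN : (z i)%:~R < N%:R :> R by rewrite -(ltr_pM2l h0); lra.
  case: (z i) zi0 zN => n; last by rewrite ltr0z.
  by rewrite -pmulrn ltr_nat => _ nN; exists (Ordinal nN).
have [f Hf] := choice zP.
rewrite mem_pmap; apply/mapP; exists (finfun f : {ffun 'I_d -> 'I_N}).
  by rewrite mem_enum.
rewrite /pt (_ : \row_i _ = \val y); first by rewrite valK.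
by rewrite yz; apply/rowP => i; rewrite !mxE ffunE Hf.
Qed.

Lemma kernel_width Phi Phihat tau Cf : (0 < d)%N -> d%:R / 2 < tau ->
  compact Omega -> interior_cone_condition Omega ->
  symmetric_kernel k -> translation_invariant k Phi ->
  continuous Phi -> is_fourier_transform Phi Phihat -> 0 < Cf ->
  (forall w, Phihat w <= Cf * (1 + enorm w ^+ 2) `^ (- tau)) ->
  exists2 C0 : R, 0 < C0 & forall m, (0 < m)%N ->
  exists2 J : seq Omega, (size J <= m)%N &
    forall x, exists a : Omega -> R,
      `|ker x - \sum_(j <- J) a j *: ker j| <= C0 * m%:R `^ (- (tau / d%:R - 1 / 2)).
Proof.
move=> d0 tau2 cptO coneO ksym kPhi cPhi FPhi Cf0 Phihat_le.
have dR : 0 < d%:R :> R by rewrite ltr0n.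
have [b b0 Ob] := compact_coord_bounded cptO.
have [C1 [h0 [C10 h00 grid]]] := grid_estimate b d0 tau2 coneO cPhi FPhi Cf0 Phihat_le.
set alpha := tau / d%:R - 1 / 2.
pose beta := tau - d%:R / 2.
have beta0 : 0 < beta by rewrite subr_gt0.
have alphaE : alpha = d%:R^-1 * beta by rewrite /alpha /beta; field; rewrite gt_eqF.
pose K0 := Num.sqrt (Phi 0) + 1.
have K00 : 0 < K0 by rewrite ltr_wpDl// sqrtr_ge0.
(* The first summand is the grid estimate with h <= 4 b / nu. The second covers the finitely many m
   whose mesh exceeds [h0]. *)
exists (Num.sqrt C1 * (4 * b) `^ beta + K0 * (4 * b / h0) `^ beta).
  rewrite ltr_wpDl ?mulr_ge0 ?sqrtr_ge0 ?powR_ge0// mulr_gt0// powR_gt0//.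
  by rewrite divr_gt0// mulr_gt0.
move=> m m0.
pose nu : R := m%:R `^ d%:R^-1.
have mR : 0 < m%:R :> R by rewrite ltr0n.
have nu0 : 0 < nu by rewrite powR_gt0.
have nu1 : 1 <= nu.
  by rewrite /nu -[leLHS](powRr0 m%:R) ler_powR ?invr_ge0// ler1n.
have nud : nu ^+ d = m%:R.
  by rewrite -powR_mulrn ?powR_ge0// -powRrM mulVf ?gt_eqF// powRr1 ?ltW.
have nua : nu `^ (- beta) = m%:R `^ (- alpha).
  by rewrite alphaE -powRrM mulrN.
(* Then N^d <= m, and since nu >= 1 rounding loses at most a factor 2. *)
pose N := Num.truncn nu.
have /andP[Nnu nuN] := truncn_itv (ltW nu0); rewrite -/N in Nnu nuN.
have N1 : (0 < N)%N by rewrite truncn_ge_nat// ltW.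
have NR : 1 <= N%:R :> R by rewrite ler1n.
have nu2N : nu <= 2 * N%:R by move: nuN; rewrite -natr1; lra.
pose h := 2 * b / N%:R.
have hp : 0 < h by rewrite divr_gt0 ?mulr_gt0// (lt_le_trans ltr01).
have hnu : h <= 4 * b / nu.
  rewrite /h ler_pdivrMr ?(lt_le_trans ltr01)// mulrAC ler_pdivlMr//; nra.
have powE (a : R) : 0 <= a -> (a / nu) `^ beta = a `^ beta * nu `^ (- beta).
  move=> a0; rewrite powRM ?invr_ge0 ?(ltW nu0)//.
  by rewrite -(powR_inv1 (ltW nu0)) -powRrM mulN1r.
have [hh0|h0h] := leP h h0; last first.
  (* For a coarse mesh the zero approximation is enough: its error is at most [K0], and the second
     summand of the constant exceeds that. *)
  exists [::] => // x; exists (fun=> 0); rewrite big_nil subr0 (norm_ker _ kPhi).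
  apply: (@le_trans _ _ (K0 * (4 * b / h0) `^ beta * m%:R `^ (- alpha))); last first.
    rewrite ler_wpM2r ?powR_ge0// lerDr mulr_ge0 ?sqrtr_ge0 ?powR_ge0//.
  rewrite -nua -mulrA -powE; last by rewrite divr_ge0 ?mulr_ge0 ?ltW.
  apply: (@le_trans _ _ K0); first by rewrite lerDl.
  have one_le : 1 <= 4 * b / h0 / nu.
    rewrite mulrAC ler_pdivlMr// mul1r; exact: le_trans (ltW h0h) hnu.
  rewrite ler_peMr ?(ltW K00)// -[leLHS](powRr0 (4 * b / h0 / nu)).
  by rewrite ler_powR// ltW.
have hN : 2 * b <= h * N%:R by rewrite /h divfK// gt_eqF// (lt_le_trans ltr01).
have [X XN HX] := grid_subset hp hN Ob.
exists X => [|x].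
  by apply: leq_trans XN _; rewrite -(ler_nat R) natrX -nud lerXn2r ?nnegrE ?(ltW nu0).
have Ox : Omega (\val x) by have := valP x; rewrite inE.
have [I [c [y [Oy yg est]]]] := grid h (\val x) (introT andP (conj hp hh0)) Ox.
pose yO j : Omega := SigSub (mem_set (Oy j)).
(* Membership in the span turns the combination indexed by [I] into one with a coefficient per grid
   point. *)
have [a aE] : kernel_span X (\sum_j c j *: ker (yO j)).
  apply: kernel_span_sum => j _; apply/kernel_spanZ/kernel_span_ker/HX.
  by have [z zE] := yg j; exists z.
exists a; rewrite -aE.
apply: (@le_trans _ _ (Num.sqrt C1 * (4 * b) `^ beta * m%:R `^ (- alpha))); last first.
  by rewrite ler_wpM2r ?powR_ge0// lerDl mulr_ge0 ?powR_ge0 ?ltW.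
rewrite -nua -mulrA -powE; last by rewrite mulr_ge0// ltW.
apply: (@le_trans _ _ (Num.sqrt C1 * h `^ beta)); last first.
  rewrite ler_wpM2l ?sqrtr_ge0// ge0_ler_powR ?nnegrE ?(ltW beta0) ?(ltW hp)//.
  by apply: le_trans hnu; exact: ltW.
rewrite -(ler_pXn2r (isT : (0 < 2)%N)) ?nnegrE ?mulr_ge0 ?sqrtr_ge0 ?powR_ge0//.
rewrite exprMn sqr_sqrtr// ns_normE -(powR_mulrn _ (powR_ge0 _ _)) -powRrM.
rewrite (_ : beta * 2%:R = 2 * tau - d%:R); last by rewrite /beta; field.
apply: le_trans est; rewrite le_eqVlt; apply/orP; left; apply/eqP.
pose yo (l : option I) := oapp yO x l.
have -> : ker x - \sum_j c j *: ker (yO j) =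
    \sum_l (oapp (fun j => - c j) 1 l) *: ker (yo l).
  by rewrite sum_option /= scale1r -sumrN; congr (_ + _); apply: eq_bigr => j _; rewrite scaleNr.
have val_yo l : \val (yo l) = oapp y (\val x) l by case: l.
rewrite (dot_lincomb _ _ ksym kPhi); apply: eq_bigr => p _.
by rewrite !val_yo.
Qed.
End kernels_on_domains.

(** * Essential suprema *)

Section essential_supremum_on_domains.
Context {R : realType} {d : nat} {Omega : set 'rV[R]_d} {k : Omega -> Omega -> R}
  (H : native_space k).
Local Notation leb := (@lebesgue_measure R).
Local Notation mu := (@lebesgue_measure_row R d).
Local Notation ker := (ns_ker H).
Implicit Types (X : {fset Omega}) (x y : Omega) (Phi : 'rV[R]_d -> R) (g : Omega -> R).

Lemma extend0_val g x : extend0 g (\val x) = g x.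
Proof. by rewrite /extend0 /valL_ /= oinv_set_val valK. Qed.

Lemma extend0_notin g w : ~ Omega w -> extend0 g w = 0.
Proof.
move=> Ow; rewrite /extend0 /valL_ /= oinv_set_val insubF//.
by apply/negbTE; rewrite notin_setE.
Qed.

Lemma linf_norm_le g b : 0 <= b -> (forall x, `|g x| <= b) -> (linf_norm g <= b%:E)%E.
Proof.
move=> b0 gb; rewrite /linf_norm unlock; case: ifPn => _; last by rewrite lee_fin.
apply/ess_supP; apply: nearW => w /=; rewrite lee_fin.
have [Ow|Ow] := pselect (Omega w); last by rewrite extend0_notin// normr0.
rewrite (_ : w = \val (SigSub (mem_set Ow) : Omega))//.
by rewrite extend0_val.
Qed.

Definition box (c : 'rV[R]_d) (r : R) : set 'rV[R]_d :=
  [set w | forall i, c 0 i - r <= w 0 i <= c 0 i + r].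

Lemma box_measure_gt0 c r : 0 < r -> (0 < mu (box c r))%E.
Proof.
move=> r0; pose A i : set R := `[(c 0 i - r)%R, (c 0 i + r)%R]%classic.
rewrite (_ : box c r = [set w | forall i, A i (w 0 i)]); last first.
  by apply/seteqP; split=> w Hw i; have := Hw i; rewrite /A /= in_itv.
rewrite lebesgue_measure_row_box => [|i]; last exact: measurable_itv.
rewrite (eq_bigr (fun=> (r + r)%:E)) => [|i _].
  by rewrite prodEFin lte_fin; apply: prodr_gt0 => i _; rewrite addr_gt0.
rewrite /A lebesgue_measure_itv/= lte_fin.
rewrite ifT; last by lra.
by rewrite -EFinB; congr EFin; ring.
Qed.

Lemma measurable_box c r : measurable (box c r).
Proof.
rewrite (_ : box c r = \bigcap_(i : 'I_d) ((fun x : 'rV[R]_d => x 0 i) @^-1`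
    `[(c 0 i - r)%R, (c 0 i + r)%R]%classic)).
  apply: fin_bigcap_measurable => // i _.
  by rewrite -[X in measurable X]setTI; exact: (measurable_coord i).
apply/seteqP; split=> x /= Hx i; first by move=> _ /=; rewrite in_itv/=.
by have := Hx i I; rewrite /= in_itv/=.
Qed.

(** Moving from [w] a short way along the cone axis leaves room for a box inside the cone, even when
    [w] is a boundary point. *)
Lemma cone_box : (0 < d)%N -> interior_cone_condition Omega ->
  forall w (e : R), Omega w -> 0 < e -> exists c r, 0 < r /\
    forall v, box c r v -> Omega v /\ forall i, `|v 0 i - w 0 i| < e.
Proof.
move=> d0 /interior_cone_conditionP[c [r [/andP[c0 c1] r0 cone]]] w e Ow e0.
have dR : 0 < d%:R :> R by rewrite ltr0n.
have [xi xi1 Hxi] := cone w Ow.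
(* An offset u with |u| <= s (1 - c) / 2 keeps s xi + u in the cone and shorter than 3 s, hence
   below both [r] and [e]. *)
pose s := Num.min r e / 3.
have m0 : 0 < Num.min r e by rewrite lt_min r0.
have s0 : 0 < s by rewrite divr_gt0.
have sr : 3 * s <= r by rewrite /s mulrC divfK// ge_min lexx.
have se : 3 * s <= e by rewrite /s mulrC divfK// ge_min lexx orbT.
pose rho := s * (1 - c) / (2 * d%:R).
have rho0 : 0 < rho by rewrite divr_gt0 ?mulr_gt0// subr_gt0.
have drho : d%:R * rho = s * (1 - c) / 2 by rewrite /rho; field; rewrite gt_eqF.
exists (w + s *: xi), rho; split=> // v bv.
pose u := v - w - s *: xi.
have ur : enorm u <= s * (1 - c) / 2.
  rewrite -drho; apply: enorm_le => [|i]; first exact: ltW.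
  by have := bv i; rewrite /u !mxE ler_norml => /andP[h1 h2]; apply/andP; split; lra.
have vE : v = w + (s *: xi + u) by rewrite /u; apply/rowP => i; rewrite !mxE; ring.
have xixi : dotv xi xi = 1 by rewrite -sqr_enorm xi1 expr1n.
have h1 := enorm_add_unit u (ltW s0) xi1.
have := dotv_unit_le u xi1; rewrite ler_norml => /andP[h2 _].
split.
  rewrite vE; apply: Hxi; last by nra.
  rewrite dotvDl dotvZl xixi mulr1.
  apply: le_trans (ler_wpM2l (ltW c0) h1) _.
  have : c * enorm u <= enorm u by rewrite ler_piMl ?enorm_ge0// ltW.
  by rewrite mulrDr; move: ur h2; rewrite mulrBr mulr1; lra.
move=> i; apply: le_lt_trans (_ : enorm (s *: xi + u) < e); last by nra.
have -> : v 0 i - w 0 i = (s *: xi + u) 0 i by rewrite /u !mxE; ring.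
exact: coord_le_enorm.
Qed.

Lemma power_function_lipschitz X x y :
  power_function H X x <= power_function H X y + `|ker x - ker y|.
Proof.
apply: le_trans (power_function_min _ (projection_span X (ker y))) _.
rewrite [leRHS]addrC (_ : ker x - projection X (ker y) = (ker x - ker y) + (ker y - projection X (ker y))).
  exact: ler_normD.
by rewrite addrA subrK.
Qed.

(** The squared distance is 2 (Phi 0 - Phi (x - y)), so continuity of [Phi] at 0 yields uniform
    continuity. *)
Lemma ker_continuous Phi : symmetric_kernel k -> translation_invariant k Phi ->
  continuous Phi -> forall e, 0 < e -> exists2 r, 0 < r &
  forall x y, (forall i, `|\val y 0 i - \val x 0 i| < r) -> `|ker x - ker y| < e.
Proof.
move=> ksym kPhi cPhi e e0.
have e2 : 0 < e ^+ 2 / 2 by rewrite divr_gt0 ?exprn_gt0.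
have /cvgrPdist_lt/(_ _ e2)/nbhs_ballP[r /= r0 Hr] := cPhi 0.
exists r => // x y xy.
have Pxy : `|Phi 0 - Phi (\val x - \val y)| < e ^+ 2 / 2.
  apply: Hr; split=> // j i; rewrite ord1 /ball/= !mxE sub0r opprB.
  exact: xy.
rewrite -(ltr_pXn2r (isT : (0 < 2)%N)) ?nnegrE ?(ltW e0)//.
rewrite ns_normE dotBl !dotBr !dot_ker (ksym y x) !kPhi !subrr.
by move: Pxy; rewrite ltr_norml => /andP[h1 h2]; lra.
Qed.

(** If the power function exceeded its essential supremum at [x], continuity would make it do so on
    a box of positive measure inside [Omega] near [x]. *)
Lemma power_function_le_linf Phi X x : (0 < d)%N -> interior_cone_condition Omega ->
  symmetric_kernel k -> translation_invariant k Phi -> continuous Phi ->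
  ((power_function H X x)%:E <= linf_norm (power_function H X))%E.
Proof.
move=> d0 coneO ksym kPhi cPhi.
have Ox : Omega (\val x) by have := valP x; rewrite inE.
(* The norm of exponent +oo is an essential supremum only for a nonzero measure, and 0 by convention
   otherwise. *)
have muT : (0 < mu setT)%E.
  apply: lt_le_trans (box_measure_gt0 0 ltr01) _.
  by apply: le_measure; rewrite ?inE//; exact: measurable_box.
rewrite /linf_norm unlock muT.
set f := abse \o _; set s := ess_sup _ _.
rewrite leNgt; apply/negP => sP.
have s0 : (0 <= s)%E.
  rewrite leNgt; apply/negP => s0.
  have [N [mN N0 AN]] := ess_sup_ge mu f.
  move: muT; rewrite lt0e => /andP[/eqP + _]; apply.
  apply/eqP; rewrite eq_le measure_ge0 andbT -N0.
  apply: le_measure; rewrite ?inE// => w _; apply: AN => /= fw.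
  have := le_lt_trans fw s0; rewrite ltNge => /negP; apply.
  exact: abse_ge0.
move: s0 sP; case sE : s => [r| |]//; rewrite lte_fin lee_fin => r0 rP.
have e0 : 0 < power_function H X x - r by rewrite subr_gt0.
have [rho rho0 Hrho] := ker_continuous ksym kPhi cPhi e0.
have [c [q [q0 cq]]] := cone_box d0 coneO Ox rho0.
have [N [mN N0 AN]] := ess_sup_ge mu f.
have := box_measure_gt0 c q0; rewrite ltNge => /negP; apply.
rewrite -N0; apply: le_measure; rewrite ?inE//; first exact: measurable_box.
move=> w /cq[Ow wx]; apply: AN => /= fw.
pose y : Omega := SigSub (mem_set Ow).
have fy : f w = (power_function H X y)%:E.
  rewrite /f /= (_ : w = \val y)// extend0_val ger0_norm//.
  exact: power_function_ge0.
rewrite -/s sE fy lee_fin in fw.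
have := power_function_lipschitz X x y.
have := Hrho x y wx; lra.
Qed.
End essential_supremum_on_domains.

(** * The rate of stabilized algorithms *)

Theorem theorem7 (R : realType) (d : nat) (Omega : set 'rV[R]_d)
    (k : Omega -> Omega -> R) (Phi : 'rV[R]_d -> R) (tau : R)
    (H : native_space k) (f : H) :
  (0 < d)%N ->
  compact Omega ->
  interior_cone_condition Omega ->
  lipschitz_boundary Omega ->
  symmetric_kernel k ->
  translation_invariant k Phi ->
  finite_smoothness H Phi tau ->
  exists2 c1 : R, 0 < c1 &
    let CP := 2 `^ (5 * tau / d%:R - 1 / 2) * c1 in
    forall (gamma : R) (eta : nat -> H -> {fset Omega} -> Omega -> R)
      (XN : nat -> {fset Omega}),
      0 < gamma <= 1 ->
      (forall N g X x, 0 <= eta N g X x) ->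
      stabilized_run gamma eta f XN ->
      forall N : nat, (0 < N)%N ->
        (linf_norm (power_function H (XN N))
           <= (CP * gamma ^- 2 * N%:R `^ (1 / 2 - tau / d%:R))%:E)%E
        /\
        (linf_norm (ns_eval (f - projection (XN N) f)%R)
           <= (CP * gamma ^- 2 * N%:R `^ (1 / 2 - tau / d%:R) * `|f|)%:E)%E.
Proof.
move=> d0 cptO coneO _ ksym kPhi [tau2 cPhi [Phihat [cf [Cf [FPhi _ Cf0 Phihat_bnd]]]] _].
have Phihat_le w : Phihat w <= Cf * (1 + enorm w ^+ 2) `^ (- tau).
  by have /andP[] := Phihat_bnd w.
have [C0 C00 width] := kernel_width H d0 tau2 cptO coneO ksym kPhi cPhi FPhi Cf0 Phihat_le.
set alpha := tau / d%:R - 1 / 2 in width.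
have alpha0 : 0 < alpha.
  by rewrite subr_gt0 ltr_pdivlMr ?ltr0n// mulrAC mul1r.
pose K0 := Num.sqrt (Phi 0) + 1.
have K00 : 0 < K0 by rewrite ltr_wpDl// sqrtr_ge0.
have kK x : `|ns_ker H x| <= K0 by rewrite (norm_ker H x kPhi) lerDl.
have t0 : 0 < 2 `^ (- alpha) :> R by rewrite powR_gt0.
pose C := (2 * C0 / (2 `^ (- alpha)) ^+ 3 + K0 / 2 `^ (- alpha)) / 2 `^ (- alpha).
have C_gt0 : 0 < C.
  by rewrite divr_gt0// addr_gt0// divr_gt0 ?mulr_gt0 ?exprn_gt0.
have P0 : 0 < 2 `^ (5 * tau / d%:R - 1 / 2) :> R by rewrite powR_gt0.
(* The explicit power of 2 in [CP] is divided out, so that [CP] equals the constant [C] of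
   [weak_greedy_rate]. *)
exists (C / 2 `^ (5 * tau / d%:R - 1 / 2)); first by rewrite divr_gt0.
move=> CP gamma eta XN g01 _ [XN0 run] N N0.
have CPE : CP = C by rewrite /CP mulrC divfK// gt_eqF.
(* Membership in [stabilized_domain] compares with an essential supremum, which
   [power_function_le_linf] turns into a bound at every point, whatever the criterion [eta]
   selects. *)
have wg : weak_greedy H gamma XN.
  move=> n; have [x [xd _ XE]] := run n; exists x => // y.
  rewrite -lee_fin EFinM; apply: le_trans xd; apply: lee_wpmul2l.
    by rewrite lee_fin; case/andP: g01 => /ltW.
  exact: (power_function_le_linf H _ _ d0 coneO ksym kPhi cPhi).
have rate y : power_function H (XN N) y <= CP * gamma ^- 2 * N%:R `^ (1 / 2 - tau / d%:R).
  rewrite CPE -[1 / 2 - _]opprB -/alpha.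
  exact: (weak_greedy_rate wg g01 alpha0 C00 K00 kK width).
have b0 : 0 <= CP * gamma ^- 2 * N%:R `^ (1 / 2 - tau / d%:R).
  by rewrite mulr_ge0 ?powR_ge0// mulr_ge0 ?invr_ge0 ?sqr_ge0// CPE ltW.
split; apply: linf_norm_le => //.
- by move=> x; rewrite ger0_norm ?power_function_ge0.
- exact: mulr_ge0.
- move=> x; apply: le_trans (interpolation_error _ _ _) _.
  by rewrite ler_wpM2r.
Qed.
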